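(* Let $\mathbb{F}$ be a field of arbitrary characteristic, and let $\Theta\colon (A,d,Q)\to (A',d',Q')$ be a weak equivalence in the category $\widehat{\mathsf{As}}[1]_\infty$ of complete shifted $A_\infty$-algebras over $\mathbb{F}$ and filtered $\infty$-morphisms. Then the induced map of nerves $\mathcal{N}_\bullet(\Theta)\colon \mathcal{N}_\bullet(A)\to\mathcal{N}_\bullet(A')$ is a homotopy equivalence of simplicial sets.
   Context: Conventions: $\mathbb{F}$ is a field; graded objects are $\mathbb{Z}$-graded and unbounded, differentials have degree $+1$, and the Koszul sign rule is used. A complete cochain complex is a cochain complex $(A,d)$ over $\mathbb{F}$ with a descending filtration by subcomplexes $A=\mathcal{F}_1A\supseteq\mathcal{F}_2A\supseteq\cdots$ such that $A=\varprojlim_n A/\mathcal{F}_nA$. Morphisms are filtration-preserving chain maps. For a graded vector space $V$ let $\bar T(V)=\bigoplus_{k\ge1}V^{\otimes k}$ with the deconcatenation coproduct. A complete shifted $A_\infty$-algebra $(A,d,Q)$ is a complete cochain complex $(A,d)$ with a degree $1$ coderivation $Q$ of $\bar T(A)$, $Q^2=0$, with structure maps $Q^1_n\colon A^{\otimes n}\to A$ (the restriction to $A^{\otimes n}$ of $Q$ followed by projection to $A$), such that $Q^1_1=d$ and $Q^1_n(\mathcal{F}_{i_1}A\otimes\cdots\otimes\mathcal{F}_{i_n}A)\subseteq\mathcal{F}_{i_1+\cdots+i_n}A$ for all $n$. A filtered $\infty$-morphism $\Phi\colon (A,d,Q)\to(A',d',Q')$ is a degree $0$ coalgebra morphism $\bar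 T(A)\to\bar T(A')$ with $\Phi Q=Q'\Phi$ whose structure maps $\Phi^1_n\colon A^{\otimes n}\to A'$ satisfy $\Phi^1_n(\mathcal{F}_{i_1}A\otimes\cdots\otimes\mathcal{F}_{i_n}A)\subseteq\mathcal{F}_{i_1+\cdots+i_n}A'$. These form the category $\widehat{\mathsf{As}}[1]_\infty$. The linear term $\Phi^1_1$ is a morphism of complete cochain complexes. $\Phi$ is a weak equivalence if $\Phi^1_1|_{\mathcal{F}_nA}\colon(\mathcal{F}_nA,d)\to(\mathcal{F}_nA',d')$ is a quasi-isomorphism for all $n\ge1$. Maurer–Cartan set: $\mathrm{MC}_{\mathrm{As}}(A)=\{a\in A^0 : \sum_{n\ge1}Q^1_n(a^{\otimes n})=0\}$; an $\infty$-morphism $\Phi$ induces $\mathrm{MC}_{\mathrm{As}}(A)\to\mathrm{MC}_{\mathrm{As}}(A')$, $a\mapsto\sum_{n\ge1}\Phi^1_n(a^{\otimes n})$. Tensor products: for a finite-dimensional dg associative algebra $(B,\delta,\cdot)$, $A\otimes B$ is a complete shifted $A_\infty$-algebra with filtration $\mathcal{F}_nA\otimes B$, differential $d\otimes\mathrm{id}+\mathrm{id}\otimes\delta$, and for $k\ge2$ structure maps $(x_1\otimes b_1,\dots,x_k\otimes b_k)\mapsto\pm Q^1_k(x_1,\dots,x_k)\otimes b_1\cdots b_k$ (Koszul sign). An $\infty$-morphism $\Phi$ induces $\Phi_B$ with structure maps $(x_1\otimes b_1,\dots,x_k\otimes b_k)\mapsto\pm\Phi^1_k(x_1,\dots,x_k)\otimes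 b_1\cdots b_k$. $N^\ast(\Delta^n)$ is the dg algebra of normalized $\mathbb{F}$-valued cochains on the standard $n$-simplex: it has basis $\varphi_\sigma$ dual to the nondegenerate simplices $\sigma=(i_0<\cdots<i_k)$ of $\Delta^n$, $\varphi_\sigma$ in degree $k$; $\delta\varphi_\sigma=\sum_\tau\sum_{i}(-1)^i c_{\tau,i}\varphi_\tau$ (sum over nondegenerate $(k+1)$-simplices $\tau$ and $0\le i\le k+1$, $c_{\tau,i}=1$ if $d_i\tau=\sigma$, else $0$); the product is the cup product $(\phi\smile\psi)(i_0<\cdots<i_{k+\ell})=\phi(i_0<\cdots<i_k)\psi(i_k<\cdots<i_{k+\ell})$. $N^\ast(\Delta^\bullet)$ is a simplicial dg algebra by restriction. The nerve of $A$ is the simplicial set $\mathcal{N}_n(A)=\mathrm{MC}_{\mathrm{As}}(A\otimes N^\ast(\Delta^n))$; it is functorial on $\widehat{\mathsf{As}}[1]_\infty$ and is a Kan simplicial set. *)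

(* Defs.v *)
From HB Require Import structures.
From mathcomp Require Import all_boot all_algebra.
From mathcomp Require Import ring_quotient freeg boolp zify.

Set Implicit Arguments.
Unset Strict Implicit.
Unset Printing Implicit Defensive.

Import GRing.Theory.

Local Open Scope ring_scope.

Inductive span (F : fieldType) (V : lmodType F) (S : V -> Prop) : V -> Prop :=
| span0 : span S 0
| spanS (c : F) (u v : V) : S u -> span S v -> span S (c *: u + v).

Section Span.
Context (F : fieldType) (V : lmodType F) (S : V -> Prop).

Lemma span_linear c u v : span S u -> span S v -> span S (c *: u + v).
Proof.
move=> Su; elim: Su c v => [|a x y Sx _ IH] c v Sv; first by rewrite scaler0 add0r.
by rewrite scalerDr scalerA -addrA; apply: spanS => //; apply: IH.
Qed.

Lemma span_gen u : S u -> span S u.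
Proof. by move=> Su; rewrite -[u]scale1r -[1 *: u]addr0; apply: spanS => //; apply: span0. Qed.

Definition spanp : {pred V} := fun x => `[< span S x >].

Lemma spanpP x : reflect (span S x) (x \in spanp).
Proof. exact: asboolP. Qed.

Fact spanp_zmod : zmod_closed spanp.
Proof.
split; first by apply/spanpP; apply: span0.
move=> x y /spanpP Sx /spanpP Sy; apply/spanpP.
by rewrite addrC -scaleN1r; apply: span_linear.
Qed.

HB.instance Definition _ := GRing.isZmodClosed.Build V spanp spanp_zmod.

Lemma spanp_scale c x : x \in spanp -> c *: x \in spanp.
Proof.
move=> /spanpP Sx; apply/spanpP; rewrite -[_ *: _]addr0.
by apply: span_linear => //; apply: span0.
Qed.

Lemma span_ind_linear (W : lmodType F) (f g : {linear V -> W}) x :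
  (forall u, S u -> f u = g u) -> span S x -> f x = g x.
Proof.
by move=> fg; elim=> [|c u v Su _ IH]; rewrite ?linear0 // !linearP fg // IH.
Qed.

End Span.

Section QuotientModule.
Context (F : fieldType) (V : lmodType F) (S : V -> Prop).
Local Open Scope quotient_scope.

Definition quomod : Type := @Quotient.quot V (spanp S).

HB.instance Definition _ := GRing.Zmodule.on quomod.
HB.instance Definition _ := EqQuotient.on quomod.

Definition qpi (x : V) : quomod := \pi_quomod x.

Lemma qpi_eq x y : qpi x = qpi y <-> span S (x - y).
Proof.
split=> [/eqP|Sxy].
  by rewrite /qpi -Quotient.idealrBE => /spanpP.
by apply/eqP; rewrite /qpi -Quotient.idealrBE; apply/spanpP.
Qed.

Lemma qpi_repr (x : quomod) : qpi (repr x) = x.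
Proof. exact: reprK. Qed.

Fact qpi_zmod : zmod_morphism qpi.
Proof. exact: pi_is_zmod_morphism. Qed.
HB.instance Definition _ := GRing.isZmodMorphism.Build V quomod qpi qpi_zmod.

Definition qscale (c : F) (x : quomod) : quomod := qpi (c *: repr x).

Lemma qscaleE c x : qscale c (qpi x) = qpi (c *: x).
Proof.
apply/qpi_eq; rewrite -scalerBr; apply/spanpP/spanp_scale/spanpP.
by apply/qpi_eq; rewrite qpi_repr.
Qed.

Fact qscaleA a b x : qscale a (qscale b x) = qscale (a * b) x.
Proof. by rewrite -(qpi_repr x) !qscaleE scalerA. Qed.
Fact qscale1 : left_id 1 qscale.
Proof. by move=> x; rewrite -(qpi_repr x) !qscaleE scale1r. Qed.
Fact qscaleDr : right_distributive qscale +%R.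
Proof.
by move=> a x y; rewrite -(qpi_repr x) -(qpi_repr y) -raddfD !qscaleE scalerDr raddfD.
Qed.
Fact qscaleDl x : {morph qscale^~ x : a b / a + b}.
Proof. by move=> a b /=; rewrite -(qpi_repr x) !qscaleE scalerDl raddfD. Qed.

HB.instance Definition _ :=
  GRing.Zmodule_isLmodule.Build F quomod qscaleA qscale1 qscaleDr qscaleDl.

Fact qpi_scalable : scalable qpi.
Proof. by move=> c x; rewrite -qscaleE. Qed.
HB.instance Definition _ := GRing.isScalable.Build F V quomod *:%R qpi qpi_scalable.

Section Lift.
Context (W : lmodType F) (f : {linear V -> W}).

Definition qlift (_ : forall x, S x -> f x = 0) (x : quomod) : W := f (repr x).

Lemma qliftE (fS : forall x, S x -> f x = 0) x : qlift fS (qpi x) = f x.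
Proof.
apply/eqP; rewrite -subr_eq0 /qlift -linearB; apply/eqP.
have : span S (repr (qpi x) - x) by apply/qpi_eq; rewrite qpi_repr.
elim=> [|c u v Su _ IH]; first by rewrite linear0.
by rewrite linearP fS // scaler0 add0r.
Qed.

Fact qlift_linear (fS : forall x, S x -> f x = 0) : linear (qlift fS).
Proof.
move=> c x y; rewrite -[in LHS](qpi_repr x) -[in LHS](qpi_repr y) -linearP qliftE.
by rewrite linearP.
Qed.
HB.instance Definition _ (fS : forall x, S x -> f x = 0) :=
  GRing.isLinear.Build F quomod W *:%R (qlift fS) (qlift_linear fS).
End Lift.
End QuotientModule.

Section FreeLift.
Context (F : fieldType) (K : choiceType) (W : lmodType F) (g : K -> W).

Definition flift (x : {freeg K / F}) : W := fglift g x.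

Lemma freegUZ (c k : F) (x : K) : c *: (<< k *g x >> : {freeg K / F}) = << c * k *g x >>.
Proof. by apply/eqP/freeg_eqP => y; rewrite coeffZ !coeffU mulrA. Qed.

Lemma fliftU c x : flift << c *g x >> = c *: g x.
Proof. exact: liftU. Qed.

Fact flift_linear : linear flift.
Proof.
have fD : {morph flift : x y / x + y}.
  move=> x y; have B : zmod_morphism flift by exact: lift_is_additive.
  have f0 : flift 0 = 0 by rewrite -(subrr 0) B subrr.
  have fN z : flift (- z) = - flift z by rewrite -[- z]sub0r B f0 sub0r.
  by rewrite -[y]opprK B !fN.
have f0 : flift 0 = 0.
  by apply: (addrI (flift 0)); rewrite -fD !addr0.
move=> c x y; rewrite fD; congr (_ + _).
have fsum (s : seq K) (h : K -> {freeg K / F}) :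
    flift (\sum_(z <- s) h z) = \sum_(z <- s) flift (h z).
  by elim: s => [|a s IH]; rewrite ?big_nil // !big_cons fD IH.
rewrite -(freeg_sumE x) scaler_sumr !fsum scaler_sumr; apply: eq_bigr => z _.
by rewrite freegUZ !fliftU scalerA.
Qed.
HB.instance Definition _ := GRing.isLinear.Build F {freeg K / F} W *:%R flift flift_linear.
End FreeLift.

Section Presented.
Context (F : fieldType) (K : choiceType) (S : {freeg K / F} -> Prop).

Definition pgen (x : K) : quomod S := qpi S << x >>.

Lemma quomod_span (x : quomod S) : span (fun u => exists k, u = pgen k) x.
Proof.
rewrite -(qpi_repr x) -(freeg_sumE (repr x)) raddf_sum /=.
elim: (dom _) => [|k s IH]; first by rewrite big_nil; apply: span0.
rewrite big_cons -[coeff k _]mulr1 -freegUZ linearZ /=.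
by apply: spanS => //; exists k.
Qed.

Lemma pgen_ext (W : lmodType F) (f g : {linear quomod S -> W}) :
  (forall k, f (pgen k) = g (pgen k)) -> f =1 g.
Proof.
by move=> fg x; apply: (span_ind_linear _ (quomod_span x)) => u [k ->].
Qed.

Section Lift.
Context (W : lmodType F) (g : K -> W) (gS : forall r, S r -> flift g r = 0).
(* Locked only so that simplification does not unfold maps defined on generators. *)
Definition plift : {linear quomod S -> W} :=
  locked (qlift gS : {linear quomod S -> W}).
Lemma pliftE x : plift (pgen x) = g x.
Proof. by rewrite /plift -lock [LHS](qliftE gS) /= fliftU scale1r. Qed.
End Lift.
End Presented.

Section Tensor.
Context (F : fieldType) (M N : lmodType F).

Definition fpair (x : M) (y : N) : {freeg (M * N)%type / F} := << (x, y) >>.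

Inductive tens_rel : {freeg (M * N)%type / F} -> Prop :=
| tens_rel_l c x x' y :
    tens_rel (fpair (c *: x + x') y - (c *: fpair x y + fpair x' y))
| tens_rel_r c x y y' :
    tens_rel (fpair x (c *: y + y') - (c *: fpair x y + fpair x y')).

Definition tens : lmodType F := quomod tens_rel.

Definition pure (x : M) (y : N) : tens := pgen tens_rel (x, y).

Lemma pure_linear_l y : linear (pure^~ y).
Proof.
move=> c x x'; rewrite /pure /pgen -linearP.
by apply/qpi_eq/span_gen; apply: tens_rel_l.
Qed.

Lemma pure_linear_r x : linear (pure x).
Proof.
move=> c y y'; rewrite /pure /pgen -linearP.
by apply/qpi_eq/span_gen; apply: tens_rel_r.
Qed.

Lemma tens_span (u : tens) : span (fun u => exists x y, u = pure x y) u.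
Proof.
elim: (quomod_span u) => [|c v w [[x y] ->] _ IH]; first exact: span0.
by apply: spanS => //; exists x, y.
Qed.

Lemma tens_ext (W : lmodType F) (f g : {linear tens -> W}) :
  (forall x y, f (pure x y) = g (pure x y)) -> f =1 g.
Proof. by move=> fg; apply: pgen_ext => -[x y]; apply: fg. Qed.

Section Lift.
Context (W : lmodType F) (g : M -> N -> W).

Definition bilin := (forall y, linear (g^~ y)) /\ (forall x, linear (g x)).

Fact tens_lift_rel : bilin -> forall r, tens_rel r -> flift (fun p => g p.1 p.2) r = 0.
Proof.
move=> [gl gr] r [c x x' y|c x y y']; rewrite linearB linearP /= !fliftU !scale1r /=.
  by rewrite (gl y c x x') subrr.
by rewrite gr subrr.
Qed.

Definition tens_lift (gb : bilin) : {linear tens -> W} := plift (tens_lift_rel gb).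

Lemma tens_liftE (gb : bilin) x y : tens_lift gb (pure x y) = g x y.
Proof. exact: pliftE. Qed.
End Lift.
End Tensor.

Section TensorMap.
Context (F : fieldType) (M M' N N' : lmodType F).
Context (f : {linear M -> M'}) (g : {linear N -> N'}).

Fact tmap_bilin : bilin (fun x y => pure (f x) (g y)).
Proof.
by split=> [y|x] c u v /=; rewrite linearP ?pure_linear_l ?pure_linear_r.
Qed.

Definition tmap : {linear tens M N -> tens M' N'} := tens_lift tmap_bilin.

Lemma tmapE x y : tmap (pure x y) = pure (f x) (g y).
Proof. exact: tens_liftE. Qed.
End TensorMap.

Section Words.
Context (F : fieldType) (V : lmodType F).

Definition gword (s : seq V) : {freeg (seq V) / F} := << s >>.

(* The empty word is killed, so the quotient is the sum of the V^{(x)k} over k >= 1;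
   word [:: x1; ...; xk] is the tensor x1 (x) ... (x) xk. *)
Inductive word_rel : {freeg (seq V) / F} -> Prop :=
| word_rel_nil : word_rel (gword [::])
| word_rel_lin s t c x y :
    word_rel (gword (s ++ (c *: x + y) :: t)
              - (c *: gword (s ++ x :: t) + gword (s ++ y :: t))).

Definition Tbar : lmodType F := quomod word_rel.

Definition word (s : seq V) : Tbar := pgen word_rel s.

Lemma word_nil : word [::] = 0.
Proof.
rewrite /word /pgen -[RHS](raddf0 (qpi word_rel)).
by apply/qpi_eq; rewrite subr0; apply/span_gen/word_rel_nil.
Qed.

Definition multilin (W : lmodType F) (g : seq V -> W) :=
  g [::] = 0 /\
  forall s t c x y,
    g (s ++ (c *: x + y) :: t) = c *: g (s ++ x :: t) + g (s ++ y :: t).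

Lemma word_multilin : multilin word.
Proof.
split=> [|s t c x y]; first exact: word_nil.
by rewrite /word /pgen -linearP; apply/qpi_eq/span_gen; apply: word_rel_lin.
Qed.

Lemma Tbar_span (u : Tbar) : span (fun u => exists s, u = word s) u.
Proof.
elim: (quomod_span u) => [|c v w [s ->] _ IH]; first exact: span0.
by apply: spanS => //; exists s.
Qed.

Lemma Tbar_ext (W : lmodType F) (f g : {linear Tbar -> W}) :
  (forall s, f (word s) = g (word s)) -> f =1 g.
Proof. exact: pgen_ext. Qed.

Section Lift.
Context (W : lmodType F) (g : seq V -> W).

Fact Tlift_rel : multilin g -> forall r, word_rel r -> flift g r = 0.
Proof.
move=> [g0 gl] r [|s t c x y]; first by rewrite /gword fliftU g0 scaler0.
by rewrite linearB linearP /= !fliftU !scale1r gl subrr.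
Qed.

Definition Tlift (gm : multilin g) : {linear Tbar -> W} := plift (Tlift_rel gm).

Lemma TliftE (gm : multilin g) s : Tlift gm (word s) = g s.
Proof. exact: pliftE. Qed.
End Lift.

Fact Tproj_multilin : multilin (fun s : seq V => if s is [:: x] then x else 0).
Proof.
split=> // -[|a [|b s]] [|d t] c x y //=; rewrite ?scaler0 ?addr0 //.
Qed.

Definition Tproj : {linear Tbar -> V} := Tlift Tproj_multilin.

Lemma TprojE s : Tproj (word s) = if s is [:: x] then x else 0.
Proof. exact: TliftE. Qed.

(* Only the proper splittings: the coproduct of the non-unital tensor coalgebra. *)
Definition deconc (s : seq V) : tens Tbar Tbar :=
  \sum_(1 <= i < size s) pure (word (take i s)) (word (drop i s)).

Fact deconc_multilin : multilin deconc.
Proof.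
split=> [|s t c x y]; first by rewrite /deconc big_geq.
rewrite /deconc !size_cat /= scaler_sumr -big_split /=.
apply: eq_bigr => i _; rewrite !take_cat !drop_cat; case: ltnP => lti.
  by rewrite word_multilin.2 pure_linear_r.
case: (i - size s)%N => [|j] /=.
  by rewrite (word_multilin.2 [::] t) pure_linear_r.
by rewrite word_multilin.2 pure_linear_l.
Qed.

Definition coprod : {linear Tbar -> tens Tbar Tbar} := Tlift deconc_multilin.

Lemma coprodE s : coprod (word s) = deconc s.
Proof. exact: TliftE. Qed.

Fact Tcons_multilin_r (x : V) :
  multilin (fun s => if s is [::] then 0 else word (x :: s)).
Proof.
by split=> // -[|a s] t c u v; rewrite -?cat_cons (word_multilin.2 (x :: _)).
Qed.

Definition Tcons (x : V) : {linear Tbar -> Tbar} := Tlift (Tcons_multilin_r x).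

Lemma TconsE x s : Tcons x (word s) = if s is [::] then 0 else word (x :: s).
Proof. exact: TliftE. Qed.

Lemma Tcons_linear u : linear (fun x => Tcons x u).
Proof.
move=> c x y; elim: (Tbar_span u) => [|a v w [s ->] _ IH] /=.
  have E z : Tcons z 0 = 0 by exact: linear0.
  by rewrite !E scaler0 addr0.
have E z : Tcons z (a *: word s + w) = a *: Tcons z (word s) + Tcons z w.
  by exact: linearP.
rewrite /= in IH; rewrite !E IH !TconsE.
case: s {E} => [|b s]; first by rewrite !scaler0 !add0r.
rewrite (word_multilin.2 [::]) !scalerDr !scalerA (mulrC a c) -!addrA; congr (_ + _).
by rewrite addrCA.
Qed.
End Words.

Section WordMap.
Context (F : fieldType) (V W : lmodType F) (f : {linear V -> W}).

Fact Tmap_multilin : multilin (fun s => word (map f s)).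
Proof.
split=> [|s t c x y]; first exact: word_nil.
rewrite !map_cat /= linearP; exact: (proj2 (@word_multilin F W)).
Qed.

Definition Tmap : {linear Tbar V -> Tbar W} := Tlift Tmap_multilin.

Lemma TmapE s : Tmap (word s) = word (map f s).
Proof. exact: TliftE. Qed.
End WordMap.

(* M is the total space of a Z-graded vector space; gproj i is the projection onto
   the component of degree i, and every element is the finite sum of its
   components. *)
Record grading (F : fieldType) (M : lmodType F) := Grading {
  gproj : int -> {linear M -> M};
  gprojK : forall i j x, gproj i (gproj j x) = if i == j then gproj j x else 0;
  gproj_fin : forall x, exists s : seq int,
    uniq s && (x == \sum_(i <- s) gproj i x) }.

Definition homog (F : fieldType) (M : lmodType F) (G : grading M) (i : int) (x : M) : Prop :=
  gproj G i x = x.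

Section Graded.
Context (F : fieldType) (M : lmodType F) (G : grading M).

Definition gsupp (x : M) : seq int := xchoose (gproj_fin G x).

Lemma gsupp_uniq x : uniq (gsupp x).
Proof. by case/andP: (xchooseP (gproj_fin G x)). Qed.

Lemma gsuppE x : x = \sum_(i <- gsupp x) gproj G i x.
Proof. by apply/eqP; case/andP: (xchooseP (gproj_fin G x)). Qed.

Lemma gproj_out i x : i \notin gsupp x -> gproj G i x = 0.
Proof.
move=> ni; rewrite [in LHS](gsuppE x) raddf_sum big_seq big1 // => j js /=.
by rewrite gprojK; case: eqP => // ij; rewrite ij js in ni.
Qed.

Lemma gproj_homog i x : homog G i (gproj G i x).
Proof. by rewrite /homog gprojK eqxx. Qed.

Section Lift.
Context (W : lmodType F) (f : int -> {linear M -> W}).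

(* The map given by f i on the component of degree i. *)
Definition glift (x : M) : W := \sum_(i <- gsupp x) f i (gproj G i x).

Lemma gliftE s x : uniq s -> {subset gsupp x <= s} ->
  glift x = \sum_(i <- s) f i (gproj G i x).
Proof.
move=> us sub; rewrite [RHS](bigID (fun i => i \in gsupp x)) /=.
rewrite [X in _ + X]big1 ?addr0; last first.
  by move=> i ni; rewrite gproj_out // linear0.
rewrite -big_filter; apply: perm_big; apply: uniq_perm.
- exact: gsupp_uniq.
- exact: filter_uniq.
by move=> i; rewrite mem_filter; case: (boolP (i \in gsupp x)) => // /sub ->.
Qed.

Fact glift_linear : linear glift.
Proof.
move=> c x y.
pose s := undup (gsupp (c *: x + y) ++ gsupp x ++ gsupp y).
have us : uniq s by exact: undup_uniq.
rewrite !(@gliftE s) //; try by move=> i ix; rewrite mem_undup !mem_cat ix ?orbT.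
rewrite scaler_sumr -big_split /=; apply: eq_bigr => i _.
by rewrite !linearP.
Qed.
HB.instance Definition _ := GRing.isLinear.Build F M W *:%R glift glift_linear.

Lemma glift_homog i x : homog G i x -> glift x = f i x.
Proof.
move=> hx; have E j : gproj G j x = if j == i then x else 0.
  by rewrite -{1}hx gprojK hx.
pose s := undup (i :: gsupp x).
rewrite (@gliftE s) ?undup_uniq //; last first.
  by move=> j jx; rewrite mem_undup inE jx orbT.
rewrite (bigD1_seq i) ?undup_uniq ?mem_undup ?mem_head //= E eqxx big1 ?addr0 //.
by move=> j /negbTE ji; rewrite E ji linear0.
Qed.
End Lift.

Definition ksgn (i j : int) : F := (-1) ^+ absz (i * j).

Fact kscale_linear (i j : int) : linear (fun x : M => ksgn i j *: x).
Proof. by move=> c x y; rewrite scalerDr !scalerA mulrC. Qed.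
Definition kscale (i j : int) (x : M) : M := ksgn i j *: x.
HB.instance Definition _ i j :=
  GRing.isLinear.Build F M M *:%R (kscale i j) (kscale_linear i j).

(* x |-> (-1)^(i * |x|) x: the sign of moving a symbol of degree i past x. *)
Definition ksign (i : int) : {linear M -> M} := glift (fun j => kscale i j).

Lemma ksignE i j x : homog G j x -> ksign i x = ksgn i j *: x.
Proof. exact: glift_homog. Qed.
End Graded.

Section HomogeneousWords.
Context (F : fieldType) (V : lmodType F) (G : grading V).

Inductive hword : int -> seq V -> Prop :=
| hword_nil : hword 0 [::]
| hword_cons i j x s : homog G i x -> hword j s -> hword (i + j) (x :: s).

Definition Thomog (i : int) : Tbar V -> Prop :=
  span (fun u => exists2 s, hword i s & u = word s).
End HomogeneousWords.

(* fword fil n s: the letters of s lie in F_{i1}, ..., F_{ik} with i1 + ... + ik = n. *)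
Inductive fword (V : Type) (fil : nat -> V -> Prop) : nat -> seq V -> Prop :=
| fword_nil : fword fil 0 [::]
| fword_cons i j x s : fil i x -> fword fil j s -> fword fil (i + j) (x :: s).

(* The filtration is indexed from 1: fil1 and fil_decr force fil 0 to be everything,
   so index 0 carries no information and adds no constraint below.
   fil_sep and fil_lim say that the canonical map from A^i to the inverse limit of
   A^i / F_n A^i is injective and surjective; in fil_lim, the class of u n modulo
   F_n is the n-th entry of an element of the limit. *)
Record complex (F : fieldType) := Complex {
  car :> lmodType F;
  gr : grading car;
  dif : {linear car -> car};
  dif_deg : forall i x, homog gr i x -> homog gr (i + 1) (dif x);
  dif_dif : forall x, dif (dif x) = 0;
  fil : nat -> car -> Prop;
  fil0 : forall n, fil n 0;
  fil_linear : forall n c x y, fil n x -> fil n y -> fil n (c *: x + y);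
  fil_gproj : forall n i x, fil n x -> fil n (gproj gr i x);
  fil_dif : forall n x, fil n x -> fil n (dif x);
  fil_decr : forall n x, fil n.+1 x -> fil n x;
  fil1 : forall x, fil 1 x;
  fil_sep : forall x, (forall n, fil n x) -> x = 0;
  fil_lim : forall (i : int) (u : nat -> car),
    (forall n, homog gr i (u n)) -> (forall n, fil n (u n.+1 - u n)) ->
    exists2 x, homog gr i x & forall n, fil n (x - u n) }.

(* The structure maps f^1_k, evaluated on x1 (x) ... (x) xk for s = [:: x1; ...; xk]. *)
Definition smap (F : fieldType) (V W : lmodType F) (f : {linear Tbar V -> Tbar W})
  (s : seq V) : W := Tproj W (f (word s)).

(* In aQ_coder, the second summand is (id (x) Q) with its Koszul sign:
   u (x) v |-> (-1)^|u| u (x) Q v. *)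
Record ainf (F : fieldType) := Ainf {
  acpx :> complex F;
  aQ : {linear Tbar acpx -> Tbar acpx};
  aQ_deg : forall i u, Thomog (gr acpx) i u -> Thomog (gr acpx) (i + 1) (aQ u);
  aQ_coder : forall u, coprod acpx (aQ u)
    = tmap aQ idfun (coprod acpx u)
      + tmap (Tmap (ksign (gr acpx) 1)) aQ (coprod acpx u);
  aQ_sq : forall u, aQ (aQ u) = 0;
  aQ_dif : forall x, smap aQ [:: x] = dif acpx x;
  aQ_fil : forall n s, fword (@fil F acpx) n s -> fil n (smap aQ s) }.

Record amor (F : fieldType) (A A' : ainf F) := Amor {
  aphi : {linear Tbar A -> Tbar A'};
  aphi_deg : forall i u, Thomog (gr A) i u -> Thomog (gr A') i (aphi u);
  aphi_coprod : forall u, coprod A' (aphi u) = tmap aphi aphi (coprod A u);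
  aphi_Q : forall u, aphi (aQ A u) = aQ A' (aphi u);
  aphi_fil : forall n s, fword (@fil F A) n s -> fil n (smap aphi s) }.

Section Cohomology.
Context (F : fieldType) (C : complex F).

Definition cocycle (n : nat) (i : int) (x : C) : Prop :=
  [/\ homog (gr C) i x, fil n x & dif C x = 0].

Definition cohomologous (n : nat) (i : int) (x y : C) : Prop :=
  exists z : C, [/\ homog (gr C) (i - 1) z, fil n z & x - y = dif C z].
End Cohomology.

Definition fil_quasi_iso (F : fieldType) (C C' : complex F) (f : C -> C') (n : nat) : Prop :=
  forall i : int,
    (forall x y : C, cocycle n i x -> cocycle n i y ->
       cohomologous n i (f x) (f y) -> cohomologous n i x y) /\
    (forall x' : C', cocycle n i x' ->
       exists2 x : C, cocycle n i x & cohomologous n i x' (f x)).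

Definition weak_equivalence (F : fieldType) (A A' : ainf F) (Phi : amor A A') : Prop :=
  forall n, (0 < n)%N -> fil_quasi_iso (fun x : A => smap (aphi Phi) [:: x]) n.

Record dga (F : fieldType) := Dga {
  dalg :> algType F;
  dgr : grading dalg;
  dfin : exists s : seq dalg, forall b : dalg, span (fun c => c \in s) b;
  d_one : homog dgr 0 1;
  d_mul : forall i j b c, homog dgr i b -> homog dgr j c -> homog dgr (i + j) (b * c);
  ddelta : {linear dalg -> dalg};
  ddelta_deg : forall i b, homog dgr i b -> homog dgr (i + 1) (ddelta b);
  ddelta_sq : forall b, ddelta (ddelta b) = 0;
  d_leibniz : forall i b c, homog dgr i b ->
    ddelta (b * c) = ddelta b * c + ksgn F i 1 *: (b * ddelta c) }.

Section TensorStructure.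
Context (F : fieldType) (A : complex F) (B : dga F).

Definition lmulB (b c : B) : B := b * c.
Fact lmulB_linear b : linear (lmulB b).
Proof. by move=> c x y; rewrite /lmulB mulrDr -scalerAr. Qed.
HB.instance Definition _ b := GRing.isLinear.Build F B B *:%R (lmulB b) (lmulB_linear b).

Definition Tsingle (x : A) : Tbar A := word [:: x].
Fact Tsingle_linear : linear Tsingle.
Proof. by move=> c x y; apply: (proj2 (@word_multilin F A) [::] [::]). Qed.
HB.instance Definition _ := GRing.isLinear.Build F A (Tbar A) *:%R Tsingle Tsingle_linear.

(* For |b| = i: X (x) c |-> (-1)^(|b| |X|) (x X) (x) (b c). *)
Definition kcons_comp (x : A) (i : int) (b : B) :
    {linear tens (Tbar A) B -> tens (Tbar A) B} :=
  tmap (Tcons x \o Tmap (ksign (gr A) i)) (lmulB b).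

Definition kcons_at (u : tens (Tbar A) B) (x : A) (i : int) (b : B) : tens (Tbar A) B :=
  kcons_comp x i b u.

Lemma kcons_compE x i b v c :
  kcons_comp x i b (pure v c) = pure (Tcons x (Tmap (ksign (gr A) i) v)) (b * c).
Proof. exact: tmapE. Qed.

Lemma kcons_bilin u i : bilin (fun x b => kcons_at u x i b).
Proof.
rewrite /kcons_at; elim: (tens_span u) => [|a v w [X [c ->]] _ [IHl IHr]].
  have E x b : kcons_comp x i b 0 = 0 by exact: linear0.
  by split=> [b|x] c y z; rewrite !E scaler0 addr0.
have E x b : kcons_comp x i b (a *: pure X c + w)
    = a *: pure (Tcons x (Tmap (ksign (gr A) i) X)) (b * c) + kcons_comp x i b w.
  by rewrite linearP kcons_compE.
split=> [b|x] e y z; rewrite !E.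
  rewrite IHl Tcons_linear pure_linear_l !scalerDr !scalerA (mulrC a e).
  by rewrite -!addrA; congr (_ + _); rewrite addrCA.
rewrite IHr mulrDl -scalerAl pure_linear_r !scalerDr !scalerA (mulrC a e).
by rewrite -!addrA; congr (_ + _); rewrite addrCA.
Qed.

HB.instance Definition _ u x i := GRing.isLinear.Build F B (tens (Tbar A) B) *:%R
  (kcons_at u x i) ((kcons_bilin u i).2 x).

Definition kcons_pure (u : tens (Tbar A) B) (x : A) : B -> tens (Tbar A) B :=
  glift (dgr B) (fun i => kcons_at u x i).

Fact kcons_pure_bilin u : bilin (kcons_pure u).
Proof.
split=> [b|x]; last exact: linearP.
move=> c x y; rewrite /kcons_pure /glift scaler_sumr -big_split /=.
by apply: eq_bigr => i _; apply: (kcons_bilin u i).1.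
Qed.

Definition kcons (t : tens A B) (u : tens (Tbar A) B) : tens (Tbar A) B :=
  tens_lift (kcons_pure_bilin u) t.

(* (x1 (x) b1) ... (xk (x) bk) |-> +- (x1 ... xk) (x) (b1 ... bk), with the Koszul
   sign (-1)^(sum over i < j of |b_i| |x_j|). *)
Fixpoint regroup (s : seq (tens A B)) : tens (Tbar A) B :=
  match s with
  | [::] => 0
  | [:: t] => tmap Tsingle idfun t
  | t :: s' => kcons t (regroup s')
  end.

Lemma regroup1 x b : regroup [:: pure x b] = pure (word [:: x]) b.
Proof. exact: tmapE. Qed.

Lemma kconsE x i b w (c : B) : w != [::] -> homog (dgr B) i b ->
  kcons (pure x b) (pure (word w) c)
  = pure (word (x :: map (ksign (gr A) i) w)) (b * c).
Proof.
move=> w0 hb; rewrite /kcons tens_liftE /kcons_pure (glift_homog _ hb).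
by rewrite /= /kcons_at kcons_compE TmapE TconsE; case: w w0.
Qed.
End TensorStructure.

(* What the Maurer-Cartan equation of a complete shifted A-infinity algebra involves:
   the carrier, its grading, its filtration and its structure maps sop, given on
   the list of their arguments. *)
Record smaps (F : fieldType) := SMaps {
  scar :> lmodType F;
  sdeg : int -> scar -> Prop;
  sfil : nat -> scar -> Prop;
  sop : seq scar -> scar }.

Definition has_sum (F : fieldType) (V : lmodType F) (f : nat -> V -> Prop)
    (u : nat -> V) (l : V) : Prop :=
  forall p, exists N, forall k, (N <= k)%N -> f p (l - \sum_(i < k) u i).

Definition MC (F : fieldType) (S : smaps F) (a : S) : Prop :=
  sdeg 0 a /\ has_sum (@sfil F S) (fun n => sop (nseq n.+1 a)) 0.

Section TensorAlgebra.
Context (F : fieldType) (B : dga F).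

Definition tdeg (A : complex F) (i : int) : tens A B -> Prop :=
  span (fun u => exists p q x b,
    [/\ p + q = i, homog (gr A) p x, homog (dgr B) q b & u = pure x b]).

Definition tfil (A : complex F) (n : nat) : tens A B -> Prop :=
  span (fun u => exists (x : A) (b : B), fil n x /\ u = pure x b).

Definition tsmap (A A' : complex F) (f : {linear Tbar A -> Tbar A'})
    (s : seq (tens A B)) : tens A' B :=
  tmap (Tproj A' \o f) idfun (regroup s).

(* On one letter the first summand is d (x) id and the second is id (x) delta,
   x (x) b |-> (-1)^|x| x (x) delta b. *)
Definition tensQ (A : ainf F) (s : seq (tens A B)) : tens A B :=
  tsmap (aQ A) s
  + (if s is [:: t] then tmap (ksign (gr A) 1) (ddelta B) t else 0).

Definition tens_ainf (A : ainf F) : smaps F :=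
  SMaps (@tdeg A) (@tfil A) (@tensQ A).
End TensorAlgebra.

Section Cochains.
Context (F : fieldType) (n : nat).

(* A nondegenerate simplex i0 < ... < ik is recorded by its vertex set. *)
Definition simplex := {s : {set 'I_n.+1} | s != set0}.

Definition cochain := {ffun simplex -> F^o}.

HB.instance Definition _ := GRing.Lmodule.on cochain.

Implicit Types (f g h : cochain) (s : {set 'I_n.+1}) (u v w : 'I_n.+1).

(* Evaluation extended by 0 to the empty set, so that vertices have no faces. *)
Definition ceval f s : F := if insub s is Some sigma then f sigma else 0.

Definition cmk (e : {set 'I_n.+1} -> F) : cochain := [ffun sigma => e (val sigma)].

Lemma ceval0 f : ceval f set0 = 0.
Proof. by rewrite /ceval insubF ?eqxx. Qed.

Lemma ceval_val f (sigma : simplex) : ceval f (val sigma) = f sigma.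
Proof. by rewrite /ceval valK. Qed.

Lemma ceval_mk e s : e set0 = 0 -> ceval (cmk e) s = e s.
Proof.
move=> e0; case: (eqVneq s set0) => [->|s0]; first by rewrite ceval0 e0.
by rewrite /ceval insubT ffunE.
Qed.

Lemma cochainP f g : (forall s, ceval f s = ceval g s) -> f = g.
Proof. by move=> fg; apply/ffunP => sigma; rewrite -!ceval_val fg. Qed.

Lemma cevalD f g s : ceval (f + g) s = ceval f s + ceval g s.
Proof. by rewrite /ceval; case: insubP => [x _ _|_]; rewrite ?addr0 // ffunE. Qed.
Lemma cevalZ c f s : ceval (c *: f) s = c * ceval f s.
Proof. by rewrite /ceval; case: insubP => [x _ _|_]; rewrite ?mulr0 // ffunE. Qed.
Lemma ceval_sum (I : Type) (r : seq I) (P : pred I) (E : I -> cochain) s :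
  ceval (\sum_(i <- r | P i) E i) s = \sum_(i <- r | P i) ceval (E i) s.
Proof.
elim/big_rec2: _ => [|i x y _ <-]; last by rewrite cevalD.
by rewrite /ceval; case: insubP => // x _ _; rewrite ffunE.
Qed.

Definition lowf v s := [set u in s | u <= v]%N.
Definition highf v s := [set u in s | v <= u]%N.

(* The summand at v splits the simplex into its front face ending at v and its back
   face starting at v. *)
Definition cup_at f g s : F :=
  \sum_(v in s) ceval f (lowf v s) * ceval g (highf v s).
Definition cup f g : cochain := cmk (cup_at f g).
Definition cone : cochain := cmk (fun s => (#|s| == 1%N)%:R).

(* v is the vertex of s of index rk s v, and s :\ v is the face d_(rk s v) of s. *)
Definition rk s v : nat := #|[set u in s | u < v]%N|.
Definition cdelta_at f s : F := \sum_(v in s) (-1) ^+ rk s v * ceval f (s :\ v).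
Definition cdelta f : cochain := cmk (cdelta_at f).

Lemma cupE f g s : ceval (cup f g) s = cup_at f g s.
Proof. by rewrite ceval_mk // /cup_at big_set0. Qed.
Lemma coneE s : ceval cone s = (#|s| == 1%N)%:R.
Proof. by rewrite ceval_mk // cards0. Qed.
Lemma cdeltaE f s : ceval (cdelta f) s = cdelta_at f s.
Proof. by rewrite ceval_mk // /cdelta_at big_set0. Qed.

Lemma low_low v w s : (v <= w)%N -> lowf v (lowf w s) = lowf v s.
Proof.
move=> vw; apply/setP => u; rewrite !inE -andbA; congr (_ && _).
by rewrite andb_idl // => /leq_trans; apply.
Qed.
Lemma high_high v w s : (v <= w)%N -> highf w (highf v s) = highf w s.
Proof.
move=> vw; apply/setP => u; rewrite !inE -andbA; congr (_ && _).
by rewrite andb_idl //; apply: leq_trans.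
Qed.
Lemma high_low v w s : highf v (lowf w s) = lowf w (highf v s).
Proof. by apply/setP => u; rewrite !inE andbAC. Qed.

Fact cupA : associative cup.
Proof.
move=> f g h; apply: cochainP => s; rewrite !cupE /cup_at.
under eq_bigr => v _ do rewrite cupE mulr_sumr.
under [RHS]eq_bigr => w _ do rewrite cupE mulr_suml.
rewrite (exchange_big_dep (mem s)) /=; last by move=> v w _; rewrite inE => /andP[].
apply: eq_bigr => w ws; apply: eq_big => [v|v /andP[vs]]; rewrite !inE ws ?vs //=.
by move=> vw; rewrite low_low // high_high // high_low mulrA.
Qed.

Fact cup1f : left_id cone cup.
Proof.
move=> f; apply: cochainP => s; rewrite cupE /cup_at.
have [->|/set0Pn[x xs]] := eqVneq s set0; first by rewrite big_set0 ceval0.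
pose v0 := [arg min_(v < x in s) v]%N.
have [v0s v0m] : v0 \in s /\ forall u, u \in s -> (v0 <= u)%N.
  by rewrite /v0; case: arg_minnP.
rewrite (bigD1 v0) //= big1 ?addr0.
  have -> : lowf v0 s = [set v0].
    apply/setP => u; rewrite !inE -val_eqE /= eqn_leq andbC.
    case us: (u \in s); first by rewrite v0m.
    rewrite andbF; apply/esym/negP => /andP[h1 h2].
    by have E : u = v0; [apply/val_inj/eqP; rewrite eqn_leq h1 h2|rewrite E v0s in us].
  have -> : highf v0 s = s.
    by apply/setP => u; rewrite !inE; case us: (u \in s) => //=; apply: v0m.
  by rewrite coneE cards1 eqxx mul1r.
move=> v /andP[vs vv0]; rewrite coneE.
suff -> : #|lowf v s| == 1%N = false by rewrite mul0r.
apply/negP => /cards1P[y E].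
have : v \in lowf v s by rewrite inE vs leqnn.
have : v0 \in lowf v s by rewrite inE v0s v0m.
by rewrite E !inE => /eqP <- /eqP vE; rewrite vE eqxx in vv0.
Qed.

Fact cupf1 : right_id cone cup.
Proof.
move=> f; apply: cochainP => s; rewrite cupE /cup_at.
have [->|/set0Pn[x xs]] := eqVneq s set0; first by rewrite big_set0 ceval0.
pose v0 := [arg max_(v > x in s) v]%N.
have [v0s v0m] : v0 \in s /\ forall u, u \in s -> (u <= v0)%N.
  by rewrite /v0; case: arg_maxnP.
rewrite (bigD1 v0) //= big1 ?addr0.
  have -> : highf v0 s = [set v0].
    apply/setP => u; rewrite !inE -val_eqE /= eqn_leq.
    case us: (u \in s); first by rewrite v0m.
    apply/esym/negP => /andP[h1 h2].
    by have E : u = v0; [apply/val_inj/eqP; rewrite eqn_leq h1 h2|rewrite E v0s in us].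
  have -> : lowf v0 s = s.
    by apply/setP => u; rewrite !inE; case us: (u \in s) => //=; apply: v0m.
  by rewrite coneE cards1 eqxx mulr1.
move=> v /andP[vs vv0]; rewrite coneE.
suff -> : #|highf v s| == 1%N = false by rewrite mulr0.
apply/negP => /cards1P[y E].
have : v \in highf v s by rewrite inE vs leqnn.
have : v0 \in highf v s by rewrite inE v0s v0m.
by rewrite E !inE => /eqP <- /eqP vE; rewrite vE eqxx in vv0.
Qed.

Fact cupDl : left_distributive cup +%R.
Proof.
move=> f g h; apply: cochainP => s; rewrite cevalD !cupE -big_split /=.
by apply: eq_bigr => v _; rewrite cevalD mulrDl.
Qed.
Fact cupDr : right_distributive cup +%R.
Proof.
move=> f g h; apply: cochainP => s; rewrite cevalD !cupE -big_split /=.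
by apply: eq_bigr => v _; rewrite cevalD mulrDr.
Qed.
Fact cone_neq0 : cone != 0.
Proof.
apply/eqP => /(congr1 (ceval^~ [set ord0])); rewrite coneE cards1 eqxx => /eqP.
have -> : ceval 0 [set ord0] = 0 by rewrite -(scale0r (0 : cochain)) cevalZ mul0r.
by rewrite oner_eq0.
Qed.
HB.instance Definition _ := GRing.Zmodule_isNzRing.Build cochain
  cupA cup1f cupf1 cupDl cupDr cone_neq0.

Fact cupZl (c : F) f g : c *: (f * g) = (c *: f) * g.
Proof.
apply: cochainP => s; rewrite cevalZ !cupE mulr_sumr.
by apply: eq_bigr => v _; rewrite cevalZ mulrA.
Qed.
HB.instance Definition _ := GRing.Lmodule_isLalgebra.Build F cochain cupZl.
Fact cupZr (c : F) f g : c *: (f * g) = f * (c *: g).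
Proof.
apply: cochainP => s; rewrite cevalZ !cupE mulr_sumr.
by apply: eq_bigr => v _; rewrite cevalZ mulrCA.
Qed.
HB.instance Definition _ := GRing.Lalgebra_isAlgebra.Build F cochain cupZr.

Fact cdelta_linear : linear cdelta.
Proof.
move=> c f g; apply: cochainP => s; rewrite cevalD cevalZ !cdeltaE mulr_sumr -big_split /=.
by apply: eq_bigr => v _; rewrite cevalD cevalZ mulrDr mulrCA.
Qed.
HB.instance Definition _ := GRing.isLinear.Build F cochain cochain *:%R cdelta cdelta_linear.

Definition cproj_at (i : int) f s : F :=
  if (#|s|.-1)%:Z == i then ceval f s else 0.
Definition cproj (i : int) f : cochain := cmk (cproj_at i f).

Lemma cprojE i f s : ceval (cproj i f) s = cproj_at i f s.
Proof. by rewrite ceval_mk // /cproj_at ceval0 if_same. Qed.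

Fact cproj_linear i : linear (cproj i).
Proof.
move=> c f g; apply: cochainP => s; rewrite cevalD cevalZ !cprojE /cproj_at.
by case: ifP => _; rewrite ?mulr0 ?addr0 // cevalD cevalZ.
Qed.
HB.instance Definition _ i :=
  GRing.isLinear.Build F cochain cochain *:%R (cproj i) (cproj_linear i).

Fact cprojK i j f : cproj i (cproj j f) = if i == j then cproj j f else 0.
Proof.
have c0 s : ceval 0 s = 0 by rewrite -(scale0r (0 : cochain)) cevalZ mul0r.
apply: cochainP => s; rewrite cprojE /cproj_at cprojE /cproj_at.
case: (eqVneq i j) => [->|ij]; first by rewrite cprojE /cproj_at; case: (_ == j).
by rewrite c0; case: eqP => // ->; rewrite (negbTE ij).
Qed.

Fact cproj_fin f : exists r : seq int,
  uniq r && (f == \sum_(i <- r) cproj i f).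
Proof.
exists [seq (k : nat)%:Z | k <- iota 0 n.+1].
rewrite map_inj_uniq; last by move=> x y [].
rewrite iota_uniq andTb.
apply/eqP/cochainP => s; rewrite ceval_sum. rewrite big_map.
have sb : (#|s|.-1 < n.+1)%N.
  by have := max_card (mem s); rewrite card_ord; case: #|s|.
rewrite (bigD1_seq #|s|.-1) ?iota_uniq ?mem_iota //= big1 ?addr0.
  by rewrite cprojE /cproj_at eqxx.
move=> k ks; rewrite cprojE /cproj_at; case: eqP => // -[E].
by rewrite E eqxx in ks.
Qed.

Definition cgrading : grading cochain := Grading cprojK cproj_fin.

Lemma chomogP i f :
  homog cgrading i f <-> forall s, s != set0 -> (#|s|.-1)%:Z <> i -> ceval f s = 0.
Proof.
split=> [<- s s0 /eqP /negbTE si|H]; first by rewrite /= cprojE /cproj_at si.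
apply: cochainP => s; rewrite /= cprojE /cproj_at; case: eqP => // si.
have [->|s0] := eqVneq s set0; first by rewrite ceval0.
by rewrite H.
Qed.

Fact cochain_fin : exists r : seq cochain, forall f, span (fun c => c \in r) f.
Proof.
exists [seq ([ffun t => (t == x)%:R] : cochain) | x <- enum {: simplex}] => f.
have -> : f = \sum_(x <- enum {: simplex}) f x *: ([ffun t => (t == x)%:R] : cochain).
  apply/ffunP => t; rewrite sum_ffunE (bigD1_seq t) ?enum_uniq ?mem_enum //=.
  rewrite big1 ?addr0; first by rewrite ffunE [X in _ *: X]ffunE eqxx [RHS]mulr1.
  by move=> x xt; rewrite ffunE [X in _ *: X]ffunE eq_sym (negbTE xt) [LHS]mulr0.
rewrite big_seq; elim/big_ind: _ => [|x y hx hy|x xs]; first exact: span0.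
  by rewrite -[x]scale1r; apply: span_linear.
rewrite -[_ *: _]addr0; apply: spanS; last exact: span0.
by apply/mapP; exists x.
Qed.

Fact cone_homog : homog cgrading 0 1.
Proof.
apply/chomogP => s s0 h; rewrite coneE; case: eqP => // s1; case: h.
by rewrite s1.
Qed.

Lemma card_low_high v s : v \in s -> (#|lowf v s| + #|highf v s|)%N = #|s|.+1.
Proof.
move=> vs; rewrite -cardsUI.
have -> : lowf v s :|: highf v s = s.
  by apply/setP => u; rewrite !inE -andb_orr leq_total andbT.
have -> : lowf v s :&: highf v s = [set v].
  apply/setP => u; rewrite !inE; apply/idP/eqP => [|->]; last by rewrite vs leqnn.
  by case/andP=> /andP[_ h1] /andP[_ h2]; apply/val_inj/eqP; rewrite eqn_leq h1.
by rewrite cards1 addn1.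
Qed.

Lemma low_neq0 v s : v \in s -> lowf v s != set0.
Proof. by move=> vs; apply/set0Pn; exists v; rewrite inE vs leqnn. Qed.
Lemma high_neq0 v s : v \in s -> highf v s != set0.
Proof. by move=> vs; apply/set0Pn; exists v; rewrite inE vs leqnn. Qed.

Fact cup_homog i j f g :
  homog cgrading i f -> homog cgrading j g -> homog cgrading (i + j) (f * g).
Proof.
move=> /chomogP hf /chomogP hg; apply/chomogP => s s0 h.
rewrite cupE /cup_at big1 // => v vs.
have := card_low_high vs.
have [l0 r0] := (low_neq0 vs, high_neq0 vs).
case: (eqVneq (#|lowf v s|.-1)%:Z i) => [li|/eqP li]; last by rewrite hf // mul0r.
case: (eqVneq (#|highf v s|.-1)%:Z j) => [rj|/eqP rj]; last by rewrite hg // mulr0.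
move: l0 r0 h; rewrite -!card_gt0 -li -rj => l0 r0 h e; case: h.
rewrite -PoszD; congr Posz; lia.
Qed.

Fact cdelta_homog i f :
  homog cgrading i f -> homog cgrading (i + 1) (cdelta f).
Proof.
move=> /chomogP hf; apply/chomogP => s s0 h.
rewrite cdeltaE /cdelta_at big1 // => v vs.
have [->|t0] := eqVneq (s :\ v) set0; first by rewrite ceval0 mulr0.
rewrite hf ?mulr0 // => E; apply: h; rewrite -E.
have := cardsD1 v s; rewrite vs -card_gt0 in t0 * => ->.
by rewrite -PoszD; congr Posz; lia.
Qed.

Lemma rkD1 s u v : rk (s :\ v) u = (rk s u - ((v \in s) && (v < u)))%N.
Proof.
rewrite /rk [in RHS](cardsD1 v) inE; rewrite addKn.
by congr #|pred_of_set _|; apply/setP => w; rewrite !inE andbA.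
Qed.

Lemma rk_gt0 s u v : v \in s -> (v < u)%N -> (0 < rk s u)%N.
Proof. by move=> vs vu; rewrite card_gt0; apply/set0Pn; exists v; rewrite inE vs. Qed.

Fact cdelta_sq f : cdelta (cdelta f) = 0.
Proof.
apply: cochainP => s.
have -> : ceval 0 s = 0 by rewrite -(scale0r (0 : cochain)) cevalZ mul0r.
rewrite cdeltaE /cdelta_at.
under eq_bigr => v _ do rewrite cdeltaE /cdelta_at mulr_sumr.
pose E u v := (-1) ^+ rk s v * ((-1) ^+ rk (s :\ v) u * ceval f (s :\ v :\ u)) : F.
rewrite (exchange_big_dep (mem s)) /=; last by move=> v u vs /setD1P[].
rewrite (eq_bigr (fun u => \sum_(v in s | v != u) E u v)); last first.
  move=> u us; apply: eq_bigl => v; rewrite !inE us andbT eq_sym; by case: (v \in s).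
transitivity (\sum_(u in s) (\sum_(v in s | (v < u)%N) E u v + \sum_(v in s | (u < v)%N) E u v)).
  apply: eq_bigr => u us; rewrite (bigID (fun v : 'I_n.+1 => (v < u)%N)) /=; congr (_ + _).
    by apply: eq_bigl => v; rewrite -val_eqE /= neq_ltn; case: (v \in s) => //=; case: ltnP; rewrite ?andbF ?andbT.
  apply: eq_bigl => v; rewrite -val_eqE /= neq_ltn; case: (v \in s) => //=.
  by case: (ltngtP v u).
rewrite big_split /= [X in _ + X](exchange_big_dep (mem s)) /=; last by move=> u v us /andP[].
rewrite -big_split /= big1 // => u us.
rewrite [X in _ + X](eq_bigl (fun v => (v \in s) && (v < u)%N)); last first.
  by move=> v; rewrite us.
rewrite -big_split /= big1 // => v /andP[vs vu].
have -> : E v u = (-1) ^+ rk s u * ((-1) ^+ rk (s :\ u) v * ceval f (s :\ v :\ u)).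
  by rewrite /E !setDDl setUC.
rewrite /E !rkD1 us vs vu /= ltnNge (ltnW vu) /= subn0.
have := rk_gt0 vs vu; case: (rk s u) => // k _.
rewrite subn1 /= exprS !mulrA (mulrC ((-1) ^+ rk s v)) -mulrDl.
by rewrite !mulN1r mulNr subrr mul0r.
Qed.

Lemma sgn_absz (i : int) : (-1) ^+ absz (i * 1) = (-1) ^+ absz i :> F.
Proof. by rewrite mulr1. Qed.

Fact cleibniz i f g : homog cgrading i f ->
  cdelta (f * g) = cdelta f * g + ksgn F i 1 *: (f * cdelta g).
Proof.
move=> /chomogP hf; apply: cochainP => s.
rewrite cevalD cevalZ cdeltaE !cupE /cdelta_at /cup_at mulr_sumr.
have sg v : v \in s -> ksgn F i 1 * ceval f (lowf v s) = (-1) ^+ rk s v * ceval f (lowf v s).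
  move=> vs; case: (eqVneq (#|lowf v s|.-1)%:Z i) => [E|/eqP E]; last first.
    by rewrite hf ?low_neq0 // !mulr0.
  congr (_ * _); rewrite /ksgn mulr1 -E absz_nat; congr (_ ^+ _).
  rewrite (cardsD1 v) inE vs leqnn /=; congr #|pred_of_set _|.
  by apply/setP => u; rewrite !inE -val_eqE /= ltn_neqAle; case: (u \in s); rewrite ?andbF ?andbT.
pose L u v : F := (-1) ^+ rk s u * (ceval f (lowf v s :\ u) * ceval g (highf v s)).
pose R u v : F := (-1) ^+ rk s u * (ceval f (lowf v s) * ceval g (highf v s :\ u)).
transitivity (\sum_(u in s) (\sum_(v in s | (u < v)%N) L u v
                           + \sum_(v in s | (v < u)%N) R u v)).
  apply: eq_bigr => u us; rewrite cupE /cup_at mulr_sumr.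
  rewrite (bigID (fun v : 'I_n.+1 => (u < v)%N)) /=; congr (_ + _).
    rewrite (eq_bigl (fun v => (v \in s) && (u < v)%N)); last first.
      by move=> v; rewrite !inE -val_eqE /= neq_ltn; case: (v \in s); case: ltngtP.
    apply: eq_bigr => v /andP[vs uv]; congr (_ * (ceval f _ * ceval g _)).
      by apply/setP => w; rewrite !inE -andbA.
    apply/setP => w; rewrite !inE -andbA -val_eqE /=.
    by case: (w \in s); rewrite ?andbF //=; case: (ltngtP w u) => //= ->; rewrite leqNgt uv.
  rewrite (eq_bigl (fun v => (v \in s) && (v < u)%N)); last first.
    by move=> v; rewrite !inE -val_eqE /= neq_ltn; case: (v \in s); case: ltngtP.
  apply: eq_bigr => v /andP[vs uv]; congr (_ * (ceval f _ * ceval g _)).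
    apply/setP => w; rewrite !inE -andbA -val_eqE /=.
    by case: (w \in s); rewrite ?andbF //=; case: (ltngtP w u) => //= ->; rewrite leqNgt uv.
  by apply/setP => w; rewrite !inE -andbA.
transitivity (\sum_(v in s) (L v v + \sum_(u in s | (u < v)%N) L u v)
            + \sum_(v in s) (R v v + \sum_(u in s | (v < u)%N) R u v)); last first.
  congr (_ + _); apply: eq_bigr => v vs.
    rewrite cdeltaE /cdelta_at mulr_suml [RHS](bigD1 v) /=; last by rewrite inE vs leqnn.
    have rkl u : (u <= v)%N -> rk (lowf v s) u = rk s u.
      move=> uv; congr #|pred_of_set _|; apply/setP => w; rewrite !inE.
      case: (w \in s) => //=; rewrite andb_idl // => wu.
      exact: leq_trans (ltnW wu) uv.
    congr (_ + _); first by rewrite /L rkl // mulrA.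
    rewrite [RHS](eq_bigl (fun u => (u \in s) && (u < v)%N)); last first.
      move=> u; rewrite !inE -val_eqE /= ltn_neqAle.
      by case: (u \in s) => //=; rewrite andbC.
    by apply: eq_bigr => u /andP[us uv]; rewrite /L rkl ?mulrA // ltnW.
  rewrite mulrA sg // -mulrA cdeltaE /cdelta_at mulr_sumr mulr_sumr.
  rewrite [RHS](bigD1 v) /=; last by rewrite inE vs leqnn.
  have rkh u : u \in s -> (v <= u)%N -> (rk s v + rk (highf v s) u)%N = rk s u.
    move=> us vu; rewrite /rk -cardsUI [X in (_ + X)%N](_ : _ = 0%N) ?addn0.
      congr #|pred_of_set _|; apply/setP => w; rewrite !inE.
      case: (w \in s) => //=; case: (ltnP w v) => //= wv.
      by rewrite (leq_trans wv vu).
    apply/eqP; rewrite cards_eq0; apply/eqP/setP => w; rewrite !inE.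
    by case: (w \in s) => //=; rewrite ltnNge; case: (v <= w)%N.
  congr (_ + _).
    have -> : rk (highf v s) v = 0%N by have := rkh v vs (leqnn v); lia.
    by rewrite expr0 mul1r.
  rewrite [RHS](eq_bigl (fun u => (u \in s) && (v < u)%N)); last first.
    move=> u; rewrite !inE -val_eqE /= ltn_neqAle eq_sym.
    by case: (u \in s) => //=; rewrite andbC.
  apply: eq_bigr => u /andP[us vu]; rewrite /R -(rkh u) ?(ltnW vu) // exprD -!mulrA.
  by congr (_ * _); rewrite mulrCA.
rewrite !big_split /= [RHS]addrACA [X in _ = X + _](_ : _ = 0) ?add0r.
  congr (_ + _); rewrite (exchange_big_dep (mem s)) /=; try by move=> u v _ /andP[].
    by apply: eq_bigr => v vs; apply: eq_bigl => u; rewrite vs.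
  by apply: eq_bigr => v vs; apply: eq_bigl => u; rewrite vs.
rewrite -big_split /=.
pose lt j := [set u in s | u < j]%N; pose ge j := [set u in s | j <= u]%N.
pose G j : F := (-1) ^+ #|lt j| * (ceval f (lt j) * ceval g (ge j)).
transitivity (\sum_(0 <= j < n.+1) (G j - G j.+1)).
  rewrite big_mkord big_mkcond /=; apply: eq_bigr => v _.
  have ltS : lt v.+1 = lowf v s by apply/setP => u; rewrite !inE ltnS.
  case: (boolP (v \in s)) => vs; last first.
    rewrite /G; have -> : lt v.+1 = lt v.
      apply/setP => u; rewrite !inE ltnS leq_eqVlt; case: eqP => //= /val_inj ->.
      by rewrite (negbTE vs).
    have -> : ge v.+1 = ge v; last by rewrite /= subrr.
    apply/setP => u; rewrite !inE [in RHS]leq_eqVlt; case: eqP => //= /val_inj <-.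
    by rewrite (negbTE vs).
  have -> : G v = L v v.
    congr (_ * (ceval f _ * _)); apply/setP => u; rewrite !inE -val_eqE /= ltn_neqAle.
    by case: (u \in s); rewrite ?andbF.
  have cS : #|lt v.+1| = (rk s v).+1.
    rewrite (cardsD1 v) ltS inE vs leqnn /= add1n; congr #|pred_of_set _|.+1.
    by apply/setP => u; rewrite !inE -val_eqE /= ltn_neqAle; case: (u \in s); rewrite ?andbF ?andbT.
  rewrite /G cS exprS mulN1r mulNr opprK ltS; congr (_ + _ * (_ * ceval g _)).
  apply/setP => u; rewrite !inE -val_eqE /= ltn_neqAle eq_sym.
  by case: (u \in s); rewrite ?andbF.
under eq_bigr => j _ do rewrite -opprB.
rewrite sumrN telescope_sumr // /G.
have -> : ge n.+1 = set0.
  by apply/setP => u; rewrite !inE leqNgt ltn_ord andbF.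
have -> : lt 0%N = set0 by apply/setP => u; rewrite !inE ltn0 andbF.
by rewrite !ceval0 mul0r !mulr0 subrr oppr0.
Qed.

Definition cochain_dga : dga F :=
  Dga cochain_fin cone_homog cup_homog cdelta_homog cdelta_sq cleibniz.
End Cochains.

Definition monob m n (th : {ffun 'I_m.+1 -> 'I_n.+1}) : bool :=
  [forall i : 'I_m.+1, forall j : 'I_m.+1, (i <= j)%N ==> (th i <= th j)%N].

(* The morphisms [m] -> [n] of the simplex category. *)
Definition omap (m n : nat) := {th : {ffun 'I_m.+1 -> 'I_n.+1} | monob th}.

Definition omap_fun m n (th : omap m n) : 'I_m.+1 -> 'I_n.+1 := val th.
Coercion omap_fun : omap >-> Funclass.

Lemma omapP m n (th : omap m n) (i j : 'I_m.+1) : (i <= j)%N -> (th i <= th j)%N.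
Proof.
move=> ij; have /forallP/(_ i)/forallP/(_ j)/implyP := valP th; exact.
Qed.

Lemma omap_eq m n (th eta : omap m n) : th =1 eta -> th = eta.
Proof. by move=> E; apply/val_inj/ffunP. Qed.

Fact omap_id_subproof n : monob [ffun k : 'I_n.+1 => k].
Proof. by apply/forallP => i; apply/forallP => j; apply/implyP; rewrite !ffunE. Qed.
Definition omap_id n : omap n n := exist (fun th => is_true (monob th)) _ (omap_id_subproof n).

Fact omap_comp_subproof m n p (th : omap n p) (eta : omap m n) :
  monob [ffun k => th (eta k)].
Proof.
apply/forallP => i; apply/forallP => j; apply/implyP => ij.
by rewrite !ffunE; do 2!apply: omapP.
Qed.
Definition omap_comp m n p (th : omap n p) (eta : omap m n) : omap m p :=
  exist (fun th => is_true (monob th)) _ (omap_comp_subproof th eta).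

Lemma omap_idE n i : omap_id n i = i. Proof. by rewrite /omap_fun ffunE. Qed.
Lemma omap_compE m n p (th : omap n p) (eta : omap m n) i :
  omap_comp th eta i = th (eta i).
Proof. by rewrite /omap_fun [LHS]ffunE. Qed.

Section Restriction.
Context (F : fieldType) (m n : nat) (th : omap m n).
Implicit Types (f g : cochain F n) (s : {set 'I_m.+1}).

(* The image of s under th is a degenerate simplex, on which normalized cochains
   vanish, exactly when th is not injective on s. *)
Definition crestr_at f s : F := if #|th @: s| == #|s| then ceval f (th @: s) else 0.
Definition crestr f : cochain F m := cmk (crestr_at f).

Lemma crestrE f s : ceval (crestr f) s = crestr_at f s.
Proof. by rewrite ceval_mk // /crestr_at imset0 ceval0 if_same. Qed.

Fact crestr_linear : linear crestr.
Proof.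
move=> c f g; apply: cochainP => s; rewrite cevalD cevalZ !crestrE /crestr_at.
by case: ifP => _; rewrite ?mulr0 ?addr0 // cevalD cevalZ.
Qed.
HB.instance Definition _ :=
  GRing.isLinear.Build F (cochain F n) (cochain F m) *:%R crestr crestr_linear.

Lemma crestr_homog i f :
  homog (cgrading F n) i f -> homog (cgrading F m) i (crestr f).
Proof.
move=> /chomogP hf; apply/chomogP => s s0 si; rewrite crestrE /crestr_at.
case: eqP => // E; rewrite hf ?E //.
by rewrite -card_gt0 E card_gt0.
Qed.

Lemma imset_inj_strict s u v : {in s &, injective th} -> u \in s -> v \in s ->
  (th u <= th v)%N = (u <= v)%N.
Proof.
move=> inj us vs; apply/idP/idP; last exact: omapP.
case: (leqP u v) => // vu h; have := omapP th (ltnW vu) => h2.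
have E : th u = th v by apply/val_inj/eqP; rewrite eqn_leq h.
by rewrite (inj u v us vs E) ltnn in vu.
Qed.

Lemma crestrM f g : crestr (f * g) = crestr f * crestr g.
Proof.
apply: cochainP => s; rewrite crestrE /crestr_at !cupE /cup_at.
case: eqP => [/eqP/imset_injP inj|ninj].
  rewrite big_imset //=; apply: eq_bigr => v vs.
  have cI (t : {set 'I_m.+1}) : t \subset s -> #|th @: t| == #|t|.
    by move=> /subsetP ts; apply/imset_injP => x y /ts xs /ts ys; apply: inj.
  have lE : lowf (th v) (th @: s) = th @: lowf v s.
    apply/setP => w; rewrite inE; apply/andP/imsetP => [[/imsetP[u us ->]]|[u]].
      by rewrite (imset_inj_strict inj) // => uv; exists u; rewrite // inE us.
    by rewrite inE => /andP[us uv] ->; rewrite imset_f // omapP.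
  have hE : highf (th v) (th @: s) = th @: highf v s.
    apply/setP => w; rewrite inE; apply/andP/imsetP => [[/imsetP[u us ->]]|[u]].
      by rewrite (imset_inj_strict inj) // => uv; exists u; rewrite // inE us.
    by rewrite inE => /andP[us uv] ->; rewrite imset_f // omapP.
  rewrite !crestrE /crestr_at lE hE !cI //.
    by apply/subsetP => u; rewrite inE => /andP[].
  by apply/subsetP => u; rewrite inE => /andP[].
rewrite big1 // => v vs; rewrite !crestrE /crestr_at.
case: eqP => [/eqP/imset_injP il|_]; last by rewrite mul0r.
case: eqP => [/eqP/imset_injP ih|_]; last by rewrite mulr0.
case: ninj; apply/eqP/imset_injP.
suff H x y : x \in s -> y \in s -> (x <= y)%N -> th x = th y -> x = y.
  by move=> x y xs ys E; case: (leqP x y) => [|/ltnW] xy; [apply: H|apply/esym/H].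
move=> xs ys xy E; case: (leqP y v) => [yv|/ltnW vy].
  by apply: il; rewrite ?inE ?xs ?ys ?yv ?(leq_trans xy yv).
case: (leqP v x) => [vx|/ltnW xv].
  by apply: ih; rewrite ?inE ?xs ?ys ?vy ?vx.
have Exv : th x = th v.
  apply/val_inj/eqP; rewrite eqn_leq omapP //= E; exact: omapP.
have xE : x = v by apply: il; rewrite ?inE ?xs ?vs ?leqnn.
by apply: ih => //; rewrite inE ?xs ?ys ?vy // xE leqnn.
Qed.

Lemma crestr_delta f : crestr (cdelta f) = cdelta (crestr f).
Proof.
apply: cochainP => s; rewrite crestrE /crestr_at !cdeltaE /cdelta_at.
case: eqP => [/eqP/imset_injP inj|ninj].
  rewrite big_imset //=; apply: eq_bigr => v vs.
  have DE : (th @: s) :\ th v = th @: (s :\ v).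
    apply/setP => w; rewrite !inE; apply/andP/imsetP => [[wv /imsetP[u us E]]|[u]].
      by exists u => //; rewrite !inE us andbT; apply: contra wv => /eqP <-; apply/eqP.
    rewrite !inE => /andP[uv us] ->; rewrite imset_f //; split=> //.
    by apply: contra uv => /eqP /inj ->.
  rewrite crestrE /crestr_at DE.
  have -> : #|th @: (s :\ v)| == #|s :\ v|.
    by apply/imset_injP => x y /setD1P[_ xs] /setD1P[_ ys]; apply: inj.
  congr (_ ^+ _ * _); rewrite /rk.
  have -> : [set u in th @: s | u < th v]%N = th @: [set u in s | u < v]%N.
    apply/setP => w; rewrite inE; apply/andP/imsetP => [[/imsetP[u us ->]]|[u]].
      by rewrite ltnNge (imset_inj_strict inj) // -ltnNge => uv; exists u; rewrite // inE us.
    by rewrite inE => /andP[us uv] ->; rewrite imset_f // ltnNge (imset_inj_strict inj) // -ltnNge.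
  by apply: card_in_imset => x y; rewrite !inE => /andP[xs _] /andP[ys _]; apply: inj.
apply/esym.
have [x [y [xs ys xy E]]] : exists x y : 'I_m.+1, [/\ x \in s, y \in s, (x < y)%N & th x = th y].
  apply: contrapT => no; apply: ninj; apply/eqP/imset_injP => x y xs ys E.
  apply/eqP; apply: contrapT => /negP; rewrite -val_eqE /= neq_ltn => /orP[] h; apply: no.
    by exists x, y.
  by exists y, x.
pose y' := [arg min_(v < y in [set v in s | x < v]%N) v]%N.
have [y's y'm] : y' \in [set v in s | x < v]%N /\ forall u, u \in [set v in s | x < v]%N -> (y' <= u)%N.
  by rewrite /y'; case: arg_minnP; rewrite ?inE ?ys ?xy.
move: y's y'm; move: y' => z; rewrite inE => /andP[zs xz] zm.
have zy : (z <= y)%N by apply: zm; rewrite inE ys.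
have Ez : th x = th z.
  apply/val_inj/eqP; rewrite eqn_leq (omapP th (ltnW xz)) /= E; exact: omapP.
have xz' : x != z by rewrite -val_eqE /= neq_ltn xz.
rewrite (bigD1 x) //= (bigD1 z) /=; last by rewrite zs eq_sym.
rewrite addrA big1 ?addr0; last first.
  move=> v /andP[/andP[vs vx] vz]; rewrite crestrE /crestr_at ifF ?mulr0 //.
  apply/negP => /imset_injP inj; have : x = z.
    by apply: inj; rewrite ?inE ?xs ?zs ?(eq_sym _ v) ?vx ?vz // eq_sym.
  by move/eqP; rewrite (negbTE xz').
have imE : th @: (s :\ x) = th @: (s :\ z).
  have sub a b : a \in s -> b \in s -> a != b -> th a = th b -> th @: (s :\ a) \subset th @: (s :\ b).
    move=> as_ bs ab Eab; apply/subsetP => w /imsetP[u /setD1P[ua us] ->].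
    case: (eqVneq u b) => [->|ub]; last by apply: imset_f; rewrite !inE ub.
    by rewrite -Eab; apply: imset_f; rewrite !inE ab.
  by apply/eqP; rewrite eqEsubset !sub // eq_sym.
rewrite !crestrE /crestr_at imE.
have -> : #|s :\ x| = #|s :\ z|.
  by have := cardsD1 x s; have := cardsD1 z s; rewrite xs zs => -> [].
have -> : rk s z = (rk s x).+1.
  rewrite /rk (cardsD1 x) inE xs xz add1n; congr #|pred_of_set _|.+1.
  apply/setP => u; rewrite !inE -val_eqE /= neq_ltn.
  case us: (u \in s); rewrite ?andbF //=.
  case: (ltngtP u x) => [ux|xu|ux] /=.
  - by rewrite (ltn_trans ux xz).
  - by apply/negbTE; rewrite -leqNgt; apply: zm; rewrite inE us.
  - by [].
by rewrite exprS mulN1r mulNr subrr.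
Qed.
End Restriction.

Lemma crestr_id (F : fieldType) n (f : cochain F n) : crestr (omap_id n) f = f.
Proof.
apply: cochainP => s; rewrite crestrE /crestr_at.
have -> : omap_id n @: s = s.
  by rewrite -[RHS]imset_id; apply: eq_imset => u; rewrite omap_idE.
by rewrite eqxx.
Qed.

Lemma crestr_comp (F : fieldType) m n p (th : omap n p) (eta : omap m n) (f : cochain F p) :
  crestr (omap_comp th eta) f = crestr eta (crestr th f).
Proof.
apply: cochainP => s; rewrite !crestrE /crestr_at crestrE /crestr_at.
have -> : omap_comp th eta @: s = th @: (eta @: s).
  by rewrite -imset_comp; apply: eq_imset => u; rewrite omap_compE.
case: (eqVneq #|eta @: s| #|s|) => [->//|h].
rewrite ifF //; apply/negbTE; move: h; apply: contra_neq => e.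
have h1 := leq_imset_card th (mem (eta @: s)); have h2 := leq_imset_card eta (mem s).
by apply/eqP; rewrite eqn_leq h2 -e h1.
Qed.

Section Naturality.
Context (F : fieldType) (A : complex F) (B B' : dga F) (f : {linear B -> B'}).
Hypothesis f_homog : forall i b, homog (dgr B) i b -> homog (dgr B') i (f b).
Hypothesis f_mul : forall b c, f (b * c) = f b * f c.

Local Notation pushA := (tmap (idfun : A -> A) f).
Local Notation pushT := (tmap (idfun : Tbar A -> Tbar A) f).

Lemma kcons_nat t u : kcons (pushA t) (pushT u) = pushT (kcons t u).
Proof.
suff H x b : kcons (pushA (pure x b)) (pushT u) = pushT (kcons (pure x b) u).
  exact: (tens_ext (f := tens_lift (kcons_pure_bilin (pushT u)) \o pushA)
                   (g := pushT \o tens_lift (kcons_pure_bilin u)) H t).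
rewrite tmapE /kcons !tens_liftE /=.
have hom_case i c : homog (dgr B) i c ->
    kcons_pure (pushT u) x (f c) = pushT (kcons_pure u x c).
  move=> hc; rewrite /kcons_pure (glift_homog _ hc) (glift_homog _ (f_homog hc)) /=.
  rewrite /kcons_at.
  apply: (tens_ext (f := kcons_comp x i (f c) \o pushT) (g := pushT \o kcons_comp x i c)).
  by move=> v e; rewrite /= tmapE !kcons_compE tmapE /= f_mul.
rewrite (gsuppE (dgr B) b); elim: (gsupp _ _) => [|i s IH].
  by rewrite big_nil (linear0 f) /kcons_pure !raddf0.
rewrite big_cons (raddfD f); move: (hom_case i _ (gproj_homog (dgr B) i b)) IH.
rewrite /kcons_pure => E1 E2.
by rewrite !raddfD /= E1 E2.
Qed.

Lemma regroup_nat s : regroup (map pushA s) = pushT (regroup s).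
Proof.
elim: s => [|t [|t' s] IH]; first by rewrite /= linear0.
  apply: (tens_ext (f := tmap (@Tsingle F A) idfun \o pushA)
                   (g := pushT \o tmap (@Tsingle F A) idfun)) => x b /=.
  by rewrite !tmapE.
have E (B1 : dga F) (t1 t2 : tens A B1) (r : seq (tens A B1)) :
  regroup [:: t1, t2 & r] = kcons t1 (regroup (t2 :: r)) by [].
by rewrite E -kcons_nat -IH.
Qed.

Lemma tsmap_nat (Q : {linear Tbar A -> Tbar A}) s :
  tsmap Q (map pushA s) = pushA (tsmap Q s).
Proof.
rewrite /tsmap regroup_nat.
apply: (tens_ext (f := tmap (Tproj A \o Q) idfun \o pushT)
                 (g := pushA \o tmap (Tproj A \o Q) idfun)) => x b /=.
by rewrite !tmapE.
Qed.

Lemma tdeg_nat i u : tdeg i u -> tdeg i (pushA u).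
Proof.
elim=> [|c v w [p [q [x [b [pq hx hb ->]]]]] _ IH]; first by rewrite linear0; apply: span0.
rewrite linearP tmapE; apply: spanS => //; exists p, q, x, (f b); split=> //.
exact: f_homog.
Qed.

Lemma tfil_nat n u : tfil n u -> tfil n (pushA u).
Proof.
elim=> [|c v w [x [b [hx ->]]] _ IH]; first by rewrite linear0; apply: span0.
by rewrite linearP tmapE; apply: spanS => //; exists x, (f b).
Qed.
End Naturality.

Section MCNaturality.
Context (F : fieldType) (A : ainf F) (B B' : dga F) (f : {linear B -> B'}).
Hypothesis f_homog : forall i b, homog (dgr B) i b -> homog (dgr B') i (f b).
Hypothesis f_mul : forall b c, f (b * c) = f b * f c.
Hypothesis f_delta : forall b, f (ddelta B b) = ddelta B' (f b).

Local Notation pushA := (tmap (idfun : A -> A) f).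

Lemma tensQ_nat s : tensQ (map pushA s) = pushA (tensQ s).
Proof.
rewrite /tensQ linearD (tsmap_nat f_homog f_mul); congr (_ + _).
case: s => [|t [|t' s]] /=; rewrite ?linear0 //.
apply: (tens_ext (f := tmap (ksign (gr A) 1) (ddelta B') \o pushA)
                 (g := pushA \o tmap (ksign (gr A) 1) (ddelta B))) => x b /=.
by rewrite !tmapE /= f_delta.
Qed.

Lemma MC_nat (a : tens_ainf B A) : MC a -> @MC F (tens_ainf B' A) (pushA a).
Proof.
case=> ha sa; split; first exact: tdeg_nat.
move=> p; have [N HN] := sa p; exists N => k Nk.
have /= := tfil_nat f (HN k Nk).
rewrite !sub0r linearN linear_sum; congr (tfil p (- _)).
apply: eq_bigr => i _.
by rewrite -[RHS](congr1 (@tensQ F B' A) (map_nseq i.+1 pushA a)) tensQ_nat.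
Qed.
End MCNaturality.

Record sset := SSet {
  splx : nat -> Type;
  sact : forall m n, omap m n -> splx n -> splx m;
  sact_id : forall n x, sact (omap_id n) x = x;
  sact_comp : forall m n p (th : omap n p) (eta : omap m n) x,
    sact (omap_comp th eta) x = sact eta (sact th x) }.

Record smor (X Y : sset) := SMor {
  sfun : forall n, splx X n -> splx Y n;
  sfun_nat : forall m n (th : omap m n) (x : splx X n),
    sfun (sact th x) = sact th (sfun x) }.

Program Definition smor_id (X : sset) : smor X X := @SMor X X (fun _ x => x) _.

Program Definition smor_comp (X Y Z : sset) (g : smor Y Z) (f : smor X Y) : smor X Z :=
  @SMor X Z (fun _ x => sfun g (sfun f x)) _.
Next Obligation. by rewrite !sfun_nat. Qed.

Program Definition std_simplex (k : nat) : sset :=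
  @SSet (fun n => omap n k) (fun m n th x => omap_comp x th) _ _.
Next Obligation. by apply: omap_eq => i; rewrite omap_compE omap_idE. Qed.
Next Obligation. by apply: omap_eq => i; rewrite !omap_compE. Qed.

Program Definition sprod (X Y : sset) : sset :=
  @SSet (fun n => (splx X n * splx Y n)%type)
    (fun m n th p => (sact th p.1, sact th p.2)) _ _.
Next Obligation. by rewrite !sact_id. Qed.
Next Obligation. by rewrite !sact_comp. Qed.

Fact omap_const_subproof m n (v : 'I_n.+1) : monob [ffun _ : 'I_m.+1 => v].
Proof. by apply/forallP => i; apply/forallP => j; apply/implyP; rewrite !ffunE. Qed.
Definition omap_const m n (v : 'I_n.+1) : omap m n :=
  exist (fun th => is_true (monob th)) _ (omap_const_subproof m v).

Definition shomotopic (X Y : sset) (f g : smor X Y) : Prop :=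
  exists H : smor (sprod X (std_simplex 1)) Y,
    forall n (x : splx X n),
      sfun H ((x, omap_const n (ord0 : 'I_2)) : splx (sprod X (std_simplex 1)) n) = sfun f x /\
      sfun H ((x, omap_const n (ord_max : 'I_2)) : splx (sprod X (std_simplex 1)) n) = sfun g x.

Definition homotopy_equivalence (X Y : sset) (f : smor X Y) : Prop :=
  exists g : smor Y X,
    shomotopic (smor_comp g f) (smor_id X) /\ shomotopic (smor_comp f g) (smor_id Y).

Section Nerve.
Context (F : fieldType) (A : ainf F).

Definition nerve_alg (n : nat) : smaps F := tens_ainf (cochain_dga F n) A.

Definition nerve_splx (n : nat) : Type := {a : nerve_alg n | MC a}.

Definition nerve_restr m n (th : omap m n) : {linear nerve_alg n -> nerve_alg m} :=
  tmap (M := A) (N := cochain_dga F n) (N' := cochain_dga F m) idfun (crestr th).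

Definition nerve_act m n (th : omap m n) (a : nerve_splx n) : nerve_splx m :=
  exist (fun b => MC b) (nerve_restr th (sval a))
    (MC_nat (B := cochain_dga F n) (B' := cochain_dga F m) (f := crestr th)
       (crestr_homog th) (crestrM th) (crestr_delta th) (svalP a)).

Lemma nerve_splx_eq n (a b : nerve_splx n) : sval a = sval b -> a = b.
Proof.
case: a b => [a ha] [b hb] /= E; subst b.
by rewrite (Prop_irrelevance ha hb).
Qed.

Fact nerve_act_id n (a : nerve_splx n) : nerve_act (omap_id n) a = a.
Proof.
apply: nerve_splx_eq.
apply: (tens_ext (f := nerve_restr (omap_id n)) (g := idfun)) => x b.
by rewrite [LHS]tmapE /= crestr_id.
Qed.

Fact nerve_act_comp m n p (th : omap n p) (eta : omap m n) (a : nerve_splx p) :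
  nerve_act (omap_comp th eta) a = nerve_act eta (nerve_act th a).
Proof.
apply: nerve_splx_eq.
apply: (tens_ext (f := nerve_restr (omap_comp th eta))
   (g := nerve_restr eta \o nerve_restr th)) => x b.
by rewrite /= /nerve_restr !tmapE /= crestr_comp.
Qed.

Definition nerve : sset := SSet nerve_act_id nerve_act_comp.
End Nerve.

(* a |-> the sum over k >= 1 of Phi_B^1_k (a^{(x)k}), B the cochains on the n-simplex;
   since the filtration is separated, this determines f. *)
Definition is_nerve_map (F : fieldType) (A A' : ainf F) (Phi : amor A A')
    (f : smor (nerve A) (nerve A')) : Prop :=
  forall n (a : nerve_splx A n),
    has_sum (@sfil F (nerve_alg A' n))
      (fun k => tsmap (aphi Phi) (nseq k.+1 (sval a))) (sval (sfun f a)).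

(* Main.v *)
Require Import Defs.
From HB Require Import structures.
From mathcomp Require Import all_boot all_algebra.
From mathcomp Require classical_sets.
From mathcomp Require Import boolp zify ring.
(* Defs again: vector.v shadows its span. *)
Import Defs.

Set Implicit Arguments.
Unset Strict Implicit.
Unset Printing Implicit Defensive.

Import GRing.Theory.

Local Open Scope ring_scope.

(* A Maurer-Cartan element of A (x) N^*(Delta^n) is a function a on the simplices of
   Delta^n whose associated group-like series G = a + aa + aaa + ... satisfies QG = G bd,
   where bd is the simplicial boundary; over words, the series is a coalgebra map and
   QG - G bd is a coderivation along it, so that it is determined by its projection to A,
   the curvature of a. Consider the simplicial set E of triples (a, xi, b) with a and b
   Maurer-Cartan in A and A', and xi a path from Theta(a) to b over N^*(Delta^1).
   Given a, any xi of degree -1 determines b as the fixed point of a contraction for the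
   filtration. Given b, the pairs k = (a, xi) live in the mapping cone of the linear term of
   Theta, which is filtered acyclic and hence, over a field, has a filtered contraction h
   (Zorn's lemma, using completeness). With D the linear part of the equations and NL the
   rest, k = w - h NL(k) has a unique solution for each closed w; the Bianchi identity says
   that D raises the filtration of the curvature of k, which equals h D of itself, so
   that the solution is a point of E. Therefore E is a product of nerve A with a
   contractible simplicial vector space (the xi), and of nerve A' with another one (the w),
   and both contractions are obtained by truncating xi or h k along Delta^1. *)

(** [Tbar] is a direct sum and contains no infinite series, while the equations involve words of
    every length. They are therefore stated for words of length at most N, modulo the N-th step of
    the filtration, for every N. All letters lie in F_1, so terms with at least two letters are
    contractive, and each equation is solved one filtration step at a time.

    A weak equivalence makes each F_N of the cone acyclic, but gives no primitives compatible for
    all N; h has to be linear and to preserve every F_N at once, which is what Zorn's lemma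
    supplies. Since h acts on coefficients only, it commutes with simplicial operators, and since
    solutions are unique, the maps built from them are automatically simplicial. This gives a
    homotopy inverse and both homotopies directly, without appeal to the Kan property.

    Truncation along Delta^1 does not preserve closedness of w; so the primitive h k is truncated,
    and the differential is applied afterwards. Given a, the path xi satisfies no equation and can
    be truncated as it is. *)

Section Submodules.
Context (F : fieldType) (V : lmodType F).
Implicit Types (P : V -> Prop) (x y z : V).

Definition submod P := P 0 /\ forall c x y, P x -> P y -> P (c *: x + y).

Lemma submodD P x y : submod P -> P x -> P y -> P (x + y).
Proof. by move=> [_ hP] Px Py; rewrite -[x]scale1r; apply: hP. Qed.

Lemma submodZ P c x : submod P -> P x -> P (c *: x).
Proof. by move=> [h0 hP] Px; rewrite -[_ *: _]addr0; apply: hP. Qed.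

Lemma submodN P x : submod P -> P x -> P (- x).
Proof. by move=> hP Px; rewrite -scaleN1r; apply: submodZ. Qed.

Lemma submodB P x y : submod P -> P x -> P y -> P (x - y).
Proof. by move=> hP Px Py; apply: submodD => //; apply: submodN. Qed.

Lemma submod_sum P (I : Type) (r : seq I) (Q : pred I) (f : I -> V) :
  submod P -> (forall i, Q i -> P (f i)) -> P (\sum_(i <- r | Q i) f i).
Proof.
move=> hP hf; elim/big_ind: _ => // [|x y Px Py]; first by case: hP.
exact: submodD.
Qed.

Lemma span_submod P : submod (span P).
Proof. by split=> [|c x y]; [apply: span0|apply: span_linear]. Qed.

Lemma span_min P Q x : submod Q -> (forall y, P y -> Q y) -> span P x -> Q x.
Proof.
by move=> [h0 hQ] PQ; elim=> // c u v Pu _ Qv; apply: hQ => //; apply: PQ.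
Qed.

Definition cong P x y := P (x - y).

Section Congruence.
Context (P : V -> Prop).
Hypothesis hP : submod P.

Lemma cong_refl x : cong P x x.
Proof. by rewrite /cong subrr; case: hP. Qed.

Lemma cong_eq x y : x = y -> cong P x y.
Proof. by move->; apply: cong_refl. Qed.

Lemma cong_sym x y : cong P x y -> cong P y x.
Proof. by rewrite /cong => /(submodN hP); rewrite opprB. Qed.

Lemma cong_trans y x z : cong P x y -> cong P y z -> cong P x z.
Proof. by rewrite /cong => xy yz; rewrite -(subrKA y); apply: submodD. Qed.

Lemma congD x x' y y' : cong P x x' -> cong P y y' -> cong P (x + y) (x' + y').
Proof. by rewrite /cong opprD addrACA; apply: submodD. Qed.

Lemma congN x x' : cong P x x' -> cong P (- x) (- x').
Proof. by rewrite /cong -opprD; apply: submodN. Qed.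

Lemma congB x x' y y' : cong P x x' -> cong P y y' -> cong P (x - y) (x' - y').
Proof. by move=> xx yy; apply: congD => //; apply: congN. Qed.

Lemma congZ c x x' : cong P x x' -> cong P (c *: x) (c *: x').
Proof. by rewrite /cong -scalerBr; apply: submodZ. Qed.

Lemma cong_sum (I : Type) (r : seq I) (Q : pred I) (f g : I -> V) :
  (forall i, Q i -> cong P (f i) (g i)) ->
  cong P (\sum_(i <- r | Q i) f i) (\sum_(i <- r | Q i) g i).
Proof. by move=> fg; rewrite /cong -sumrB; apply: submod_sum. Qed.

Lemma cong_mem x y : cong P x y -> P y -> P x.
Proof. by move=> xy Py; rewrite -(subrK y x); apply: submodD. Qed.

Lemma cong0 x : cong P x 0 <-> P x.
Proof. by rewrite /cong subr0. Qed.

End Congruence.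
End Submodules.

Lemma submod_preim (F : fieldType) (V W : lmodType F) (f : {linear V -> W}) (P : W -> Prop) :
  submod P -> submod (fun x => P (f x)).
Proof. by case=> h0 hP; split=> [|c x y]; rewrite ?linear0 ?linearP //; apply: hP. Qed.

(** * Weight filtration on the tensor coalgebra *)

Section Filtration.
Context (F : fieldType) (A : complex F).
Implicit Types (x y : A) (u v : Tbar A) (w : seq A).

Lemma fil_submod n : submod (@fil F A n).
Proof. by split; [apply: fil0|move=> c x y; apply: fil_linear]. Qed.

Lemma fil_le m n x : (m <= n)%N -> fil n x -> fil m x.
Proof.
by move/subnK <-; elim: (n - m)%N => // k IH; rewrite addSn => /fil_decr.
Qed.

Lemma fil_bot x : fil 0 x.
Proof. exact/fil_decr/fil1. Qed.

Lemma fil_ksign n i x : fil n x -> fil n (ksign (gr A) i x).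
Proof.
move=> hx; rewrite /ksign /= /glift; apply: submod_sum; first exact: fil_submod.
by move=> j _; apply: submodZ; [apply: fil_submod|apply: fil_gproj].
Qed.

Lemma fword_split n w k : fword (@fil F A) n w -> exists i j,
  [/\ (n = i + j)%N, fword (@fil F A) i (take k w) & fword (@fil F A) j (drop k w)].
Proof.
move=> h; elim: h k => [|i j x s hx hs IH] [|k] /=.
- by exists 0, 0; split=> //; constructor.
- by exists 0, 0; split=> //; constructor.
- by exists 0, (i + j)%N; split=> //; constructor.
have [i' [j' [-> h1 h2]]] := IH k; exists (i + i')%N, j'; split=> //.
  by rewrite addnA.
exact: fword_cons.
Qed.

Lemma fword_size w : fword (@fil F A) (size w) w.
Proof.
elim: w => [|x w IH] /=; first exact: fword_nil.
by rewrite -add1n; apply: fword_cons => //; apply: fil1.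
Qed.

(** Filtration by the total weight of a word. Letters lie in F_1, so a word of k letters has weight
    at least k, and modulo [TF N] only the lengths below N matter. *)
Definition TF (N : nat) : Tbar A -> Prop :=
  span (fun u => exists m w, [/\ (N <= m)%N, fword (@fil F A) m w & u = word w]).

Lemma TF_submod N : submod (TF N). Proof. exact: span_submod. Qed.

Lemma TF_word N m w : (N <= m)%N -> fword (@fil F A) m w -> TF N (word w).
Proof. by move=> Nm h; apply: span_gen; exists m, w. Qed.

Lemma TF_le m n u : (m <= n)%N -> TF n u -> TF m u.
Proof.
move=> mn; apply: span_min; first exact: TF_submod.
by move=> y [k [w [nk h ->]]]; apply: TF_word h; apply: leq_trans nk.
Qed.

(** The empty word is zero in [Tbar], and each letter of another word weighs at least 1. This unit
    is what an error in one letter gains as soon as a further letter is present. *)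
Lemma TF_bot u : TF 1 u.
Proof.
apply: span_min (Tbar_span u); first exact: TF_submod.
move=> y [w ->]; case: w => [|x w].
  by rewrite word_nil; apply: span0.
by apply: TF_word (fword_size _).
Qed.

Lemma TF_all u : TF 0 u.
Proof. exact: TF_le (leq0n 1) (TF_bot u). Qed.

Lemma TF_single N x : fil N x -> TF N (word [:: x]).
Proof.
move=> hx; apply: (@TF_word _ (N + 0)); first by rewrite addn0.
by apply: fword_cons => //; apply: fword_nil.
Qed.

Lemma TF_cons i j x u : fil i x -> TF j u -> TF (i + j) (Tcons x u).
Proof.
move=> hx; apply: (span_min (Q := fun u => TF (i + j) (Tcons x u))).
  by apply: submod_preim; apply: TF_submod.
move=> y [m [w [jm h ->]]]; rewrite TconsE; case: w h => [|z w] h.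
  by apply: span0.
by apply: (@TF_word _ (i + m)); [rewrite leq_add2l|apply: fword_cons].
Qed.

Lemma TF_proj n u : TF n u -> fil n (Tproj A u).
Proof.
apply: (span_min (Q := fun u => fil n (Tproj A u))).
  by apply: submod_preim; apply: fil_submod.
move=> y [m [w [nm h ->]]]; rewrite TprojE.
case: w h => [|z [|z' w]] h; try exact: fil0.
inversion h as [|i j z0 s hz hs]; subst; inversion hs; subst.
by rewrite addn0 in nm; apply: fil_le nm hz.
Qed.

Definition TF2 (N : nat) : tens (Tbar A) (Tbar A) -> Prop :=
  span (fun t => exists i j u v, [/\ (N <= i + j)%N, TF i u, TF j v & t = pure u v]).

Lemma TF2_submod N : submod (TF2 N). Proof. exact: span_submod. Qed.

Lemma TF2_pure N i j u v : (N <= i + j)%N -> TF i u -> TF j v -> TF2 N (pure u v).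
Proof. by move=> *; apply: span_gen; exists i, j, u, v. Qed.

Lemma TF2_le m n t : (m <= n)%N -> TF2 n t -> TF2 m t.
Proof.
move=> mn; apply: span_min; first exact: TF2_submod.
by move=> y [i [j [u' [v [h h1 h2 ->]]]]]; apply: TF2_pure h1 h2; apply: leq_trans h.
Qed.

Lemma TF2_bot t : TF2 0 t.
Proof.
apply: span_min (tens_span t); first exact: TF2_submod.
by move=> y [v [w ->]]; apply: (TF2_pure (i := 1) (j := 1)) => //; apply: TF_bot.
Qed.

Definition Tconsl (x : A) : {linear tens (Tbar A) (Tbar A) -> tens (Tbar A) (Tbar A)} :=
  tmap (Tcons x) idfun.

Lemma Tconsl_linear t : linear (fun x => Tconsl x t).
Proof.
move=> c x y; elim: (tens_span t) => [|a v w [u [u' ->]] _ IH] /=.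
  have E z : Tconsl z 0 = 0 by exact: linear0.
  by rewrite !E scaler0 addr0.
have E z : Tconsl z (a *: pure u u' + w) = a *: pure (Tcons z u) u' + Tconsl z w.
  by rewrite linearP tmapE.
rewrite !E IH (Tcons_linear u) (pure_linear_l u') !scalerDr !scalerA (mulrC a c).
by rewrite -!addrA; congr (_ + _); rewrite addrCA.
Qed.

Lemma TF2_consl i j x t : fil i x -> TF2 j t -> TF2 (i + j) (Tconsl x t).
Proof.
move=> hx; apply: (span_min (Q := fun t => TF2 (i + j) (Tconsl x t))).
  by apply: submod_preim; apply: TF2_submod.
move=> y [i' [j' [u [v [h h1 h2 ->]]]]]; rewrite tmapE.
by apply: (@TF2_pure _ (i + i') j') => //; [rewrite -addnA leq_add2l|apply: TF_cons].
Qed.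

Lemma TF2_coprod N u : TF N u -> TF2 N (coprod A u).
Proof.
apply: (span_min (Q := fun u => TF2 N (coprod A u))).
  by apply: submod_preim; apply: TF2_submod.
move=> y [m [w [Nm h ->]]]; rewrite coprodE /deconc; apply: submod_sum => [|k _].
  exact: TF2_submod.
have [i [j [E h1 h2]]] := fword_split k h.
by apply: TF2_pure (TF_word (leqnn _) h1) (TF_word (leqnn _) h2); rewrite -E.
Qed.

Lemma Tcons0 u : Tcons (0 : A) u = 0.
Proof. by have := Tcons_linear u (-1) 0 0; rewrite scaler0 addr0 scaleN1r addNr. Qed.

Fact Tcons_bilin : bilin (fun (x : A) (u : Tbar A) => Tcons x u).
Proof. by split=> [u|x]; [apply: Tcons_linear|apply: linearP]. Qed.

Definition Tcons2 : {linear tens A (Tbar A) -> Tbar A} := tens_lift Tcons_bilin.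

Lemma Tcons2E x u : Tcons2 (pure x u) = Tcons x u.
Proof. exact: tens_liftE. Qed.

Lemma coprod_single x : coprod A (word [:: x]) = 0.
Proof. by rewrite coprodE /deconc big_geq. Qed.

Lemma coprod_cons x u : coprod A (Tcons x u) = pure (word [:: x]) u + Tconsl x (coprod A u).
Proof.
move: u; pose g : {linear Tbar A -> tens (Tbar A) (Tbar A)} := Tconsl x \o coprod A.
have gP : linear (fun u => pure (word [:: x]) u + g u).
  move=> c u v; rewrite pure_linear_r linearP scalerDr -!addrA; congr (_ + _).
  by rewrite addrCA.
pose G : {linear Tbar A -> tens (Tbar A) (Tbar A)} :=
  HB.pack (fun u => pure (word [:: x]) u + g u) (GRing.isLinear.Build F _ _ *:%R _ gP).
apply: (Tbar_ext (f := coprod A \o Tcons x) (g := G)) => w; rewrite /= TconsE.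
case: w => [|y w].
  by rewrite word_nil -[RHS]/(G 0) !linear0.
rewrite [in RHS]coprodE.
rewrite coprodE /deconc big_nat_recl //; congr (_ + _).
rewrite linear_sum /=; apply: eq_big_nat => -[|i] // hi.
by rewrite tmapE TconsE.
Qed.

Lemma Tproj_cons x u : Tproj A (Tcons x u) = 0.
Proof.
apply: (Tbar_ext (f := Tproj A \o Tcons x) (g := \0 : {linear Tbar A -> A})) => w.
by rewrite /= TconsE; case: w => [|y w]; rewrite ?linear0 ?TprojE.
Qed.

(** Cofreeness in recursive form: projecting the left factor of the coproduct to letters keeps only
    the splitting after the first letter, and [Tcons2] glues the two pieces again. Coderivations and
    coalgebra maps are thereby determined by their projections to letters. *)
Lemma Tbar_decomp u :
  u = word [:: Tproj A u] + Tcons2 (tmap (Tproj A) idfun (coprod A u)).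
Proof.
move: u; pose g : {linear Tbar A -> Tbar A} :=
  (@Tsingle F A \o Tproj A) \+ (Tcons2 \o tmap (Tproj A) idfun \o coprod A).
suff E : idfun =1 g by [].
apply: Tbar_ext => w; rewrite /g /= /Tsingle TprojE coprodE /deconc.
case: w => [|x [|y w]].
- by rewrite word_nil big_geq // -/(Tsingle 0) !linear0 addr0.
- by rewrite big_geq // !linear0 addr0.
rewrite big_ltn //= [in RHS]linearD [in RHS]linearD /= tmapE Tcons2E TprojE TconsE.
rewrite big_nat linear_sum linear_sum big1 => [|[|[|i]] // hi].
  by rewrite -/(Tsingle 0) linear0 add0r addr0.
by rewrite /= tmapE Tcons2E TprojE Tcons0.
Qed.

End Filtration.
Arguments Tcons2 {F A}.

Lemma tmap_comp (F : fieldType) (M M' M'' N N' N'' : lmodType F)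
  (f : {linear M -> M'}) (g : {linear N -> N'})
  (f' : {linear M' -> M''}) (g' : {linear N' -> N''}) t :
  tmap f' g' (tmap f g t) = tmap (f' \o f) (g' \o g) t.
Proof.
apply: (tens_ext (f := tmap f' g' \o tmap f g) (g := tmap (f' \o f) (g' \o g))) => x y.
by rewrite /= !tmapE.
Qed.

Lemma Tproj_map (F : fieldType) (V W : lmodType F) (f : {linear V -> W}) u :
  Tproj W (Tmap f u) = f (Tproj V u).
Proof.
apply: (Tbar_ext (f := Tproj W \o Tmap f) (g := f \o Tproj V)) => w /=.
by rewrite TmapE !TprojE; case: w => [|x [|y w]] //=; rewrite linear0.
Qed.

Section Degrees.
Context (F : fieldType) (V : lmodType F) (G : grading V).

Lemma homog_submod i : submod (homog G i).
Proof. by rewrite /homog; split=> [|c x y hx hy]; rewrite ?linear0 // linearP hx hy. Qed.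

Lemma Thomog_submod i : submod (Thomog G i).
Proof. exact: span_submod. Qed.

Lemma Thomog_single i x : homog G i x -> Thomog G i (word [:: x]).
Proof.
move=> hx; apply: span_gen; exists [:: x] => //.
by rewrite -[i]addr0; apply: hword_cons => //; apply: hword_nil.
Qed.

Lemma Thomog_cons i j x u : homog G i x -> Thomog G j u -> Thomog G (i + j) (Tcons x u).
Proof.
move=> hx; apply: (span_min (Q := fun u => Thomog G (i + j) (Tcons x u))).
  by apply: submod_preim; apply: Thomog_submod.
move=> y [w hw ->]; rewrite TconsE; case: w hw => [|z w] hw; first exact: span0.
by apply: span_gen; exists (x :: z :: w) => //; apply: hword_cons.
Qed.

Lemma Thomog_proj i u : Thomog G i u -> homog G i (Tproj V u).
Proof.
apply: (span_min (Q := fun u => homog G i (Tproj V u))).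
  by apply: submod_preim; apply: homog_submod.
move=> y [w hw ->]; rewrite TprojE.
case: w hw => [|x [|z w]] hw; try exact: (homog_submod i).1.
by inversion hw as [|i' j x0 s hx hs E]; subst; inversion hs; subst; rewrite addr0.
Qed.

End Degrees.

(** * Coderivations and coalgebra maps as recursions on words *)

Section Coderivation.
Context (F : fieldType) (A : ainf F).
Implicit Types (x y : A) (u v : Tbar A) (w : seq A).

Definition pQ : {linear Tbar A -> A} := Tproj A \o aQ A.

(** [Tbar_decomp] at Q u, with the coderivation rule for its coproduct. On the right Q meets proper
    tails only, so this is a recursion on the length of words. *)
Lemma aQ_decomp u : aQ A u = word [:: pQ u] + Tcons2 (tmap pQ idfun (coprod A u))
  + Tcons2 (tmap (ksign (gr A) 1 \o Tproj A) (aQ A) (coprod A u)).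
Proof.
rewrite {1}(Tbar_decomp (aQ A u)) aQ_coder !linearD -addrA; congr (_ + (_ + _)).
  rewrite tmap_comp; congr (Tcons2 _).
  by apply: (tens_ext (f := tmap _ _) (g := tmap _ _)) => x y; rewrite !tmapE.
rewrite tmap_comp; congr (Tcons2 _).
apply: (tens_ext (f := tmap _ _) (g := tmap _ _)) => x y; rewrite !tmapE.
by rewrite [X in pure X _](Tproj_map (ksign (gr A) 1)).
Qed.

Lemma pQ_fil n w : fword (@fil F A) n w -> fil n (pQ (word w)).
Proof. exact: aQ_fil. Qed.

Lemma pQ_TF n u : TF n u -> fil n (pQ u).
Proof.
apply: (span_min (Q := fun u => fil n (pQ u))).
  by apply: submod_preim; apply: fil_submod.
by move=> y [m [w [nm h ->]]]; apply: fil_le nm _; apply: pQ_fil.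
Qed.

(** The axiom bounds only the structure maps; the recursion [aQ_decomp] carries the bound over to
    Q. *)
Lemma TF_aQ n u : TF n u -> TF n (aQ A u).
Proof.
apply: (span_min (Q := fun u => TF n (aQ A u))).
  by apply: submod_preim; apply: TF_submod.
move=> y [m [w [nm h ->]]]; apply: TF_le nm _.
have [k] := ubnP (size w); elim: k => // k IH in m w h *; rewrite ltnS => wk.
have TS := TF_submod A m.
rewrite aQ_decomp coprodE /deconc !linear_sum /= !big_nat.
apply: submodD => //; first apply: submodD => //.
- by apply: TF_single; apply: pQ_fil.
- apply: submod_sum => // i hi; rewrite tmapE Tcons2E.
  have [a [b [-> h1 h2]]] := fword_split i h.
  by apply: TF_cons; [apply: pQ_fil|apply: TF_word h2].
- apply: submod_sum => // i hi; rewrite tmapE Tcons2E /=.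
  have [a [b [-> h1 h2]]] := fword_split i h.
  apply: TF_cons.
    by apply: fil_ksign; apply: TF_proj; apply: TF_word h1.
  apply: IH => //; rewrite size_drop; lia.
Qed.

Lemma pQ_homog i u : Thomog (gr A) i u -> homog (gr A) (i + 1) (pQ u).
Proof. by move=> hu; apply: Thomog_proj; apply: aQ_deg. Qed.

Lemma pQ_single x : pQ (word [:: x]) = dif A x.
Proof. exact: aQ_dif. Qed.

End Coderivation.

Section Morphism.
Context (F : fieldType) (A A' : ainf F) (Th : amor A A').
Implicit Types (x y : A) (u v : Tbar A) (w : seq A).

Definition pTh : {linear Tbar A -> A'} := Tproj A' \o aphi Th.

Lemma aphi_decomp u :
  aphi Th u = word [:: pTh u] + Tcons2 (tmap pTh (aphi Th) (coprod A u)).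
Proof.
rewrite {1}(Tbar_decomp (aphi Th u)) aphi_coprod; congr (_ + _).
rewrite tmap_comp; congr (Tcons2 _).
by apply: (tens_ext (f := tmap _ _) (g := tmap _ _)) => x y; rewrite !tmapE.
Qed.

Lemma pTh_TF n u : TF n u -> fil n (pTh u).
Proof.
apply: (span_min (Q := fun u => fil n (pTh u))).
  by apply: submod_preim; apply: fil_submod.
by move=> y [m [w [nm h ->]]]; apply: fil_le nm _; apply: (@aphi_fil _ _ _ Th).
Qed.

Lemma TF_aphi n u : TF n u -> TF n (aphi Th u).
Proof.
apply: (span_min (Q := fun u => TF n (aphi Th u))).
  by apply: submod_preim; apply: TF_submod.
move=> y [m [w [nm h ->]]]; apply: TF_le nm _.
have [k] := ubnP (size w); elim: k => // k IH in m w h *; rewrite ltnS => wk.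
have TS := TF_submod A' m.
rewrite aphi_decomp coprodE /deconc !linear_sum /= !big_nat.
apply: submodD => //.
  by apply: TF_single; apply: (@aphi_fil _ _ _ Th).
apply: submod_sum => // i hi; rewrite tmapE Tcons2E /=.
have [a [b [-> h1 h2]]] := fword_split i h.
apply: TF_cons; first by apply: (@aphi_fil _ _ _ Th).
by apply: IH => //; rewrite size_drop; lia.
Qed.

Lemma pTh_homog i u : Thomog (gr A) i u -> homog (gr A') i (pTh u).
Proof. by move=> hu; apply: Thomog_proj; apply: aphi_deg. Qed.

End Morphism.

(** * Convolution of functions on simplices *)

Section Bilinear.
Context (F : fieldType) (U V W : lmodType F) (mu : U -> V -> W).
Hypothesis mu_bilin : bilin mu.

Lemma bilin0l y : mu 0 y = 0.
Proof. by have := mu_bilin.1 y (-1) 0 0; rewrite scaler0 addr0 scaleN1r addNr. Qed.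

Lemma bilin0r x : mu x 0 = 0.
Proof. by have := mu_bilin.2 x (-1) 0 0; rewrite scaler0 addr0 scaleN1r addNr. Qed.

Lemma bilinDl x x' y : mu (x + x') y = mu x y + mu x' y.
Proof. by have := mu_bilin.1 y 1 x x'; rewrite !scale1r. Qed.

Lemma bilinDr x y y' : mu x (y + y') = mu x y + mu x y'.
Proof. by have := mu_bilin.2 x 1 y y'; rewrite !scale1r. Qed.

Lemma bilinZl c x y : mu (c *: x) y = c *: mu x y.
Proof. by have := mu_bilin.1 y c x 0; rewrite bilin0l !addr0. Qed.

Lemma bilinZr c x y : mu x (c *: y) = c *: mu x y.
Proof. by have := mu_bilin.2 x c y 0; rewrite bilin0r !addr0. Qed.

Lemma bilin_suml (I : Type) (r : seq I) (P : pred I) (f : I -> U) y :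
  mu (\sum_(i <- r | P i) f i) y = \sum_(i <- r | P i) mu (f i) y.
Proof. by elim/big_rec2: _ => [|i u v _ <-]; rewrite ?bilin0l ?bilinDl. Qed.

Lemma bilin_sumr (I : Type) (r : seq I) (P : pred I) (f : I -> V) x :
  mu x (\sum_(i <- r | P i) f i) = \sum_(i <- r | P i) mu x (f i).
Proof. by elim/big_rec2: _ => [|i u v _ <-]; rewrite ?bilin0r ?bilinDr. Qed.

End Bilinear.

Section Convolution.
Context (F : fieldType) (n : nat).
Local Notation T := {set 'I_n.+1}.
Implicit Types (s : T).

(** The cup product of module-valued functions, with no Koszul sign: such signs are carried by [tw]
    and by the identification with tensors. *)
Definition conv (U V W : lmodType F) (mu : U -> V -> W) (f : T -> U) (g : T -> V) s : W :=
  \sum_(v in s) mu (f (lowf v s)) (g (highf v s)).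

(** Precomposition with the simplicial boundary. The face of a vertex is the empty set, whence the
    recurring condition that functions vanish there. *)
Definition bd (U : lmodType F) (f : T -> U) s : U :=
  \sum_(v in s) (-1) ^+ rk s v *: f (s :\ v).

Definition tw (U : lmodType F) (f : T -> U) s : U := (-1) ^+ #|s|.-1 *: f s.

Lemma conv_set0 (U V W : lmodType F) (mu : U -> V -> W) f g : conv mu f g set0 = 0.
Proof. by rewrite /conv big_set0. Qed.

Lemma bd_set0 (U : lmodType F) (f : T -> U) : bd f set0 = 0.
Proof. by rewrite /bd big_set0. Qed.

Lemma tw_set0 (U : lmodType F) (f : T -> U) : f set0 = 0 -> tw f set0 = 0.
Proof. by rewrite /tw => ->; rewrite scaler0. Qed.

Lemma conv_assoc (U V W X Y Z : lmodType F) (mu : U -> V -> X) (mu' : X -> W -> Z)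
    (nu : V -> W -> Y) (nu' : U -> Y -> Z) f g h s :
  bilin mu' -> bilin nu' -> (forall x y z, mu' (mu x y) z = nu' x (nu y z)) ->
  conv mu' (conv mu f g) h s = conv nu' f (conv nu g h) s.
Proof.
move=> bm bn E; rewrite /conv.
under eq_bigr => w _ do rewrite (bilin_suml bm).
under [RHS]eq_bigr => v _ do rewrite (bilin_sumr bn).
rewrite (exchange_big_dep (mem s)) /=; last by move=> v w _; rewrite inE => /andP[].
apply: eq_bigr => v vs; apply: eq_big => [w|w /andP[ws]]; rewrite !inE vs ?ws //=.
by move=> vw; rewrite low_low // high_high // high_low E.
Qed.

Definition phi (sg : simplex n) : cochain F n := [ffun t => (t == sg)%:R].

Lemma ceval_phi sg s : ceval (phi sg) s = (s == val sg)%:R.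
Proof.
rewrite /ceval; case: insubP => [t _ <-|]; first by rewrite ffunE val_eqE.
by rewrite negbK => /eqP ->; case: eqP => // E; have := valP sg; rewrite -E eqxx.
Qed.

(** Scalar cochains b with coefficients in U. Through such expansions the Leibniz rule, the
    vanishing of the squared boundary and naturality for module-valued functions reduce to the same
    facts for N^*(Delta^n). *)
Definition expands (U : lmodType F) (b : simplex n -> cochain F n) (f0 f : T -> U) :=
  forall s, f s = \sum_sg ceval (b sg) s *: f0 (val sg).

Lemma ceval_set0_sum (U : lmodType F) (b : simplex n -> cochain F n) (f0 : T -> U) :
  \sum_sg ceval (b sg) set0 *: f0 (val sg) = 0.
Proof. by rewrite big1 // => sg _; rewrite ceval0 scale0r. Qed.

Lemma phi_expands (U : lmodType F) (f : T -> U) : f set0 = 0 -> expands phi f f.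
Proof.
move=> f0 s; have [->|s0] := eqVneq s set0; first by rewrite ceval_set0_sum.
pose sg : simplex n := exist _ s s0.
rewrite (bigD1 sg) //= ceval_phi eqxx scale1r big1 ?addr0 // => t ts.
by rewrite ceval_phi; case: eqP => [E|]; rewrite ?scale0r //; case/eqP: ts; apply: val_inj.
Qed.

Lemma conv_expand (U V W : lmodType F) (mu : U -> V -> W) b c f0 g0 f g s : bilin mu ->
  expands b f0 f -> expands c g0 g ->
  conv mu f g s = \sum_sg \sum_ta ceval (b sg * c ta) s *: mu (f0 (val sg)) (g0 (val ta)).
Proof.
move=> bm hf hg; rewrite /conv.
under eq_bigr => v _ do rewrite hf hg (bilin_suml bm).
rewrite exchange_big; apply: eq_bigr => sg _.
under eq_bigr => v _ do rewrite (bilin_sumr bm).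
rewrite exchange_big; apply: eq_bigr => ta _.
rewrite cupE /cup_at scaler_suml; apply: eq_bigr => v _.
by rewrite (bilinZl bm) (bilinZr bm) scalerA.
Qed.

Lemma bd_expands (U : lmodType F) b (f0 f : T -> U) :
  expands b f0 f -> expands (fun sg => cdelta (b sg)) f0 (bd f).
Proof.
move=> hf s; rewrite /bd; under eq_bigr => v _ do rewrite hf scaler_sumr.
rewrite exchange_big; apply: eq_bigr => sg _.
rewrite cdeltaE /cdelta_at scaler_suml; apply: eq_bigr => v _.
by rewrite scalerA.
Qed.

Lemma tw_expands (U : lmodType F) (f : T -> U) : f set0 = 0 ->
  expands (fun sg => (-1) ^+ #|val sg|.-1 *: phi sg) f (tw f).
Proof.
move=> f0 s; rewrite /tw (phi_expands f0 s) scaler_sumr; apply: eq_bigr => sg _.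
by rewrite cevalZ scalerA ceval_phi; case: eqP => [->|] //; rewrite !mulr0.
Qed.

Lemma phi_homog (sg : simplex n) : homog (cgrading F n) #|val sg|.-1 (phi sg).
Proof.
by apply/chomogP => s s0 h; rewrite ceval_phi; case: eqP => // E; case: h; rewrite E.
Qed.

Lemma bd_bd (U : lmodType F) (f : T -> U) s : f set0 = 0 -> bd (bd f) s = 0.
Proof.
move=> f0; rewrite (bd_expands (bd_expands (phi_expands f0))) big1 // => sg _.
have c0 : ceval (0 : cochain F n) s = 0 by rewrite -(scale0r (0 : cochain F n)) cevalZ mul0r.
by rewrite cdelta_sq c0 scale0r.
Qed.

Lemma bd_conv (U V W : lmodType F) (mu : U -> V -> W) f g s : bilin mu ->
  f set0 = 0 -> g set0 = 0 ->
  bd (conv mu f g) s = conv mu (bd f) g s + conv mu (tw f) (bd g) s.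
Proof.
move=> bm f0 g0; have [hf hg] := (phi_expands f0, phi_expands g0).
rewrite (conv_expand _ bm (bd_expands hf) hg).
rewrite (conv_expand _ bm (tw_expands f0) (bd_expands hg)).
rewrite /bd; under eq_bigr => v _ do rewrite (conv_expand _ bm hf hg) scaler_sumr.
rewrite exchange_big -big_split; apply: eq_bigr => sg _ /=.
under eq_bigr => v _ do rewrite scaler_sumr.
rewrite exchange_big -big_split; apply: eq_bigr => ta _ /=.
rewrite -scalerDl; under eq_bigr => v _ do rewrite scalerA.
rewrite -scaler_suml; congr (_ *: _).
have := congr1 (fun c => ceval c s) (cleibniz (phi ta) (phi_homog sg)).
by rewrite cdeltaE cevalD scalerAl /ksgn sgn_absz.
Qed.

Lemma tw_tw (U : lmodType F) (f : T -> U) s : tw (tw f) s = f s.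
Proof. by rewrite /tw scalerA -expr2 sqrr_sign scale1r. Qed.

Lemma tw_conv (U V W : lmodType F) (mu : U -> V -> W) f g s : bilin mu ->
  tw (conv mu f g) s = conv mu (tw f) (tw g) s.
Proof.
move=> bm; rewrite /tw /conv scaler_sumr; apply: eq_bigr => v vs.
rewrite (bilinZl bm) (bilinZr bm) scalerA -exprD; congr (_ ^+ _ *: _).
have := card_low_high vs; have := low_neq0 vs; have := high_neq0 vs.
by rewrite -!card_gt0; lia.
Qed.

Lemma tw_bd (U : lmodType F) (f : T -> U) s : f set0 = 0 -> bd (tw f) s = - tw (bd f) s.
Proof.
move=> f0; rewrite /tw /bd scaler_sumr -sumrN; apply: eq_bigr => v vs.
(* The predecessor assigns dimension 0 to the empty face of a vertex as well, so the sign does not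
   change there; the value is zero instead. *)
rewrite (cardsD1 v s) vs add1n /=; have [->|t0] := eqVneq (s :\ v) set0.
  by rewrite f0 !scaler0 oppr0.
rewrite -card_gt0 in t0; case: #|s :\ v| t0 => // k _.
by rewrite !scalerA exprS mulN1r mulNr scaleNr opprK mulrC.
Qed.

End Convolution.

Section RestrictionMap.
Context (F : fieldType) (m n : nat) (th : omap m n).

Definition restr (U : lmodType F) (f : {set 'I_n.+1} -> U) (s : {set 'I_m.+1}) : U :=
  if #|th @: s| == #|s| then f (th @: s) else 0.

Lemma restr_set0 (U : lmodType F) (f : {set 'I_n.+1} -> U) : f set0 = 0 -> restr f set0 = 0.
Proof. by move=> f0; rewrite /restr imset0 f0 if_same. Qed.

Lemma restr_expand (U : lmodType F) b (f0 f : {set 'I_n.+1} -> U) s : expands b f0 f ->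
  restr f s = \sum_sg ceval (crestr th (b sg)) s *: f0 (val sg).
Proof.
move=> hf; rewrite /restr; case: ifP => E.
  by rewrite hf; apply: eq_bigr => sg _; rewrite crestrE /crestr_at E.
by rewrite big1 // => sg _; rewrite crestrE /crestr_at E scale0r.
Qed.

Lemma restr_conv (U V W : lmodType F) (mu : U -> V -> W) f g s : bilin mu ->
  f set0 = 0 -> g set0 = 0 ->
  restr (conv mu f g) s = conv mu (restr f) (restr g) s.
Proof.
move=> bm f0 g0; have [hf hg] := (phi_expands f0, phi_expands g0).
transitivity (\sum_sg \sum_ta
  ceval (crestr th (phi F sg * phi F ta)) s *: mu (f (val sg)) (g (val ta))).
  rewrite /restr; case: ifP => E.
    rewrite (conv_expand _ bm hf hg); apply: eq_bigr => sg _; apply: eq_bigr => ta _.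
    by rewrite crestrE /crestr_at E.
  rewrite big1 // => sg _; rewrite big1 // => ta _.
  by rewrite crestrE /crestr_at E scale0r.
rewrite /conv; under [RHS]eq_bigr => v _ do
  rewrite (restr_expand _ hf) (restr_expand _ hg) (bilin_suml bm).
rewrite [RHS]exchange_big; apply: eq_bigr => sg _.
under [RHS]eq_bigr => v _ do rewrite (bilin_sumr bm).
rewrite [RHS]exchange_big; apply: eq_bigr => ta _.
rewrite crestrM cupE /cup_at scaler_suml; apply: eq_bigr => v _.
by rewrite (bilinZl bm) (bilinZr bm) scalerA.
Qed.

Lemma restr_bd (U : lmodType F) (f : {set 'I_n.+1} -> U) s : f set0 = 0 ->
  restr (bd f) s = bd (restr f) s.
Proof.
move=> f0; have hf := phi_expands f0.
rewrite (restr_expand _ (bd_expands hf)) /bd.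
under [RHS]eq_bigr => v _ do rewrite (restr_expand _ hf) scaler_sumr.
rewrite [RHS]exchange_big; apply: eq_bigr => sg _.
rewrite crestr_delta cdeltaE /cdelta_at scaler_suml; apply: eq_bigr => v _.
by rewrite scalerA.
Qed.

Lemma restr_tw (U : lmodType F) (f : {set 'I_n.+1} -> U) s : restr (tw f) s = tw (restr f) s.
Proof. by rewrite /restr /tw; case: eqP => [->|]; rewrite ?scaler0. Qed.

Lemma restr_app (U V : lmodType F) (L : U -> V) (f : {set 'I_n.+1} -> U) s :
  L 0 = 0 -> restr (fun t => L (f t)) s = L (restr f s).
Proof. by rewrite /restr => L0; case: ifP; rewrite ?L0. Qed.

End RestrictionMap.

(** * Group-like series *)

Lemma bd_lin (F : fieldType) n (U V : lmodType F) (L : {linear U -> V})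
  (f : {set 'I_n.+1} -> U) s : bd (fun t => L (f t)) s = L (bd f s).
Proof. by rewrite /bd linear_sum; apply: eq_bigr => v _; rewrite linearZ. Qed.

Lemma bdD (F : fieldType) n (U : lmodType F) (f g : {set 'I_n.+1} -> U) s :
  bd (fun t => f t + g t) s = bd f s + bd g s.
Proof. by rewrite /bd -big_split; apply: eq_bigr => v _; rewrite scalerDr. Qed.

Lemma bdN (F : fieldType) n (U : lmodType F) (f : {set 'I_n.+1} -> U) s :
  bd (fun t => - f t) s = - bd f s.
Proof. by rewrite /bd -sumrN; apply: eq_bigr => v _; rewrite scalerN. Qed.

Lemma bdB (F : fieldType) n (U : lmodType F) (f g : {set 'I_n.+1} -> U) s :
  bd (fun t => f t - g t) s = bd f s - bd g s.
Proof. by rewrite bdD bdN. Qed.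

Lemma bd_cong (F : fieldType) n (U : lmodType F) (P : U -> Prop)
  (f g : {set 'I_n.+1} -> U) s : submod P ->
  (forall s, cong P (f s) (g s)) -> cong P (bd f s) (bd g s).
Proof. by move=> hP fg; apply: cong_sum => // v _; apply: congZ. Qed.

Lemma tw_cong (F : fieldType) n (U : lmodType F) (P : U -> Prop)
  (f g : {set 'I_n.+1} -> U) s : submod P ->
  (forall s, cong P (f s) (g s)) -> cong P (tw f s) (tw g s).
Proof. by move=> hP fg; apply: congZ. Qed.

Section ConvAdditive.
Context (F : fieldType) (n : nat) (U V W : lmodType F) (mu : U -> V -> W).
Hypothesis bm : bilin mu.
Implicit Types (f : {set 'I_n.+1} -> U) (g : {set 'I_n.+1} -> V).

Lemma convDl f f' g s : conv mu (fun t => f t + f' t) g s = conv mu f g s + conv mu f' g s.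
Proof. by rewrite /conv -big_split; apply: eq_bigr => v _; rewrite (bilinDl bm). Qed.

Lemma convNl f g s : conv mu (fun t => - f t) g s = - conv mu f g s.
Proof.
rewrite /conv -sumrN; apply: eq_bigr => v _.
by rewrite -[- f _]scaleN1r (bilinZl bm) scaleN1r.
Qed.

Lemma convDr f g g' s : conv mu f (fun t => g t + g' t) s = conv mu f g s + conv mu f g' s.
Proof. by rewrite /conv -big_split; apply: eq_bigr => v _; rewrite (bilinDr bm). Qed.

Lemma convNr f g s : conv mu f (fun t => - g t) s = - conv mu f g s.
Proof.
rewrite /conv -sumrN; apply: eq_bigr => v _.
by rewrite -[- g _]scaleN1r (bilinZr bm) scaleN1r.
Qed.

Lemma convBl f f' g s : conv mu (fun t => f t - f' t) g s = conv mu f g s - conv mu f' g s.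
Proof. by rewrite convDl convNl. Qed.

Lemma convBr f g g' s : conv mu f (fun t => g t - g' t) s = conv mu f g s - conv mu f g' s.
Proof. by rewrite convDr convNr. Qed.

Lemma conv_in (P : U -> Prop) (Q : V -> Prop) (R : W -> Prop) f g s : submod R ->
  (forall x y, P x -> Q y -> R (mu x y)) ->
  (forall s, P (f s)) -> (forall s, Q (g s)) -> R (conv mu f g s).
Proof. by move=> hR h hf hg; apply: submod_sum => // v _; apply: h. Qed.

End ConvAdditive.

Lemma conv_lin (F : fieldType) n (U V W X : lmodType F) (mu : U -> V -> W)
  (L : {linear W -> X}) (f : {set 'I_n.+1} -> U) (g : {set 'I_n.+1} -> V) s :
  L (conv mu f g s) = conv (fun x y => L (mu x y)) f g s.
Proof. exact: linear_sum. Qed.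

(* Left convolution with a function valued in A raises the filtration, so that an
   affine fixed-point equation of this form has at most one solution. *)
Lemma conv_fixed_point (F : fieldType) n (A W : lmodType F) (P : nat -> W -> Prop)
    (mu : A -> W -> W) (c : {set 'I_n.+1} -> A) (Z : {set 'I_n.+1} -> W) N :
  (forall k, submod (P k)) -> (forall w, P 0 w) -> (forall j k w, (j <= k)%N -> P k w -> P j w) ->
  (forall k x w, P k w -> P k.+1 (mu x w)) ->
  (forall s, cong (P N) (Z s) (conv mu c Z s)) -> forall s, P N (Z s).
Proof.
move=> hP P0 Ple hmu hZ.
have H j : (j <= N)%N -> forall s, P j (Z s).
  elim: j => [|j IH] jN s; first exact: P0.
  apply: (cong_mem (hP _) (y := conv mu c Z s)); first exact: Ple jN (hZ s).
  by apply: submod_sum => // v _; apply: hmu; apply: IH; apply: ltnW.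
exact: H.
Qed.

Section Series.
Context (F : fieldType) (A : complex F) (n : nat).
Local Notation T := {set 'I_n.+1}.
Implicit Types (s : T) (a b c x : T -> A) (G H : T -> Tbar A).

Definition star (a : T -> A) (G : T -> Tbar A) : T -> Tbar A :=
  conv (fun (x : A) (u : Tbar A) => Tcons x u) a G.

Lemma TF_refl k (u : Tbar A) : cong (TF k) u u.
Proof. by apply: cong_refl; apply: TF_submod. Qed.

Lemma star_TF i j a G s :
  (forall s, fil i (a s)) -> (forall s, TF j (G s)) -> TF (i + j) (star a G s).
Proof. by apply: conv_in; [apply: TF_submod|move=> x y; apply: TF_cons]. Qed.

Lemma star0l a G s : (forall t, a t = 0) -> star a G s = 0.
Proof. by move=> a0; apply: big1 => v _; rewrite a0 Tcons0. Qed.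

Lemma star0r a G s : (forall t, G t = 0) -> star a G s = 0.
Proof. by move=> G0; apply: big1 => v _; rewrite G0 linear0. Qed.

Lemma star_linl k a a' G s :
  star (fun t => k *: a t + a' t) G s = k *: star a G s + star a' G s.
Proof.
rewrite /star /conv scaler_sumr -big_split; apply: eq_bigr => v _ /=.
exact: Tcons_linear.
Qed.

Lemma star_linr k a G G' s :
  star a (fun t => k *: G t + G' t) s = k *: star a G s + star a G' s.
Proof.
rewrite /star /conv scaler_sumr -big_split; apply: eq_bigr => v _ /=.
exact: linearP.
Qed.

Lemma star_congl k a a' G s : (forall s, cong (@fil F A k) (a s) (a' s)) ->
  cong (TF k.+1) (star a G s) (star a' G s).
Proof.
move=> aa; rewrite /cong -(convBl (@Tcons_bilin F A)) -addn1.
by apply: star_TF => // t; apply: TF_bot.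
Qed.

Lemma star_congr k a G G' s : (forall s, cong (TF k) (G s) (G' s)) ->
  cong (TF k.+1) (star a G s) (star a G' s).
Proof.
move=> GG; rewrite /cong -(convBr (@Tcons_bilin F A)) -add1n.
by apply: star_TF => // t; apply: fil1.
Qed.

(* The words a^1 + ... + a^N, evaluated on the iterated coproduct of a simplex. *)
Fixpoint ser a N s : Tbar A :=
  if N is k.+1 then word [:: a s] + star a (ser a k) s else 0.

(* The sum of the words a^i x b^j, up to terms of filtration > N. *)
Fixpoint ser2 a x b N s : Tbar A :=
  if N is k.+1 then word [:: x s] + star x (ser b k) s + star a (ser2 a x b k) s else 0.

Lemma word1_linear : linear (fun x : A => word [:: x]).
Proof. exact: Tsingle_linear. Qed.

Lemma word10 : word [:: 0 : A] = 0.
Proof. exact: (linear0 (@Tsingle F A)). Qed.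

Lemma word1D (x y : A) : word [:: x + y] = word [:: x] + word [:: y].
Proof. exact: (linearD (@Tsingle F A)). Qed.

Lemma word1B (x y : A) : word [:: x - y] = word [:: x] - word [:: y].
Proof. exact: (linearB (@Tsingle F A)). Qed.

Lemma word1Z k (x : A) : word [:: k *: x] = k *: word [:: x].
Proof. by have := word1_linear k x 0; rewrite word10 !addr0. Qed.

Lemma word1_cong k (x y : A) : cong (@fil F A k) x y -> cong (TF k) (word [:: x]) (word [:: y]).
Proof. by rewrite /cong -word1B; apply: TF_single. Qed.

Lemma bd_word1 a s : bd (fun t => word [:: a t]) s = word [:: bd a s].
Proof. exact: (bd_lin (@Tsingle F A)). Qed.

Lemma ser_set0 a N : a set0 = 0 -> ser a N set0 = 0.
Proof. by move=> a0; case: N => //= N; rewrite a0 word10 /star conv_set0 addr0. Qed.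

Lemma ser2_set0 a x b N : x set0 = 0 -> ser2 a x b N set0 = 0.
Proof. by move=> x0; case: N => //= N; rewrite x0 word10 /star !conv_set0 !addr0. Qed.

Lemma ser_cong k a a' N s : (forall s, cong (@fil F A k) (a s) (a' s)) ->
  cong (TF k) (ser a N s) (ser a' N s).
Proof.
move=> aa; elim: N s => [|N IH] s /=; first exact: TF_refl.
apply: congD; [exact: TF_submod|exact: word1_cong|].
apply: (TF_le (leqnSn k)); apply: (cong_trans (TF_submod _ _) (y := star a' (ser a N) s)).
  exact: star_congl.
exact: star_congr.
Qed.

Lemma star_ser_cong k a a' N s : (forall s, cong (@fil F A k) (a s) (a' s)) ->
  cong (TF k.+1) (star a (ser a N) s) (star a' (ser a' N) s).
Proof.
move=> aa; apply: (cong_trans (TF_submod _ _) (y := star a' (ser a N) s)).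
  exact: star_congl.
by apply: star_congr => t; apply: ser_cong.
Qed.

Lemma ser_stable a N s : cong (TF N) (ser a N.+1 s) (ser a N s).
Proof.
elim: N s => [|N IH] s; first exact: TF_all.
by apply: congD; [exact: TF_submod|exact: TF_refl|apply: star_congr].
Qed.

Lemma ser_stable_le a N M s : (N <= M)%N -> cong (TF N) (ser a M s) (ser a N s).
Proof.
elim: M => [|M IH]; first by rewrite leqn0 => /eqP ->; exact: TF_refl.
rewrite leq_eqVlt => /orP[/eqP ->|NM]; first exact: TF_refl.
apply: (cong_trans (TF_submod _ _) (y := ser a M s)); last exact: IH.
exact: TF_le (ser_stable _ _ _).
Qed.

Lemma ser_fix a N s : cong (TF N) (ser a N s) (word [:: a s] + star a (ser a N) s).
Proof. by apply: cong_sym; [apply: TF_submod|apply: ser_stable]. Qed.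

Lemma ser2_stable a x b N s : cong (TF N) (ser2 a x b N.+1 s) (ser2 a x b N s).
Proof.
elim: N s => [|N IH] s; first exact: TF_all.
apply: congD; [exact: TF_submod| |exact: star_congr].
apply: congD; [exact: TF_submod|exact: TF_refl|apply: star_congr].
by move=> t; apply: ser_stable.
Qed.

Lemma ser2_fix a x b N s : cong (TF N) (ser2 a x b N s)
  (word [:: x s] + star x (ser b N) s + star a (ser2 a x b N) s).
Proof.
apply: cong_sym; first exact: TF_submod.
exact: ser2_stable.
Qed.

Lemma ser2_cong k a x b a' x' b' N s :
  (forall s, cong (@fil F A k) (a s) (a' s)) ->
  (forall s, cong (@fil F A k) (x s) (x' s)) ->
  (forall s, cong (@fil F A k) (b s) (b' s)) ->
  cong (TF k) (ser2 a x b N s) (ser2 a' x' b' N s).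
Proof.
move=> aa xx bb; elim: N s => [|N IH] s /=; first exact: TF_refl.
apply: congD; [exact: TF_submod| |].
  apply: congD; [exact: TF_submod|exact: word1_cong|].
  apply: (TF_le (leqnSn k)); apply: (cong_trans (TF_submod _ _) (y := star x' (ser b N) s)).
    exact: star_congl.
  by apply: star_congr => t; apply: ser_cong.
apply: (TF_le (leqnSn k)); apply: (cong_trans (TF_submod _ _) (y := star a' (ser2 a x b N) s)).
  exact: star_congl.
exact: star_congr.
Qed.

(** Every word of the tail has at least two letters, so an error of weight k in one letter is
    accompanied by another letter of weight at least 1. This is the contraction estimate behind the
    path equation. *)
Lemma ser2_tail_cong k a x b a' x' b' N s :
  (forall s, cong (@fil F A k) (a s) (a' s)) ->
  (forall s, cong (@fil F A k) (x s) (x' s)) ->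
  (forall s, cong (@fil F A k) (b s) (b' s)) ->
  cong (TF k.+1) (star x (ser b N) s + star a (ser2 a x b N) s)
                 (star x' (ser b' N) s + star a' (ser2 a' x' b' N) s).
Proof.
move=> aa xx bb; apply: congD; first exact: TF_submod.
  apply: (cong_trans (TF_submod _ _) (y := star x' (ser b N) s)); first exact: star_congl.
  by apply: star_congr => t; apply: ser_cong.
apply: (cong_trans (TF_submod _ _) (y := star a' (ser2 a x b N) s)); first exact: star_congl.
by apply: star_congr => t; apply: ser2_cong.
Qed.

Lemma ser_proj a N s : Tproj A (ser a N.+1 s) = a s.
Proof.
rewrite /= linearD /= TprojE linear_sum big1 ?addr0 // => v _; exact: Tproj_cons.
Qed.

Lemma ser2_proj a x b N s : Tproj A (ser2 a x b N.+1 s) = x s.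
Proof.
rewrite /= !linearD /= TprojE !linear_sum !big1 ?addr0 // => v _; exact: Tproj_cons.
Qed.

Lemma ser_tw a N s : ser (tw a) N s = tw (ser a N) s.
Proof.
elim: N s => [|N IH] s; first by rewrite /tw scaler0.
rewrite /= /tw scalerDr; congr (_ + _); first exact: word1Z.
rewrite [RHS](tw_conv _ _ _ (@Tcons_bilin F A)) /star; congr (conv _ _ _ _).
by apply: funext.
Qed.

Lemma star_unique N c Z :
  (forall s, cong (TF N) (Z s) (star c Z s)) -> forall s, TF N (Z s).
Proof.
apply: (conv_fixed_point (P := @TF F A)) => [k|w|j k w|k x w].
- exact: TF_submod.
- exact: TF_all.
- exact: TF_le.
- by rewrite -add1n; apply: TF_cons; apply: fil1.
Qed.

(** Modulo [TF m] the inhomogeneous terms disappear, so X has weight m by [star_unique]; then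
    [star c X] has weight m + 1 and drops out. For X the defect of a series, the curvature remains
    as leading term. *)
Lemma star_absorb m c X (r : T -> A) E :
  (forall s, fil m (r s)) -> (forall s, TF m.+1 (E s)) ->
  (forall s, cong (TF m.+1) (X s) (word [:: r s] + E s + star c X s)) ->
  forall s, cong (TF m.+1) (X s) (word [:: r s]).
Proof.
move=> hr hE hX.
have Xm : forall s, TF m (X s).
  apply: (@star_unique m c) => s.
  apply: (cong_trans (TF_submod _ _) (TF_le (leqnSn m) (hX s))).
  rewrite /cong addrK; apply: submodD; [exact: TF_submod|exact: TF_single|].
  exact: TF_le (leqnSn m) (hE s).
move=> s; apply: (cong_trans (TF_submod _ _) (hX s)).
rewrite /cong -[_ + E s + _]addrA [word _ + (_ + _)]addrC addrK.
apply: submodD => //; first exact: TF_submod.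
by rewrite -add1n; apply: star_TF => // t; apply: fil1.
Qed.

Lemma pure_bilin : bilin (@pure F (Tbar A) (Tbar A)).
Proof. by split=> [u|u]; [apply: pure_linear_l|apply: pure_linear_r]. Qed.

Lemma Tconsl_bilin : bilin (fun (x : A) t => Tconsl x t).
Proof. by split=> [u|x]; [apply: Tconsl_linear|apply: linearP]. Qed.

Local Notation box := (conv (@pure F (Tbar A) (Tbar A))).
Local Notation starl := (conv (fun (x : A) t => Tconsl x t)).
Local Notation single a := (fun t => word [:: a t]).

Lemma box_cong k G G' H H' s :
  (forall s, cong (TF k) (G s) (G' s)) -> (forall s, cong (TF k) (H s) (H' s)) ->
  cong (TF2 k) (box G H s) (box G' H' s).
Proof.
move=> GG HH; apply: (cong_trans (TF2_submod _ _) (y := box G' H s)).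
  rewrite /cong -(convBl pure_bilin); apply: submod_sum => [|v _]; first exact: TF2_submod.
  by apply: (TF2_pure (i := k) (j := 1)); [rewrite leq_addr|apply: GG|apply: TF_bot].
rewrite /cong -(convBr pure_bilin); apply: submod_sum => [|v _]; first exact: TF2_submod.
by apply: (TF2_pure (i := 1) (j := k)); [rewrite leq_addl|apply: TF_bot|apply: HH].
Qed.

Lemma box_star a G H s : box (star a G) H s = starl a (box G H) s.
Proof.
by apply: conv_assoc => [||x u v]; [apply: pure_bilin|apply: Tconsl_bilin|rewrite tmapE].
Qed.

Lemma coprod_star a G s :
  coprod A (star a G s) = box (single a) G s + starl a (fun t => coprod A (G t)) s.
Proof.
rewrite /star conv_lin /conv -big_split; apply: eq_bigr => v _ /=; exact: coprod_cons.
Qed.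

Lemma coprod_cong k u v : cong (TF k) u v -> cong (TF2 k) (coprod A u) (coprod A v).
Proof. by rewrite /cong -linearB; apply: TF2_coprod. Qed.

Lemma starl_unique N c Z :
  (forall s, cong (TF2 N) (Z s) (starl c Z s)) -> forall s, TF2 N (Z s).
Proof.
apply: (conv_fixed_point (P := @TF2 F A)) => [k|w|j k w|k x w].
- exact: TF2_submod.
- exact: TF2_bot w.
- exact: TF2_le.
- by rewrite -add1n; apply: TF2_consl; apply: fil1.
Qed.

Lemma starl_cong k a Z Z' s : (forall s, cong (TF2 k) (Z s) (Z' s)) ->
  cong (TF2 k) (starl a Z s) (starl a Z' s).
Proof.
move=> ZZ; rewrite /cong -(convBr Tconsl_bilin); apply: submod_sum => [|v _].
  exact: TF2_submod.
by apply: (TF2_consl (i := 0)); [apply: fil_bot|apply: ZZ].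
Qed.

(** Group-likeness of G = [ser a N]: both sides solve Z = box(a, G) + a Z modulo [TF2 N], so their
    difference solves the homogeneous equation. *)
Lemma ser_coprod a N s :
  cong (TF2 N) (coprod A (ser a N s)) (box (ser a N) (ser a N) s).
Proof.
have hT := TF2_submod A N; set G := ser a N.
apply: (@starl_unique N a (fun s => coprod A (G s) - box G G s)) => t.
rewrite (convBr Tconsl_bilin).
have -> : starl a (fun t => coprod A (G t)) t - starl a (box G G) t
  = (box (single a) G t + starl a (fun t => coprod A (G t)) t)
    - (box (single a) G t + starl a (box G G) t) by rewrite opprD addrACA subrr add0r.
apply: congB => //.
  rewrite -coprod_star -[X in cong _ _ X]add0r -(coprod_single (a t)) -linearD.
  exact/coprod_cong/ser_fix.
rewrite -box_star -(convDl pure_bilin).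
by apply: box_cong => [u|u]; [apply: ser_fix|exact: TF_refl].
Qed.

(** [ser2] is a coderivation along two group-like series: a word a^i x b^j is split either to the
    right or to the left of x. *)
Lemma ser2_coprod a x b N s :
  cong (TF2 N) (coprod A (ser2 a x b N s))
    (box (ser2 a x b N) (ser b N) s + box (ser a N) (ser2 a x b N) s).
Proof.
have hT := TF2_submod A N; set Y := ser2 a x b N; set G := ser b N; set H := ser a N.
apply: (@starl_unique N a (fun s => coprod A (Y s) - (box Y G s + box H Y s))) => t.
rewrite (convBr Tconsl_bilin) (convDr Tconsl_bilin).
(* [K] is the inhomogeneous term of the recursion that both sides satisfy. *)
pose K := box (single x) G t + starl x (box G G) t + box (single a) Y t.
have -> : starl a (fun t => coprod A (Y t)) t - (starl a (box Y G) t + starl a (box H Y) t)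
  = (K + starl a (fun t => coprod A (Y t)) t)
    - (K + (starl a (box Y G) t + starl a (box H Y) t)).
  by rewrite [in RHS]opprD addrACA subrr add0r.
apply: congB => //.
  apply: (cong_trans hT (coprod_cong (ser2_fix a x b N t))).
  rewrite !linearD /= coprod_single add0r !coprod_star -/Y -/G /K -!addrA.
  apply: congD => //; first exact: cong_refl.
  apply: congD => //; last exact: cong_refl.
  by apply: starl_cong => u; apply: ser_coprod.
apply: (cong_trans hT (y := box (fun t => single x t + star x G t + star a Y t) G t
                          + box (fun t => single a t + star a H t) Y t)).
  by apply: congD => //; apply: box_cong => u;
    [apply: ser2_fix|exact: TF_refl|apply: ser_fix|exact: TF_refl].
rewrite !(convDl pure_bilin) !box_star; apply: cong_eq => //.
by rewrite /K -!addrA; congr (_ + (_ + _)); rewrite addrCA.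
Qed.

Lemma Tcons2_TF (B : complex F) N (g : {linear Tbar A -> B})
    (h : {linear Tbar A -> Tbar B}) t :
  (forall k u, TF k u -> fil k (g u)) -> (forall k u, TF k u -> TF k (h u)) ->
  TF2 N t -> TF N (Tcons2 (tmap g h t)).
Proof.
move=> hg hh; apply: (span_min (Q := fun t => TF N (Tcons2 (tmap g h t)))).
  exact: (submod_preim (Tcons2 \o tmap g h) (TF_submod B N)).
move=> y [i [j [u [v [ij h1 h2 ->]]]]]; rewrite tmapE Tcons2E.
by apply: TF_le ij _; apply: TF_cons; [apply: hg|apply: hh].
Qed.

End Series.

(** * Curvature and Bianchi identities *)

Section FunctionDegree.
Context (F : fieldType) (M : lmodType F) (Gr : grading M) (n : nat).

(* The coefficient at a p-simplex of a degree r element of M (x) N^*(Delta^n) has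
   degree r - p. *)
Definition fdeg (r : int) (f : {set 'I_n.+1} -> M) :=
  f set0 = 0 /\ forall s : {set 'I_n.+1}, homog Gr (r - (#|s|.-1)%:Z) (f s).

Lemma fdeg_tw r f : fdeg r f -> fdeg r (tw f).
Proof.
move=> [f0 hf]; split=> [|s]; first exact: tw_set0.
by apply: submodZ; [apply: homog_submod|apply: hf].
Qed.

(** The value at a p-simplex has degree -p, so the sign of moving an odd symbol past it depends on
    the dimension only. *)
Lemma ksign_deg0 f s : fdeg 0 f -> ksign Gr 1 (f s) = tw f s.
Proof.
by move=> [_ hf]; rewrite (ksignE 1 (hf s)) /tw /ksgn mul1r sub0r abszN.
Qed.

Lemma ksign_degN1 f s : fdeg (-1) f -> ksign Gr 1 (f s) = - tw f s.
Proof.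
move=> [_ hf]; rewrite (ksignE 1 (hf s)) /tw /ksgn -scaleNr -[- _ ^+ _]mulN1r -exprS.
by rewrite mul1r -opprD abszN -PoszD add1n.
Qed.

End FunctionDegree.

Section ConvolutionDegree.
Context (F : fieldType) (A : complex F) (n : nat).
Implicit Types (a b x : {set 'I_n.+1} -> A).

Definition Tdeg (r : int) (G : {set 'I_n.+1} -> Tbar A) :=
  forall s : {set 'I_n.+1}, Thomog (gr A) (r - (#|s|.-1)%:Z) (G s).

Lemma star_deg p r a G : fdeg (gr A) p a -> Tdeg r G -> Tdeg (p + r) (star a G).
Proof.
move=> [_ ha] hG s; apply: submod_sum => [|v vs]; first exact: Thomog_submod.
have -> : p + r - (#|s|.-1)%:Z = (p - (#|lowf v s|.-1)%:Z) + (r - (#|highf v s|.-1)%:Z).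
  have := card_low_high vs; have := low_neq0 vs; have := high_neq0 vs.
  by rewrite -!card_gt0; lia.
exact: Thomog_cons.
Qed.

Lemma ser_deg a N : fdeg (gr A) 0 a -> Tdeg 0 (ser a N).
Proof.
move=> ha; elim: N => [|N IH] s; first exact: (Thomog_submod _ _).1.
apply: submodD; first exact: Thomog_submod.
  by apply: Thomog_single; apply: ha.2.
by rewrite -[0]addr0; apply: star_deg.
Qed.

Lemma ser2_deg r a x b N : fdeg (gr A) 0 a -> fdeg (gr A) r x -> fdeg (gr A) 0 b ->
  Tdeg r (ser2 a x b N).
Proof.
move=> ha hx hb; elim: N => [|N IH] s; first exact: (Thomog_submod _ _).1.
apply: submodD; first exact: Thomog_submod.
  apply: submodD; first exact: Thomog_submod.
    by apply: Thomog_single; apply: hx.2.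
  by rewrite -[r]addr0; apply: star_deg => //; apply: ser_deg.
by rewrite -[r]add0r; apply: star_deg.
Qed.

Lemma Tcons2_box (B : complex F) (g : {linear Tbar A -> B}) (h : {linear Tbar A -> Tbar B})
    (G H : {set 'I_n.+1} -> Tbar A) s :
  Tcons2 (tmap g h (conv (@pure F (Tbar A) (Tbar A)) G H s))
  = star (fun t => g (G t)) (fun t => h (H t)) s.
Proof.
rewrite /conv /star /conv !linear_sum; apply: eq_bigr => v _ /=.
by rewrite tmapE Tcons2E.
Qed.

Lemma Tcons2_cong (B : complex F) N (g : {linear Tbar A -> B})
    (h : {linear Tbar A -> Tbar B}) t t' :
  (forall k u, TF k u -> fil k (g u)) -> (forall k u, TF k u -> TF k (h u)) ->
  cong (TF2 N) t t' -> cong (TF N) (Tcons2 (tmap g h t)) (Tcons2 (tmap g h t')).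
Proof. by move=> hg hh; rewrite /cong -!linearB; apply: Tcons2_TF. Qed.

Lemma star_ext a a' (G G' : {set 'I_n.+1} -> Tbar A) s :
  a =1 a' -> G =1 G' -> star a G s = star a' G' s.
Proof. by move=> /funext -> /funext ->. Qed.

End ConvolutionDegree.

Section Curvature.
Context (F : fieldType) (A : ainf F) (n : nat).
Local Notation T := {set 'I_n.+1}.
Local Notation Q := (aQ A).
Local Notation pQ := (pQ A).
Implicit Types (s : T) (a b x : T -> A) (G H : T -> Tbar A).

Let TS := TF_submod A.

Lemma ksign_proj_TF k (u : Tbar A) : TF k u -> fil k ((ksign (gr A) 1 \o Tproj A) u).
Proof. by move=> hu; apply: fil_ksign; apply: TF_proj. Qed.

(** The recursion of Q on a group-like series. The truncation index is a successor because the
    one-letter part of the series must be a itself, which Q passes with the sign [tw]. *)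
Lemma aQ_ser a N s : fdeg (gr A) 0 a ->
  cong (TF N.+1) (Q (ser a N.+1 s))
    (word [:: pQ (ser a N.+1 s)] + star (fun t => pQ (ser a N.+1 t)) (ser a N.+1) s
     + star (tw a) (fun t => Q (ser a N.+1 t)) s).
Proof.
move=> ha; rewrite {1}aQ_decomp.
apply: congD => //; first apply: congD => //; first exact: TF_refl.
  rewrite -[X in cong _ _ X](Tcons2_box pQ idfun).
  by apply: Tcons2_cong => //; [apply: pQ_TF|apply: ser_coprod].
apply: (cong_trans (TS _) (Tcons2_cong ksign_proj_TF (@TF_aQ F A) (ser_coprod a N.+1 s))).
rewrite Tcons2_box; apply: cong_eq => //; apply: star_ext => // t.
by rewrite /= -/(ser a N.+1 t) ser_proj ksign_deg0.
Qed.

Lemma bd_ser a N s : a set0 = 0 ->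
  cong (TF N) (bd (ser a N) s)
    (word [:: bd a s] + star (bd a) (ser a N) s + star (tw a) (bd (ser a N)) s).
Proof.
move=> a0; apply: (cong_trans (TS _) (bd_cong s (TS N) (ser_fix a N))).
rewrite bdD bd_word1 -addrA; apply: cong_eq => //; congr (_ + _).
by apply: bd_conv => //; [apply: Tcons_bilin|apply: ser_set0].
Qed.

(* a is a Maurer-Cartan element when curv a N s lies in F_N for all N. *)
Definition curv a N s : A := pQ (ser a N s) - bd a s.
Definition dQser a N s : Tbar A := Q (ser a N s) - bd (ser a N) s.

(** [aQ_ser] and [bd_ser] have the same shape and the same twist on a. Their difference is thus a
    recursion whose inhomogeneous terms contain nothing but the curvature. *)
Lemma dQser_fix a N s : fdeg (gr A) 0 a ->
  cong (TF N.+1) (dQser a N.+1 s)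
    (word [:: curv a N.+1 s] + star (curv a N.+1) (ser a N.+1) s
     + star (tw a) (dQser a N.+1) s).
Proof.
move=> ha; apply: (cong_trans (TS _) (congB (TS _) (aQ_ser N s ha) (bd_ser N.+1 s ha.1))).
apply: cong_eq => //; rewrite [curv _ _ s]/(_ - _) word1B /star.
rewrite (_ : curv a N.+1 = fun t => pQ (ser a N.+1 t) - bd a t) //.
rewrite (_ : dQser a N.+1 = fun t => Q (ser a N.+1 t) - bd (ser a N.+1) t) //.
rewrite (convBl (@Tcons_bilin F A)) (convBr (@Tcons_bilin F A)) !opprD addrACA.
by congr (_ + _); rewrite addrACA.
Qed.

Lemma dQser_curv a m s : fdeg (gr A) 0 a -> (forall s, fil m (curv a m.+1 s)) ->
  cong (TF m.+1) (dQser a m.+1 s) (word [:: curv a m.+1 s]).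
Proof.
move=> ha hR; apply: (star_absorb (c := tw a) (E := star (curv a m.+1) (ser a m.+1))) => // t.
  by have := star_TF t hR (fun u => TF_bot (ser a m.+1 u)); rewrite addn1.
exact: dQser_fix.
Qed.

Lemma pQ_cong k (u v : Tbar A) : cong (TF k) u v -> cong (@fil F A k) (pQ u) (pQ v).
Proof. by rewrite /cong -linearB; apply: pQ_TF. Qed.

Lemma Tproj_cong k (u v : Tbar A) :
  cong (TF k) u v -> cong (@fil F A k) (Tproj A u) (Tproj A v).
Proof. by rewrite /cong -linearB; apply: TF_proj. Qed.

(** Q + bd annihilates the defect QG - G bd, because both squares vanish and Q, acting on
    coefficients, commutes with bd. Modulo weight m + 1 the defect is its leading letter, the
    curvature. *)
Lemma bianchi a m s : fdeg (gr A) 0 a -> (forall s, fil m (curv a m.+1 s)) ->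
  fil m.+1 (dif A (curv a m.+1 s) + bd (curv a m.+1) s).
Proof.
move=> ha hR; have hX := fun s => dQser_curv s ha hR.
have FS := fil_submod A m.+1; set R := curv a m.+1 in hX *; set X := dQser a m.+1 in hX *.
have E : Q (X s) + bd X s = 0.
  rewrite /X /dQser linearB aQ_sq bdB bd_lin bd_bd ?subr0 ?sub0r ?addNr //.
  exact: ser_set0 ha.1.
have /(cong_sym FS) h1 := pQ_cong (hX s); rewrite pQ_single in h1.
have h2 : cong (@fil F A m.+1) (bd R s) (Tproj A (bd X s)).
  rewrite -bd_lin; apply: bd_cong => // t; apply: (cong_sym FS).
  by have := Tproj_cong (hX t); rewrite TprojE.
have E' : pQ (X s) + Tproj A (bd X s) = 0.
  by rewrite -[pQ _]/(Tproj A (Q (X s))) -linearD E linear0.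
by have := congD FS h1 h2; rewrite E' => /cong0.
Qed.

Variables (al x b : T -> A).
Hypotheses (hal : fdeg (gr A) 0 al) (hx : fdeg (gr A) (-1) x) (hb : fdeg (gr A) 0 b).

(* x is a path from al to b, i.e. a Maurer-Cartan element over N^*(Delta^1) with these
   ends, when pathcurv N s lies in F_N for all N; the twist is the Koszul sign of moving
   the odd x past al. *)
Definition pathser N s : Tbar A := ser2 (tw al) x b N s.

Definition pathcurv N s : A := pQ (pathser N s) + bd x s - (b s - al s).

(** Q passes the letter x with an additional minus sign, as x is odd, and passes [tw al] with a sign
    that undoes the twist. *)
Lemma aQ_pathser N s :
  cong (TF N.+1) (Q (pathser N.+1 s))
    (word [:: pQ (pathser N.+1 s)] + star (fun t => pQ (pathser N.+1 t)) (ser b N.+1) s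
     + star (tw (fun t => pQ (ser al N.+1 t))) (pathser N.+1) s
     - star (tw x) (fun t => Q (ser b N.+1 t)) s
     + star al (fun t => Q (pathser N.+1 t)) s).
Proof.
set Y := pathser N.+1; rewrite {1}aQ_decomp.
have hY : cong (TF2 N.+1) (coprod A (Y s)) _ := ser2_coprod (tw al) x b N.+1 s.
have pal t : pQ (ser (tw al) N.+1 t) = tw (fun t => pQ (ser al N.+1 t)) t.
  by rewrite ser_tw /tw linearZ.
have h1 := Tcons2_cong (@pQ_TF F A) (fun k u h => h : TF k (idfun u)) hY.
have h2 := Tcons2_cong ksign_proj_TF (@TF_aQ F A) hY.
apply: (cong_trans (TS _) (congD (TS _) (congD (TS _) (TF_refl _ _) h1) h2)).
rewrite !linearD /= !Tcons2_box -!addrA; apply: cong_eq => //; congr (_ + (_ + _)).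
congr (_ + _).
  by apply: star_ext => // t; apply: pal.
rewrite -(convNl (@Tcons_bilin F A)); congr (_ + _); apply: star_ext => // t.
  by rewrite -[LHS]/(ksign (gr A) 1 (Tproj A (ser2 (tw al) x b N.+1 t))) ser2_proj ksign_degN1.
rewrite -[LHS]/(ksign (gr A) 1 (Tproj A (ser (tw al) N.+1 t))) ser_proj.
by rewrite (ksign_deg0 _ (fdeg_tw hal)) tw_tw.
Qed.

Lemma bd_pathser N s :
  cong (TF N) (bd (pathser N) s)
    (word [:: bd x s] + star (bd x) (ser b N) s - star (tw (bd al)) (pathser N) s
     + star (tw x) (bd (ser b N)) s + star al (bd (pathser N)) s).
Proof.
apply: (cong_trans (TS _) (bd_cong s (TS N) (ser2_fix _ _ _ N))).
have bc := bd_conv _ (@Tcons_bilin F A).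
rewrite !bdD bd_word1 /star !bc ?tw_set0 ?ser_set0 ?ser2_set0 ?(hal.1) ?(hx.1) ?(hb.1) //.
apply: cong_eq => //; rewrite -!/(star _ _ _) -!addrA; congr (_ + (_ + _)).
rewrite addrCA; congr (_ + (_ + _)); last by apply: star_ext => // t; apply: tw_tw.
rewrite -[RHS](convNl (@Tcons_bilin F A)); apply: star_ext => // t.
exact: tw_bd hal.1.
Qed.

Lemma ser_sub_fix N s :
  cong (TF N) (ser b N s - ser al N s)
    (word [:: b s - al s] + star (fun t => b t - al t) (ser b N) s
     + star al (fun t => ser b N t - ser al N t) s).
Proof.
apply: (cong_trans (TS _) (congB (TS N) (ser_fix b N s) (ser_fix al N s))).
rewrite /star (convBl (@Tcons_bilin F A)) (convBr (@Tcons_bilin F A)) word1B.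
apply: cong_eq => //; rewrite opprD addrACA -!addrA; congr (_ + (_ + (_ + _))).
by rewrite addKr.
Qed.

(** The defect of the path equation in the coalgebra, where [pathser] plays the role of a homotopy
    between the two group-like series. For positive N its projection to letters is [pathcurv]. *)
Definition dQpath N s : Tbar A :=
  Q (pathser N s) + bd (pathser N) s - (ser b N s - ser al N s).

Lemma dQpath_fix N s :
  cong (TF N.+1) (dQpath N.+1 s)
    (word [:: pathcurv N.+1 s]
     + (star (pathcurv N.+1) (ser b N.+1) s + star (tw (curv al N.+1)) (pathser N.+1) s
        - star (tw x) (dQser b N.+1) s)
     + star al (dQpath N.+1) s).
Proof.
have h := congB (TS _) (congD (TS _) (aQ_pathser N s) (bd_pathser N.+1 s)) (ser_sub_fix N.+1 s).
apply: (cong_trans (TS _) h); apply: cong_eq => //.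
have -> : star (pathcurv N.+1) (ser b N.+1) s
    = star (fun t => pQ (pathser N.+1 t)) (ser b N.+1) s + star (bd x) (ser b N.+1) s
      - star (fun t => b t - al t) (ser b N.+1) s.
  by rewrite /star -(convDl (@Tcons_bilin F A)) -(convBl (@Tcons_bilin F A)).
have -> : star (tw (curv al N.+1)) (pathser N.+1) s
    = star (tw (fun t => pQ (ser al N.+1 t))) (pathser N.+1) s
      - star (tw (bd al)) (pathser N.+1) s.
  by rewrite /star -(convBl (@Tcons_bilin F A)); apply: star_ext => // t; apply: scalerBr.
have -> : star (tw x) (dQser b N.+1) s
    = star (tw x) (fun t => Q (ser b N.+1 t)) s - star (tw x) (bd (ser b N.+1)) s.
  by rewrite /star -(convBr (@Tcons_bilin F A)).
have -> : star al (dQpath N.+1) s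
    = star al (fun t => Q (pathser N.+1 t)) s + star al (bd (pathser N.+1)) s
      - star al (fun t => ser b N.+1 t - ser al N.+1 t) s.
  by rewrite /star -(convDr (@Tcons_bilin F A)) -(convBr (@Tcons_bilin F A)).
rewrite [pathcurv _ _]/(_ + _ - _) 2!word1B word1D -word1B !opprD !opprK.
(* Thirteen terms: the one-letter part, three terms that carry a curvature or a defect, and the
   recursive tail. *)
exact: (AC (5*5*3) ((1*6*11)*((2*7*12)*(3*8)*(4*9))*(5*10*13))).
Qed.

Lemma dQpath_curv m s : (forall s, fil m (curv al m.+1 s)) ->
  (forall s, fil m (curv b m.+1 s)) -> (forall s, fil m (pathcurv m.+1 s)) ->
  cong (TF m.+1) (dQpath m.+1 s) (word [:: pathcurv m.+1 s]).
Proof.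
move=> ha hbb hS; apply: (star_absorb (c := al) (r := pathcurv m.+1)) (fun s => dQpath_fix m s) s.
  exact: hS.
move=> t; apply: submodB => //; first apply: submodD => //.
- by have := star_TF t hS (fun u => TF_bot (ser b m.+1 u)); rewrite addn1.
- have htw u : fil m (tw (curv al m.+1) u).
    by apply: submodZ; [apply: fil_submod|apply: ha].
  by have := star_TF t htw (fun u => TF_bot (pathser m.+1 u)); rewrite addn1.
rewrite -add1n; apply: star_TF => [u|u]; first exact: fil1.
apply: (cong_mem (TS _) (TF_le (leqnSn m) (dQser_curv u hb hbb))).
exact: TF_single.
Qed.

(** Q - bd applied to [dQpath] leaves the difference of the defects of the two ends. Control of the
    path and of one end therefore controls the curvature of the other end one step further. *)
Lemma path_bianchi m s : (forall s, fil m (curv al m.+1 s)) ->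
  (forall s, fil m (curv b m.+1 s)) -> (forall s, fil m (pathcurv m.+1 s)) ->
  fil m.+1 (dif A (pathcurv m.+1 s) - bd (pathcurv m.+1) s
            + (curv b m.+1 s - curv al m.+1 s)).
Proof.
move=> ha hbb hS; have hX := fun s => dQpath_curv s ha hbb hS.
have FS := fil_submod A m.+1; set S := pathcurv m.+1 in hX *; set X := dQpath m.+1 in hX *.
set R := curv b _ _ - curv al _ _.
have E : pQ (X s) - Tproj A (bd X s) = - R.
  have e1 : Q (X s) = Q (bd (pathser m.+1) s) - (Q (ser b m.+1 s) - Q (ser al m.+1 s)).
    by rewrite -[X s]/(_ + _ - _) linearB (linearD Q) aQ_sq add0r (linearB Q).
  have e2 : bd X s = bd (fun t => Q (pathser m.+1 t)) s - (bd (ser b m.+1) s - bd (ser al m.+1) s).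
    transitivity (bd (fun t => Q (pathser m.+1 t) + bd (pathser m.+1) t) s
      - bd (fun t => ser b m.+1 t - ser al m.+1 t) s); first exact: bdB.
    congr (_ - _); last exact: bdB.
    by rewrite bdD bd_bd ?addr0 //; apply: ser2_set0; case: hx.
  have e3 c : Tproj A (bd (ser c m.+1) s) = bd c s.
    by rewrite -bd_lin; congr (bd _ _); apply: funext => t; rewrite ser_proj.
  have e5 c : Tproj A (dQser c m.+1 s) = curv c m.+1 s by rewrite /dQser linearB e3.
  have e4 : Q (X s) - bd X s = dQser al m.+1 s - dQser b m.+1 s.
    rewrite e1 e2 (bd_lin Q) /dQser !opprB.
    have AC (V : zmodType) (y q q' c c' : V) : y + (q - q') + (c - c' - y) = q - c' + (c - q').
      by rewrite [LHS](AC ((1*2)*(2*1)) ((1*6)*((2*5)*(4*3)))) /= subrr add0r.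
    exact: AC.
  rewrite -[pQ _]/(Tproj A (Q (X s))) -linearB e4 (linearB (Tproj A)) !e5.
  by rewrite /R [RHS]opprB.
have /(cong_sym FS) h1 := pQ_cong (hX s); rewrite pQ_single in h1.
have h2 : cong (@fil F A m.+1) (bd S s) (Tproj A (bd X s)).
  rewrite -bd_lin; apply: bd_cong => // t; apply: (cong_sym FS).
  by have := Tproj_cong (hX t); rewrite TprojE.
by have := congB FS h1 h2; rewrite E /cong opprK.
Qed.

End Curvature.

Section MorphismCurvature.
Context (F : fieldType) (A A' : ainf F) (Th : amor A A') (n : nat).
Local Notation T := {set 'I_n.+1}.
Implicit Types (s : T) (a : T -> A).

Definition thser a N s : A' := pTh Th (ser a N s).

Definition lin1 : {linear A -> A'} := pTh Th \o @Tsingle F A.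

Lemma pTh_cong k (u v : Tbar A) : cong (TF k) u v -> cong (@fil F A' k) (pTh Th u) (pTh Th v).
Proof. by rewrite /cong -linearB; apply: pTh_TF. Qed.

Lemma thser_set0 a N : a set0 = 0 -> thser a N set0 = 0.
Proof. by move=> a0; rewrite /thser ser_set0 // linear0. Qed.

Lemma thser_deg a N : fdeg (gr A) 0 a -> fdeg (gr A') 0 (thser a N).
Proof.
move=> ha; split=> [|s]; first exact: thser_set0 ha.1.
by apply: pTh_homog; apply: ser_deg.
Qed.

Lemma aphi_ser a N s :
  cong (TF N) (aphi Th (ser a N s))
    (word [:: thser a N s] + star (thser a N) (fun t => aphi Th (ser a N t)) s).
Proof.
rewrite {1}aphi_decomp; apply: congD; [exact: TF_submod|exact: TF_refl|].
rewrite -[X in cong _ _ X](Tcons2_box (pTh Th) (aphi Th)).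
by apply: Tcons2_cong; [apply: pTh_TF|apply: TF_aphi|apply: ser_coprod].
Qed.

(** A coalgebra map sends group-like series to group-like series, and these are determined by their
    letter part: both sides solve the same recursion. *)
Lemma aphi_ser_cong a N s : cong (TF N) (aphi Th (ser a N s)) (ser (thser a N) N s).
Proof.
apply: (@star_unique _ _ _ N (thser a N)
  (fun s => aphi Th (ser a N s) - ser (thser a N) N s)) => t.
rewrite /star (convBr (@Tcons_bilin F A')).
have -> (x y : Tbar A') : x - y
  = (word [:: thser a N t] + x) - (word [:: thser a N t] + y).
  by rewrite opprD addrACA subrr add0r.
by apply: congB; [apply: TF_submod|apply: aphi_ser|apply: ser_fix].
Qed.

(** Theta commutes with Q and with bd, so it maps the defect of a to that of its image. Modulo
    weight m + 1 the former is a single letter, on which only the linear term acts. *)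
Lemma curv_thser a m s : fdeg (gr A) 0 a -> (forall s, fil m (curv a m.+1 s)) ->
  cong (@fil F A' m.+1) (curv (thser a m.+1) m.+1 s) (lin1 (curv a m.+1 s)).
Proof.
move=> ha hR; have FS := fil_submod A' m.+1.
have h1 := pQ_cong (aphi_ser_cong a m.+1 s).
apply: (cong_trans FS (y := pTh Th (dQser a m.+1 s))); last first.
  by apply: pTh_cong; apply: dQser_curv.
rewrite /curv /dQser (linearB (pTh Th)) -(bd_lin (pTh Th)).
apply: (congB FS); last exact: cong_refl.
by apply: (cong_sym FS); rewrite /= aphi_Q in h1 *.
Qed.

End MorphismCurvature.

(** * Contractions *)

Section FixedPoint.
Context (F : fieldType) (K : lmodType F) (I : Type).
Context (flt : nat -> K -> Prop) (hom : I -> K -> Prop).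
Hypothesis flt_submod : forall N, submod (flt N).
Hypothesis flt_decr : forall N x, flt N.+1 x -> flt N x.
Hypothesis flt0 : forall x, flt 0 x.
Hypothesis flt_sep : forall x, (forall N, flt N x) -> x = 0.
Hypothesis flt_lim : forall i (u : nat -> K),
  (forall N, hom i (u N)) -> (forall N, flt N (u N.+1 - u N)) ->
  exists2 x, hom i x & forall N, flt N (x - u N).

Definition cls (x : I -> K) := forall i, hom i (x i).
Definition fcong N (x y : I -> K) := forall i, cong (flt N) (x i) (y i).

Context (Phi : nat -> (I -> K) -> I -> K).
Hypothesis Phi_cls : forall N x, cls x -> cls (Phi N x).
Hypothesis Phi_contr : forall N x y, cls x -> cls y ->
  fcong N x y -> fcong N.+1 (Phi N.+1 x) (Phi N.+1 y).
Hypothesis Phi_stable : forall N x, cls x -> fcong N (Phi N.+1 x) (Phi N x).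

(** [Phi N] is the N-th truncation of a contraction and matters only modulo F_N; each iterate uses
    the next truncation and gains one step. The predicate [hom] fixes the degree at each index,
    because completeness is assumed degreewise. *)
Lemma fixed_point_exists x0 : cls x0 -> exists2 x, cls x & forall N, fcong N x (Phi N x).
Proof.
move=> h0; pose u := fix u N := if N is k.+1 then Phi k.+1 (u k) else x0.
have uc N : cls (u N) by elim: N => [|N IH] //=; apply: Phi_cls.
have us N : fcong N (u N.+1) (u N).
  elim: N => [|N IH] i; first exact: flt0.
  apply: (cong_trans (flt_submod _) (y := Phi N.+1 (u N.+1) i)).
    exact: Phi_stable (uc N.+1) i.
  exact: Phi_contr (uc N.+1) (uc N) IH i.
have ex i : exists x, hom i x /\ forall N, cong (flt N) x (u N i).
  by have [x hx hu] := flt_lim (fun N => uc N i) (fun N => us N i); exists x.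
have [x hx] := choice ex; have xc : cls x by move=> i; have [] := hx i.
exists x => // N i; case: N => [|N]; first exact: flt0.
apply: (cong_trans (flt_submod _) (y := u N.+1 i)); first by have [_] := hx i.
by apply: Phi_contr => // j; apply: (cong_sym (flt_submod _)); have [_] := hx j.
Qed.

Lemma fixed_point_unique x y : cls x -> cls y ->
  (forall N, fcong N x (Phi N x)) -> (forall N, fcong N y (Phi N y)) -> x = y.
Proof.
move=> xc yc hx hy; apply: funext => i; apply/eqP; rewrite -subr_eq0; apply/eqP.
apply: flt_sep => N; move: i.
suff H : fcong N x y by [].
elim: N => [|N IH] i; first exact: flt0.
apply: (cong_trans (flt_submod _) (hx N.+1 i)); apply: (cong_sym (flt_submod _)).
apply: (cong_trans (flt_submod _) (hy N.+1 i)); apply: (cong_sym (flt_submod _)).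
by apply: Phi_contr.
Qed.

End FixedPoint.

(* Zorn's lemma on the graphs of partial filtered sections. *)
Section FilteredSection.
Context (F : fieldType) (K : lmodType F) (flt : nat -> K -> Prop) (d : {linear K -> K}).
Context (Z Y : K -> Prop).
Hypothesis flt_submod : forall N, submod (flt N).
Hypothesis flt_decr : forall N x, flt N.+1 x -> flt N x.
Hypothesis flt0 : forall x, flt 0 x.
Hypothesis flt_sep : forall x, (forall N, flt N x) -> x = 0.
Hypothesis flt_d : forall N x, flt N x -> flt N (d x).
Hypothesis Z_submod : submod Z.
Hypothesis Y_submod : submod Y.
Hypothesis Y_lim : forall u : nat -> K,
  (forall N, Y (u N)) -> (forall N, flt N (u N.+1 - u N)) ->
  exists2 x, Y x & forall N, flt N (x - u N).
Hypothesis acyclic : forall N z, Z z -> flt N z -> exists y, [/\ Y y, flt N y & d y = z].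

Definition good_graph (G : K * K -> Prop) :=
  [/\ forall z y, G (z, y) -> [/\ Z z, Y y & d y = z],
      forall N z y, G (z, y) -> flt N z -> flt N y,
      G (0, 0) &
      forall c z y z' y', G (z, y) -> G (z', y') -> G (c *: z + z', c *: y + y')].

(** The pair (0, y - y') belongs to G, and 0 lies in every F_N; preservation of the filtration and
    separatedness do the rest. *)
Lemma good_graph_fun G z y y' : good_graph G -> G (z, y) -> G (z, y') -> y = y'.
Proof.
move=> [_ Gf _ Gl] h h'; apply/eqP; rewrite -subr_eq0; apply/eqP; apply: flt_sep => N.
have := Gl (-1) _ _ _ _ h' h; rewrite !scaleN1r addNr addrC => /(Gf N); apply.
by case: (flt_submod N).
Qed.

Lemma flt_le M N x : (M <= N)%N -> flt N x -> flt M x.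
Proof. by move/subnK <-; elim: (N - M)%N => // k IH; rewrite addSn => /flt_decr. Qed.

(** The value at z must suit all z + u at once. If the filtration level of z + u is bounded over the
    domain, a lift taken at a u0 of highest level suits every u, since u - u0 is the difference of z
    + u and z + u0. *)
Lemma good_graph_extend G z : good_graph G -> Z z -> exists y, [/\ Y y, d y = z &
  forall N u v, G (u, v) -> flt N (z + u) -> flt N (y + v)].
Proof.
move=> [Gs Gf G0 Gl] Zz.
have GB u v u' v' : G (u, v) -> G (u', v') -> G (u - u', v - v').
  by move=> h h'; have := Gl (-1) _ _ _ _ h' h; rewrite !scaleN1r addrC [- v' + _]addrC.
have [[N0 hN0]|hN0] := pselect (exists N, forall u v, G (u, v) -> ~ flt N (z + u)).
  pose B N := `[< exists u v, G (u, v) /\ flt N (z + u) >].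
  have B0 : exists N, B N by exists 0%N; apply/asboolP; exists 0, 0.
  have Bb N : B N -> (N <= N0)%N.
    move=> /asboolP[u [v [h hu]]]; rewrite leqNgt; apply/negP => lt.
    exact: hN0 h (flt_le (ltnW lt) hu).
  have [N /asboolP[u0 [v0 [h0 hu0]]] Nmax] := ex_maxnP B0 Bb.
  have Zu : Z (z + u0) by apply: submodD => //; have [] := Gs _ _ h0.
  have [y [Yy hy dy]] := acyclic Zu hu0.
  have [_ Yv0 dv0] := Gs _ _ h0.
  exists (y - v0); split; first exact: submodB.
    by rewrite linearB dy dv0 addrK.
  move=> M u v h hu.
  have MN : (M <= N)%N by apply: Nmax; apply/asboolP; exists u, v.
  rewrite -addrA; apply: submodD => //; first exact: flt_le hy.
  rewrite addrC; apply: Gf (GB _ _ _ _ h h0) _.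
  have -> : u - u0 = (z + u) - (z + u0) by rewrite opprD addrACA subrr add0r.
  by apply: submodB => //; apply: flt_le hu0.
(* Otherwise z is a limit of elements -u of the domain. Its value is then forced to be the limit of
   the corresponding -v, which exists by completeness. *)
have ex N : exists p : K * K, G p /\ flt N (z + p.1).
  apply: contrapT => no; apply: hN0; exists N => u v h hu; apply: no.
  by exists (u, v).
have {ex} [p hp] := choice ex.
have hp1 N : G ((p N).1, (p N).2) by have [] := hp N; case: (p N).
have [y0 Yy0 hy0] : exists2 x, Y x & forall N, flt N (x - (p N).2).
  apply: Y_lim => N; first by have [] := Gs _ _ (hp1 N).
  apply: Gf (GB _ _ _ _ (hp1 N.+1) (hp1 N)) _.
  have -> : (p N.+1).1 - (p N).1 = (z + (p N.+1).1) - (z + (p N).1).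
    by rewrite opprD addrACA subrr add0r.
  by apply: submodB => //; [apply: flt_decr; have [] := hp N.+1|have [] := hp N].
exists (- y0); split; first exact: submodN.
  apply/eqP; rewrite -subr_eq0; apply/eqP; apply: flt_sep => N.
  have -> : d (- y0) - z = - (d (y0 - (p N).2) + (z + (p N).1)).
    rewrite linearN linearB; have [_ _ ->] := Gs _ _ (hp1 N).
    by rewrite [z + _]addrC addrA subrK opprD.
  apply: submodN => //; apply: submodD => //; first exact: flt_d.
  by have [] := hp N.
move=> N u v h hu.
have -> : - y0 + v = - (y0 - (p N).2) + (v - (p N).2).
  by rewrite opprB [RHS]addrC addrA subrK addrC.
apply: submodD => //; first exact: submodN.
apply: Gf (GB _ _ _ _ h (hp1 N)) _.
have -> : u - (p N).1 = (z + u) - (z + (p N).1) by rewrite opprD addrACA subrr add0r.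
by apply: submodB => //; have [] := hp N.
Qed.

Lemma filtered_section : exists sct : K -> K,
  [/\ forall z, Z z -> Y (sct z) /\ d (sct z) = z,
      forall N z, Z z -> flt N z -> flt N (sct z) &
      forall c z z', Z z -> Z z' -> sct (c *: z + z') = c *: sct z + sct z'].
Proof.
pose P (G : K * K -> Prop) := (exists q, G q) -> good_graph G.
have [Fs Fsub Ftot|G [PG Gmax]] := @classical_sets.Zorn_bigcup _ P.
  move=> [q0 [X0 FX0 Xq0]].
  have hX X q : Fs X -> X q -> good_graph X by move=> FX Xq; apply: Fsub FX _; exists q.
  have [_ _ X00 _] := hX _ _ FX0 Xq0.
  split=> [z y [X FX Xq]|N z y [X FX Xq]||c z y z' y' [X FX Xq] [X' FX' Xq']].
  - by have [h _ _ _] := hX _ _ FX Xq; apply: h.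
  - by have [_ h _ _] := hX _ _ FX Xq; apply: h.
  - by exists X0.
  have [XX'|X'X] := Ftot _ _ FX FX'.
    by exists X' => //; have [_ _ _ h] := hX _ _ FX' Xq'; apply: h => //; apply: XX'.
  by exists X => //; have [_ _ _ h] := hX _ _ FX Xq; apply: h => //; apply: X'X.
have hG : good_graph G.
  have [ex|no] := pselect (exists q, G q); first exact: PG.
  have good0 : good_graph (fun q => q = (0, 0)).
    split=> [z y [-> ->]|N z y [-> ->] //||c z y z' y' [-> ->] [-> ->]] //.
      by rewrite linear0; split=> //; [case: Z_submod|case: Y_submod].
    by rewrite scaler0 addr0.
  case: (Gmax (fun q => q = (0, 0))); last by [].
  split=> [q Gq|h]; first by case: no; exists q.
  by apply: no; exists (0, 0); apply: h.
have [Gs Gf G0 Gl] := hG.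
have ex z : exists y, Z z -> G (z, y).
  have [Zz|nZ] := pselect (Z z); last by exists 0.
  have [y [Yy dy hy]] := good_graph_extend hG Zz.
  exists y => _.
  pose G' (q : K * K) := exists u v c, G (u, v) /\ q = (u + c *: z, v + c *: y).
  apply: contrapT => nG; apply: (Gmax G'); first split.
  - by move=> [u v] h; exists u, v, 0; rewrite !scale0r !addr0.
  - by move=> h; apply: nG; apply: h; exists 0, 0, 1; rewrite !scale1r !add0r.
  move=> _; split.
  - move=> _ _ [u [v [c [h [-> ->]]]]]; have [Zu Yv dv] := Gs _ _ h; split.
    + by apply: submodD => //; apply: submodZ.
    + by apply: submodD => //; apply: submodZ.
    + by rewrite linearD linearZ /= dv dy.
  - move=> N _ _ [u [v [c [h [-> ->]]]]].
    (* [hy] treats coefficient 1 only; a nonzero c is reduced to it by division. *)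
    have [->|c0] := eqVneq c 0; first by rewrite !scale0r !addr0; apply: Gf h.
    move=> /(submodZ c^-1 (flt_submod N)); rewrite scalerDr scalerA mulVf // scale1r addrC.
    have h' : G (c^-1 *: u, c^-1 *: v) by have := Gl c^-1 _ _ _ _ h G0; rewrite !addr0.
    move/(hy N _ _ h')/(submodZ c (flt_submod N)).
    by rewrite scalerDr scalerA mulfV // scale1r addrC.
  - by exists 0, 0, 0; rewrite !scale0r !addr0.
  - move=> c _ _ _ _ [u [v [a [h [-> ->]]]]] [u' [v' [a' [h' [-> ->]]]]].
    exists (c *: u + u'), (c *: v + v'), (c * a + a'); split; first exact: Gl.
    by rewrite !scalerDl !scalerDr !scalerA; congr (_, _); rewrite addrACA.
have [sct hs] := choice ex; exists sct; split.
- by move=> z Zz; have [_ Ys ds] := Gs _ _ (hs _ Zz).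
- by move=> N z Zz; apply: Gf; apply: hs.
move=> c z z' Zz Zz'; apply: (good_graph_fun hG (z := c *: z + z')).
  by apply: hs; apply: submodD => //; apply: submodZ.
by apply: Gl; apply: hs.
Qed.

End FilteredSection.

(* The shifted mapping cone: (x, y) has degree i when x has degree i and y has degree
   i - 1. *)
Definition cone (F : fieldType) (M N : lmodType F) : lmodType F := (M * N)%type.

Section Cone.
Context (F : fieldType) (A A' : ainf F) (Th : amor A A').
Local Notation K := (cone A A').
Implicit Types (i : int) (N : nat) (k : K).

Lemma aQ_single (B : ainf F) (x : B) : aQ B (word [:: x]) = word [:: dif B x].
Proof. by rewrite aQ_decomp coprod_single !linear0 !addr0 pQ_single. Qed.

Lemma aphi_single (x : A) : aphi Th (word [:: x]) = word [:: lin1 Th x].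
Proof. by rewrite aphi_decomp coprod_single !linear0 addr0. Qed.

Lemma lin1_dif (x : A) : lin1 Th (dif A x) = dif A' (lin1 Th x).
Proof.
have := aphi_Q Th (word [:: x]); rewrite aphi_single !aQ_single aphi_single.
by move=> /(congr1 (Tproj A')); rewrite !TprojE.
Qed.

Lemma lin1_fil N (x : A) : fil N x -> fil N (lin1 Th x).
Proof. by move=> hx; apply: pTh_TF; apply: TF_single. Qed.

Lemma lin1_deg i (x : A) : homog (gr A) i x -> homog (gr A') i (lin1 Th x).
Proof. by move=> hx; apply: pTh_homog; apply: Thomog_single. Qed.

Definition cone_d k : K := (dif A k.1, - (dif A' k.2 + lin1 Th k.1)).

Fact cone_d_linear : linear cone_d.
Proof.
move=> c [x y] [x' y']; rewrite /cone_d /=; congr (_, _); first exact: linearP.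
by rewrite !linearP /= scalerN -opprD scalerDr; congr (- _); rewrite addrACA.
Qed.
HB.instance Definition _ := GRing.isLinear.Build F K K *:%R cone_d cone_d_linear.

Definition kfil N k := fil N k.1 /\ fil N k.2.
Definition kdeg i k := homog (gr A) i k.1 /\ homog (gr A') (i - 1) k.2.

Lemma cone_dd k : cone_d (cone_d k) = 0.
Proof.
case: k => x y; congr (_, _); first exact: dif_dif.
have E : dif A' (- (dif A' y + lin1 Th x)) + lin1 Th (dif A x) = 0.
  by rewrite linearN linearD dif_dif add0r lin1_dif addNr.
by rewrite -[RHS]oppr0 -E.
Qed.

Lemma kfil_submod N : submod (kfil N).
Proof.
split=> [|c [x y] [x' y'] [h1 h2] [h1' h2']]; first by split; apply: fil0.
by split; apply: fil_linear.
Qed.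

Lemma kdeg_submod i : submod (kdeg i).
Proof.
split=> [|c [x y] [x' y'] [h1 h2] [h1' h2']].
  by split; apply: (homog_submod _ _).1.
by split; apply: (homog_submod _ _).2.
Qed.

Lemma kfil_decr N k : kfil N.+1 k -> kfil N k.
Proof. by case=> h1 h2; split; apply: fil_decr. Qed.

Lemma kfil_bot k : kfil 0 k.
Proof. by split; apply: fil_bot. Qed.

Lemma kfil_sep k : (forall N, kfil N k) -> k = 0.
Proof.
case: k => x y h; congr (_, _); apply: fil_sep => N; by have [] := h N.
Qed.

Lemma kfil_d N k : kfil N k -> kfil N (cone_d k).
Proof.
case=> h1 h2; split; first exact: fil_dif.
apply: submodN; first exact: fil_submod.
by apply: submodD; [apply: fil_submod|apply: fil_dif|apply: lin1_fil].
Qed.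

Lemma kdeg_d i k : kdeg i k -> kdeg (i + 1) (cone_d k).
Proof.
case=> h1 h2; split; first exact: dif_deg.
apply: submodN; first exact: homog_submod.
apply: submodD; first exact: homog_submod.
  by rewrite addrAC; apply: dif_deg.
by rewrite addrK; apply: lin1_deg.
Qed.

Lemma kfil_lim i (u : nat -> K) :
  (forall N, kdeg i (u N)) -> (forall N, kfil N (u N.+1 - u N)) ->
  exists2 x, kdeg i x & forall N, kfil N (x - u N).
Proof.
move=> hu cu.
have [x hx cx] := fil_lim (fun N => (hu N).1) (fun N => (cu N).1).
have [y hy cy] := fil_lim (fun N => (hu N).2) (fun N => (cu N).2).
by exists (x, y).
Qed.

Hypothesis Th_we : weak_equivalence Th.

(** Injectivity in cohomology makes x a boundary d z within F_N; then Theta z + y is a cocycle, and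
    surjectivity corrects z by a cocycle c. *)
Lemma cone_acyclic i N k : kdeg i k -> cone_d k = 0 -> kfil N k ->
  exists k', [/\ kdeg (i - 1) k', kfil N k' & cone_d k' = k].
Proof.
(* Weak equivalence speaks of positive levels only; level 0 is the whole cone and equals level 1. *)
wlog N0 : N / (0 < N)%N => [IH|].
  case: N => [|N]; last exact: IH.
  move=> h1 h2 _; have [|k' [? _ ?]] := IH 1%N isT h1 h2; first by split; apply: fil1.
  by exists k'; split=> //; apply: kfil_bot.
case: k => x y [hx hy] [dx dy] [fx fy]; rewrite /= in hx hy fx fy.
have {}dy : lin1 Th x = dif A' (- y).
  by apply/eqP; rewrite linearN -addr_eq0 addrC -oppr_eq0 dy.
have cx : cocycle N i x by [].
have c0 : cocycle N i (0 : A).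
  by split; [apply: (homog_submod _ _).1|apply: fil0|rewrite linear0].
have [z [hz fz xz]] : cohomologous N i x 0.
  have [inj _] := Th_we N0 i; apply: inj => //; exists (- y); split.
  - by apply: submodN hy; apply: homog_submod.
  - by apply: submodN fy; apply: fil_submod.
  by rewrite -[smap _ [:: 0]]/(lin1 Th 0) linear0 subr0.
rewrite subr0 in xz.
have cz : cocycle N (i - 1) (lin1 Th z + y).
  split; first by apply: submodD => //; [apply: homog_submod|apply: lin1_deg].
    by apply: submodD => //; [apply: fil_submod|apply: lin1_fil].
  by rewrite linearD /= -lin1_dif -xz dy linearN addNr.
have [_ surj] := Th_we N0 (i - 1).
have [c [hc fc dc] [u [hu fu E]]] := surj _ cz.
(* Here Theta z + y - Theta c = d u, so the second component of the boundary is d u - Theta (z - c)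
   = y. *)
exists (z - c, - u); split.
- split=> /=; first by apply: submodB hz hc; apply: homog_submod.
  by apply: submodN hu; apply: homog_submod.
- split=> /=; first by apply: submodB fz fc; apply: fil_submod.
  by apply: submodN fu; apply: fil_submod.
congr (_, _); first by rewrite /= linearB dc subr0 xz.
have -> : lin1 Th (z - c, - u).1 = lin1 Th z - lin1 Th c by apply: linearB.
rewrite [dif A' _]linearN -E -[smap _ [:: c]]/(lin1 Th c).
have AC (V : zmodType) (a b e : V) : - (- (a + b - e) + (a - e)) = b.
  by rewrite opprD opprK [a + b - e]addrAC [LHS]addrAC subrr add0r.
exact: AC.
Qed.

(* The components hc i : K^i -> K^(i-1) of a filtered contraction of the cone. *)
Lemma cone_contraction : exists hc : int -> K -> K, forall i,
  [/\ forall c k k', kdeg i k -> kdeg i k' -> hc i (c *: k + k') = c *: hc i k + hc i k',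
      forall k, kdeg i k -> kdeg (i - 1) (hc i k),
      forall N k, kdeg i k -> kfil N k -> kfil N (hc i k) &
      forall k, kdeg i k -> cone_d (hc i k) + hc (i + 1) (cone_d k) = k].
Proof.
pose Z i k := kdeg i k /\ cone_d k = 0.
have Z_submod i : submod (Z i).
  split=> [|c k k' [h1 h2] [h1' h2']]; split.
  - exact: (kdeg_submod i).1.
  - exact: (linear0 cone_d).
  - exact: (kdeg_submod i).2.
  - by rewrite linearP /= h2 h2' scaler0 addr0.
(* One section for each degree, because limits in the cone exist for homogeneous sequences. *)
have /choice[sct hs] i := @filtered_section F K kfil cone_d (Z i) (kdeg (i - 1))
  kfil_submod kfil_decr kfil_bot kfil_sep kfil_d (Z_submod i) (kdeg_submod (i - 1))
  (@kfil_lim (i - 1)) (fun N z hz hN => cone_acyclic hz.1 hz.2 hN).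
have s0 i : sct i 0 = 0.
  have [_ _ h] := hs i; have := h (-1) 0 0 (Z_submod i).1 (Z_submod i).1.
  by rewrite scaler0 addr0 scaleN1r addNr.
have dZ i k : kdeg i k -> Z (i + 1) (cone_d k).
  by move=> hk; split; [apply: kdeg_d|apply: cone_dd].
have hd i k : kdeg i k -> kdeg i (sct (i + 1) (cone_d k)).
  by move=> /dZ hk; have [h _ _] := hs (i + 1); have := (h _ hk).1; rewrite addrK.
have hZ i k : kdeg i k -> Z i (k - sct (i + 1) (cone_d k)).
  move=> hk; split; first by apply: submodB (hd _ _ hk); [apply: kdeg_submod|].
  by have [h _ _] := hs (i + 1); rewrite linearB (h _ (dZ _ _ hk)).2 subrr.
(* With s the section, h = s (1 - s d): the element k - s d k is closed, so d h = 1 - s d, and h d =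
   s d because d^2 = 0. *)
exists (fun i k => sct i (k - sct (i + 1) (cone_d k))) => i; split.
- move=> c k k' hk hk'; have [_ _ l1] := hs (i + 1); have [_ _ l] := hs i.
  have E : cone_d (c *: k + k') = c *: cone_d k + cone_d k' by exact: cone_d_linear.
  rewrite -l; [|exact: hZ|exact: hZ].
  rewrite E l1; [|exact: dZ|exact: dZ]; congr (sct i _).
  by rewrite opprD addrACA scalerBr.
- by move=> k hk; have [h _ _] := hs i; apply: (h _ (hZ _ _ hk)).1.
- move=> N k hk fk; have [_ h _] := hs i; have [_ h1 _] := hs (i + 1).
  apply: h; first exact: hZ.
  by apply: (submodB (kfil_submod N) fk); apply: h1; [apply: dZ|apply: kfil_d].
move=> k hk; have [h _ _] := hs i.
by rewrite (h _ (hZ _ _ hk)).2 cone_dd s0 subr0 subrK.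
Qed.

End Cone.

(** * Solving the Maurer-Cartan equation *)

Section CurvatureStability.
Context (F : fieldType) (A : ainf F) (n : nat).
Implicit Types (a : {set 'I_n.+1} -> A).

Definition mc a := forall N s, fil N (curv a N s).

Lemma curv_stable a N s : cong (@fil F A N) (curv a N.+1 s) (curv a N s).
Proof.
apply: congB; [exact: fil_submod| |by apply: cong_refl; apply: fil_submod].
exact/pQ_cong/ser_stable.
Qed.

Lemma curv_cong a a' k N s : (forall s, cong (@fil F A k) (a s) (a' s)) ->
  cong (@fil F A k) (curv a N s) (curv a' N s).
Proof.
move=> aa; apply: congB; [exact: fil_submod| |by apply: bd_cong; first exact: fil_submod].
exact/pQ_cong/ser_cong.
Qed.

End CurvatureStability.

Section ZeroPath.
Context (F : fieldType) (A : complex F) (n : nat).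
Implicit Types (a b x : {set 'I_n.+1} -> A).

Lemma ser2_zero a x b N s : (forall t, x t = 0) -> ser2 a x b N s = 0.
Proof.
move=> x0; elim: N s => [|N IH] s //=; rewrite x0 word10 add0r /star /conv !big1 ?addr0 //.
  by move=> v _; rewrite IH linear0.
by move=> v _; rewrite x0 Tcons0.
Qed.

End ZeroPath.

Section MaurerCartanImage.
Context (F : fieldType) (A A' : ainf F) (Th : amor A A') (n : nat).
Implicit Types (a : {set 'I_n.+1} -> A) (al : {set 'I_n.+1} -> A').

Lemma thser_stable a N s : cong (@fil F A' N) (thser Th a N.+1 s) (thser Th a N s).
Proof. exact/pTh_cong/ser_stable. Qed.

Definition mc_image a al := forall N s, cong (@fil F A' N) (al s) (thser Th a N s).

Lemma mc_image_exists a : fdeg (gr A) 0 a -> exists2 al, fdeg (gr A') 0 al & mc_image a al.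
Proof.
move=> ha; have ex (s : {set 'I_n.+1}) : exists x, homog (gr A') (0 - (#|s|.-1)%:Z) x /\
    forall N, cong (@fil F A' N) x (thser Th a N s).
  have [x hx cx] := fil_lim (fun N => (thser_deg Th N ha).2 s) (fun N => thser_stable a N s).
  by exists x.
have [al hal] := choice ex; exists al; last by move=> N s; apply: (hal s).2.
split=> [|s]; last exact: (hal s).1.
by apply: fil_sep => N; have := (hal set0).2 N; rewrite thser_set0 ?ha.1 // => /cong0.
Qed.

Lemma mc_image_unique a al al' : mc_image a al -> mc_image a al' -> al = al'.
Proof.
move=> h h'; apply: funext => s; apply/eqP; rewrite -subr_eq0; apply/eqP.
have FS := fil_submod A'; apply: fil_sep => N.
exact: (cong_trans (FS N) (h N s) (cong_sym (FS N) (h' N s))).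
Qed.

Lemma mc_thser a N s : fdeg (gr A) 0 a -> mc a -> fil N (curv (thser Th a N) N s).
Proof.
case: N => [|N] ha ma; first exact: fil_bot.
have FS := fil_submod A' N.+1.
apply: (cong_mem FS (curv_thser Th s ha _)); last exact: lin1_fil.
by move=> t; apply: fil_decr.
Qed.

Lemma mc_image_mc a al : fdeg (gr A) 0 a -> mc a -> mc_image a al -> mc al.
Proof.
move=> ha ma him N s; have FS := fil_submod A' N.
by apply: (cong_mem FS (curv_cong N s (him N))); apply: mc_thser.
Qed.

(** The starting point is the N-th approximation [thser] instead of the limit Theta(a), so no image
    has to be chosen and restriction acts truncation by truncation. *)
Definition path_eq a (x b : {set 'I_n.+1} -> A') :=
  forall N s, fil N (pathcurv (thser Th a N) x b N s).

(** Induction on the filtration: in [path_bianchi] the terms of the path and the curvature of the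
    starting point already lie in F_(m+1), hence so does the curvature of b. *)
Lemma path_endpoint_mc a x b : fdeg (gr A) 0 a -> mc a -> fdeg (gr A') (-1) x ->
  fdeg (gr A') 0 b -> path_eq a x b -> mc b.
Proof.
move=> ha ma hx hb hp N; have FS := fil_submod A'.
elim: N => [|m IH] s; first exact: fil_bot.
have hal := thser_deg Th m.+1 ha.
have h := path_bianchi hal hx hb s (fun t => fil_decr (mc_thser m.+1 t ha ma))
  (fun t => cong_mem (FS m) (curv_stable b m t) (IH t)) (fun t => fil_decr (hp m.+1 t)).
have h1 : fil m.+1 (dif A' (pathcurv (thser Th a m.+1) x b m.+1 s)
                    - bd (pathcurv (thser Th a m.+1) x b m.+1) s).
  apply: submodB; [exact: FS|exact: fil_dif|].
  by apply: submod_sum => // v _; apply: submodZ.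
have h2 := submodB (FS _) h h1; rewrite addrC addKr in h2.
rewrite -[curv b _ _](subrK (curv (thser Th a m.+1) m.+1 s)).
by apply: submodD => //; apply: mc_thser.
Qed.

(** The path equation solved for b. On the right b occurs only in words that also contain the letter
    x, hence contractively. *)
Definition endpoint_step a (x : {set 'I_n.+1} -> A') N (b : {set 'I_n.+1} -> A') s : A' :=
  thser Th a N s + pQ A' (pathser (thser Th a N) x b N s) + bd x s.

Lemma path_eqP a x b : path_eq a x b <-> forall N, fcong (@fil F A') N b (endpoint_step a x N b).
Proof.
have E N s : pathcurv (thser Th a N) x b N s = - (b s - endpoint_step a x N b s).
  by rewrite /pathcurv /endpoint_step !opprB addrA [_ + thser _ _ _ _]addrC addrA.
split=> h N s; have := submodN (fil_submod A' N) (h N s).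
  by rewrite E opprK.
by rewrite E.
Qed.

(** The clause at the empty set belongs to [fdeg]; built into the class, it passes to limits by
    separatedness. *)
Definition homA (s : {set 'I_n.+1}) (x : A') :=
  homog (gr A') (0 - (#|s|.-1)%:Z) x /\ (s = set0 -> x = 0).

Lemma homA_cls b : cls homA b <-> fdeg (gr A') 0 b.
Proof.
split=> [h|[h0 h] s]; last by split=> // ->.
by split=> [|s]; [apply: (h set0).2|apply: (h s).1].
Qed.

Lemma homA_lim s (u : nat -> A') :
  (forall N, homA s (u N)) -> (forall N, fil N (u N.+1 - u N)) ->
  exists2 x, homA s x & forall N, fil N (x - u N).
Proof.
move=> hu cu; have [x hx cx] := fil_lim (fun N => (hu N).1) cu.
exists x => //; split=> // s0; apply: fil_sep => N.
by have := cx N; rewrite (hu N).2 // subr0.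
Qed.

Lemma endpoint_step_contr a x N b b' : cls homA b -> cls homA b' ->
  fcong (@fil F A') N b b' ->
  fcong (@fil F A') N.+1 (endpoint_step a x N.+1 b) (endpoint_step a x N.+1 b').
Proof.
move=> _ _ bb s; have FS := fil_submod A' N.+1.
apply: (congD FS); last exact: cong_refl.
apply: (congD FS); first exact: cong_refl.
have TS := TF_submod A'.
rewrite /pathser /= -!addrA; apply: pQ_cong; apply: (congD (TS _)); first exact: TF_refl.
by apply: ser2_tail_cong => t //; apply: cong_refl; apply: fil_submod.
Qed.

Lemma endpoint_step_stable a x N b : cls homA b ->
  fcong (@fil F A') N (endpoint_step a x N.+1 b) (endpoint_step a x N b).
Proof.
move=> _ s; have FS := fil_submod A' N; have TS := TF_submod A' N.
apply: (congD FS); last exact: cong_refl.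
apply: (congD FS); first exact: thser_stable.
apply: pQ_cong; apply: (cong_trans TS (ser2_stable _ _ _ _ _)).
apply: ser2_cong => t; try exact: cong_refl.
by apply: tw_cong => // u; apply: thser_stable.
Qed.

Lemma endpoint_step_deg a x N b : fdeg (gr A) 0 a -> fdeg (gr A') (-1) x ->
  fdeg (gr A') 0 b -> fdeg (gr A') 0 (endpoint_step a x N b).
Proof.
move=> ha hx hb; have hal := thser_deg Th N ha; split=> [|s].
  rewrite /endpoint_step hal.1 /pathser ser2_set0 ?hx.1 //.
  by rewrite linear0 bd_set0 !addr0.
have HS i := homog_submod (gr A') i.
apply: submodD; [exact: HS| |].
  apply: submodD; [exact: HS|exact: hal.2|].
  have -> : 0 - (#|s|.-1)%:Z = (-1 - (#|s|.-1)%:Z) + 1 by lia.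
  by apply: pQ_homog; apply: ser2_deg => //; apply: fdeg_tw.
rewrite /bd; apply: submod_sum => [|v vs]; first exact: HS.
apply: submodZ; first exact: HS.
have [->|t0] := eqVneq (s :\ v) set0; first by rewrite hx.1; apply: (HS _).1.
have -> : 0 - (#|s|.-1)%:Z = -1 - (#|s :\ v|.-1)%:Z.
  by have := cardsD1 v s; rewrite vs -card_gt0 in t0 *; lia.
exact: hx.2.
Qed.

Lemma path_endpoint a x : fdeg (gr A) 0 a -> fdeg (gr A') (-1) x ->
  exists2 b, fdeg (gr A') 0 b & path_eq a x b.
Proof.
move=> ha hx.
have Hc N b : cls homA b -> cls homA (endpoint_step a x N b).
  by move=> /homA_cls hb; apply/homA_cls; apply: endpoint_step_deg.
have H0 : cls homA (fun=> 0) by move=> s; split=> //; apply: (homog_submod _ _).1.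
have [b hb eb] := fixed_point_exists (fil_submod A') (@fil_bot F A') homA_lim
  Hc (@endpoint_step_contr a x) (@endpoint_step_stable a x) H0.
by exists b; [apply/homA_cls|apply/path_eqP].
Qed.

Lemma path_endpoint_unique a x b b' : fdeg (gr A') 0 b -> fdeg (gr A') 0 b' ->
  path_eq a x b -> path_eq a x b' -> b = b'.
Proof.
move=> /homA_cls hb /homA_cls hb' /path_eqP h /path_eqP h'.
exact: (fixed_point_unique (fil_submod A') (@fil_bot F A') (@fil_sep F A')
  (@endpoint_step_contr a x) hb hb' h h').
Qed.

End MaurerCartanImage.

(** * The equations for (a, xi) with given b *)

Section ConeSolver.
Context (F : fieldType) (A A' : ainf F) (Th : amor A A') (n : nat).
Local Notation K := (cone A A').
Local Notation T := {set 'I_n.+1}.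
Implicit Types (s t : T) (k w : T -> K) (b : T -> A') (r : int).

Context (hc : int -> K -> K).
Hypothesis hc_linear : forall i c (x y : K),
  kdeg i x -> kdeg i y -> hc i (c *: x + y) = c *: hc i x + hc i y.
Hypothesis hc_deg : forall i (x : K), kdeg i x -> kdeg (i - 1) (hc i x).
Hypothesis hc_fil : forall i N (x : K), kdeg i x -> kfil N x -> kfil N (hc i x).
Hypothesis hc_htpy : forall i (x : K), kdeg i x ->
  cone_d Th (hc i x) + hc (i + 1) (cone_d Th x) = x.

Definition kfd r k := k set0 = 0 /\ forall s, kdeg (r - (#|s|.-1)%:Z) (k s).

Definition hf r k s : K := hc (r - (#|s|.-1)%:Z) (k s).

Lemma hc0 i : hc i 0 = 0.
Proof.
have h0 := (kdeg_submod A A' i).1.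
by have := hc_linear (-1) h0 h0; rewrite scaler0 addr0 scaleN1r addNr.
Qed.

Lemma hcD i (x y : K) : kdeg i x -> kdeg i y -> hc i (x + y) = hc i x + hc i y.
Proof. by move=> hx hy; have := hc_linear 1 hx hy; rewrite !scale1r. Qed.

Lemma hcZ i c (x : K) : kdeg i x -> hc i (c *: x) = c *: hc i x.
Proof.
by move=> hx; have := hc_linear c hx (kdeg_submod A A' i).1; rewrite hc0 !addr0.
Qed.

Lemma hcB i (x y : K) : kdeg i x -> kdeg i y -> hc i (x - y) = hc i x - hc i y.
Proof.
move=> hx hy; rewrite hcD //; first by rewrite -[- y]scaleN1r hcZ // scaleN1r.
exact: (submodN (kdeg_submod A A' i)).
Qed.

Lemma face_dim (s : T) v : v \in s -> s :\ v != set0 -> #|s|.-1 = (#|s :\ v|.-1).+1.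
Proof. by move=> vs; rewrite -card_gt0 => t0; have := cardsD1 v s; rewrite vs; lia. Qed.

Lemma face_deg r (s : T) v : v \in s -> s :\ v != set0 ->
  r - (#|s :\ v|.-1)%:Z = r + 1 - (#|s|.-1)%:Z.
Proof. by move=> vs t0; rewrite (face_dim vs t0) intS opprD addrA addrK. Qed.

Lemma kfd_hf r k : kfd r k -> kfd (r - 1) (hf r k).
Proof.
move=> [k0 hk]; split=> [|s]; first by rewrite /hf k0 hc0.
by rewrite addrAC; apply: hc_deg.
Qed.

Lemma kfd_bd r k : kfd r k -> kfd (r + 1) (bd k).
Proof.
move=> [k0 hk]; split=> [|s]; first exact: bd_set0.
apply: submod_sum => [|v vs]; first exact: kdeg_submod.
apply: submodZ; first exact: kdeg_submod.
have [->|t0] := eqVneq (s :\ v) set0; first by rewrite k0; apply: (kdeg_submod _ _ _).1.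
by rewrite -(face_deg r vs t0).
Qed.

Lemma kfd_d r k : kfd r k -> kfd (r + 1) (fun s => cone_d Th (k s)).
Proof.
move=> [k0 hk]; split=> [|s]; first by rewrite k0 linear0.
by rewrite addrAC; apply: kdeg_d.
Qed.

Lemma kfdD r k k' : kfd r k -> kfd r k' -> kfd r (fun s => k s + k' s).
Proof.
move=> [k0 hk] [k0' hk']; split=> [|s]; first by rewrite k0 k0' addr0.
by apply: submodD => //; apply: kdeg_submod.
Qed.

Lemma kfdB r k k' : kfd r k -> kfd r k' -> kfd r (fun s => k s - k' s).
Proof.
move=> [k0 hk] [k0' hk']; split=> [|s]; first by rewrite k0 k0' subr0.
by apply: submodB => //; apply: kdeg_submod.
Qed.

(** In total degree r a face of s carries the same coefficient degree as s does in total degree r +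
    1, so the same component of h is applied on both sides. *)
Lemma hf_bd r k s : kfd r k -> hf (r + 1) (bd k) s = bd (hf r k) s.
Proof.
move=> [k0 hk]; set i := r + 1 - (#|s|.-1)%:Z.
have hdeg v : v \in s -> kdeg i (k (s :\ v)).
  move=> vs; have [->|t0] := eqVneq (s :\ v) set0.
    by rewrite k0; apply: (kdeg_submod _ _ _).1.
  by rewrite /i -(face_deg r vs t0).
transitivity (\sum_(v in s) (-1) ^+ rk s v *: hc i (k (s :\ v))).
  rewrite /hf -/i /bd; suff [] : kdeg i (\sum_(v in s) (-1) ^+ rk s v *: k (s :\ v)) /\
      hc i (\sum_(v in s) (-1) ^+ rk s v *: k (s :\ v))
      = \sum_(v in s) (-1) ^+ rk s v *: hc i (k (s :\ v)) by [].
  (* [hc i] is linear on elements of degree i only, so the degree is carried along the sum. *)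
  apply: (big_ind2 (fun x y => kdeg i x /\ hc i x = y)).
  - by split; [apply: (kdeg_submod _ _ _).1|apply: hc0].
  - move=> x x' y y' [hx <-] [hy <-]; split; last exact: hcD.
    by apply: submodD => //; apply: kdeg_submod.
  move=> v vs; split; first by apply: submodZ; [apply: kdeg_submod|apply: hdeg].
  by apply: hcZ; apply: hdeg.
apply: eq_bigr => v vs; congr (_ *: _); rewrite /hf.
have [->|t0] := eqVneq (s :\ v) set0; first by rewrite k0 !hc0.
by rewrite /i (face_deg r vs t0).
Qed.

(** The total differential is [cone_d] minus [bd] in even degree and [cone_d] plus [bd] in odd
    degree. Since h commutes with [bd] without sign, the [bd] terms cancel and the contraction
    identity of the cone remains. *)
Lemma hf_htpy0 k s : kfd 0 k ->
  cone_d Th (hf 0 k s) + bd (hf 0 k) s + hf 1 (fun t => cone_d Th (k t) - bd k t) s = k s.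
Proof.
move=> hk; have h1 := kfd_d hk; have h2 := kfd_bd hk; rewrite add0r in h1 h2.
have -> : hf 1 (fun t => cone_d Th (k t) - bd k t) s
    = hc (1 - (#|s|.-1)%:Z) (cone_d Th (k s)) - bd (hf 0 k) s.
  by rewrite -hf_bd // add0r /hf hcB; [|apply: h1.2|apply: h2.2].
rewrite addrA addrAC addrK -[RHS](hc_htpy (hk.2 s)); congr (_ + hc _ _).
by rewrite sub0r addrC.
Qed.

Lemma hf_htpy1 k s : kfd 1 k ->
  cone_d Th (hf 1 k s) - bd (hf 1 k) s + hf 2 (fun t => cone_d Th (k t) + bd k t) s = k s.
Proof.
move=> hk; have h1 := kfd_d hk; have h2 := kfd_bd hk.
have -> : hf 2 (fun t => cone_d Th (k t) + bd k t) s
    = hc (2 - (#|s|.-1)%:Z) (cone_d Th (k s)) + bd (hf 1 k) s.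
  by rewrite -hf_bd // /hf hcD; [|apply: h1.2|apply: h2.2].
rewrite [hc _ _ + _]addrC addrA subrK -[RHS](hc_htpy (hk.2 s)); congr (_ + hc _ _).
by rewrite addrAC.
Qed.

Lemma hf_fil r N k s : kfd r k -> kfil N (k s) -> kfil N (hf r k s).
Proof. by move=> hk; apply: hc_fil; apply: hk.2. Qed.

Lemma hf_sub r k k' s : kfd r k -> kfd r k' ->
  hf r k s - hf r k' s = hf r (fun t => k t - k' t) s.
Proof. by move=> hk hk'; rewrite /hf hcB; [|apply: hk.2|apply: hk'.2]. Qed.

Definition kfst k s : A := (k s).1.
Definition ksnd k s : A' := (k s).2.

Lemma kfd_pair k : kfd 0 k <-> fdeg (gr A) 0 (kfst k) /\ fdeg (gr A') (-1) (ksnd k).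
Proof.
have E (s : T) : 0 - (#|s|.-1)%:Z - 1 = -1 - (#|s|.-1)%:Z by lia.
split=> [[k0 hk]|[[a0 ha] [x0 hx]]].
  by split; split; rewrite /kfst /ksnd ?k0 // => s; have [h1 h2] := hk s; rewrite -?E.
split=> [|s]; last by split; rewrite ?E; [apply: ha|apply: hx].
by move: a0 x0; rewrite /kfst /ksnd; case: (k set0) => x y /= -> ->.
Qed.

(* The curvature of (a, xi, b), with values in the cone, is D k + NL k. *)
Definition NL b N k s : K :=
  (pQ A (ser (kfst k) N s) - dif A (kfst k s),
   - (pQ A' (pathser (thser Th (kfst k) N) (ksnd k) b N s) - dif A' (ksnd k s)
      + (thser Th (kfst k) N s - lin1 Th (kfst k s)) - b s)).

Definition coned k s : K := cone_d Th (k s) - bd k s.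

Definition curvK b N k s : K := coned k s + NL b N k s.

Lemma bd_kfst k s : (bd k s).1 = bd (kfst k) s.
Proof.
rewrite /bd; elim/big_rec2: _ => // v x y _ <-; by [].
Qed.

Lemma bd_ksnd k s : (bd k s).2 = bd (ksnd k) s.
Proof.
rewrite /bd; elim/big_rec2: _ => // v x y _ <-; by [].
Qed.

Lemma curvKE b N k s : curvK b N k s =
  (curv (kfst k) N s, - pathcurv (thser Th (kfst k) N) (ksnd k) b N s).
Proof.
have AC1 (V : zmodType) (x y z : V) : x - y + (z - x) = z - y.
  by rewrite addrC addrA subrK.
have AC2 (V : zmodType) (p d0 l e q u : V) :
  - (d0 + l) - e + (- (p - d0 + (q - l) - u)) = - (p + e - (u - q)).
  rewrite -!opprD; congr (- _).
  rewrite [LHS](AC ((2*1)*(2*2*1)) ((1*5)*(2*7)*(4*3*6*8))) /= !subrr !add0r.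
  by rewrite opprB [p + e]addrC addrA addrAC.
congr (_, _); first by rewrite /= bd_kfst; apply: AC1.
by rewrite /= bd_ksnd; apply: AC2.
Qed.

Lemma NL_deg b N k : kfd 0 k -> fdeg (gr A') 0 b -> kfd 1 (NL b N k).
Proof.
move=> /kfd_pair[ha hx] hb; have hal := thser_deg Th N ha.
have [HS HS'] := (homog_submod (gr A), homog_submod (gr A')).
split=> [|s].
  congr (_, _); first by rewrite ser_set0 ?ha.1 // !linear0 addr0.
  rewrite /pathser ser2_set0 ?hx.1 // hal.1 ha.1 hb.1.
  by rewrite !linear0 !addr0 linear0.
have E1 : 1 - (#|s|.-1)%:Z = 0 - (#|s|.-1)%:Z + 1 by lia.
have E2 : 1 - (#|s|.-1)%:Z - 1 = 0 - (#|s|.-1)%:Z by lia.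
have E3 : 0 - (#|s|.-1)%:Z = -1 - (#|s|.-1)%:Z + 1 by lia.
split; [rewrite /= E1|rewrite /= E2].
  apply: submodB => //; first by apply: pQ_homog; apply: ser_deg.
  by apply: dif_deg; apply: ha.2.
apply: submodN => //; apply: submodB => //; last exact: hb.2.
apply: submodD => //; last first.
  by apply: submodB => //; [apply: hal.2|apply: lin1_deg; apply: ha.2].
rewrite E3; apply: submodB => //.
  by apply: pQ_homog; apply: ser2_deg => //; apply: fdeg_tw.
by apply: dif_deg; apply: hx.2.
Qed.

Local Notation kcong N := (fcong (@kfil F A A') N).

(** Once the linear terms are removed, only words of at least two letters and the fixed b remain; an
    error in one letter gains one step. *)
Lemma NL_contr b N k k' : kcong N k k' -> kcong N.+1 (NL b N.+1 k) (NL b N.+1 k').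
Proof.
move=> kk s; have FS := fil_submod A N.+1; have FS' := fil_submod A' N.+1.
have aa t : cong (@fil F A N) (kfst k t) (kfst k' t) by have [] := kk t.
have xx t : cong (@fil F A' N) (ksnd k t) (ksnd k' t) by have [] := kk t.
have pser (B : ainf F) (G H : Tbar B) (x : B) : G = word [:: x] + H -> pQ B G - dif B x = pQ B H.
  by move=> ->; rewrite linearD pQ_single addrC addKr.
have pth (H : Tbar A) (x : A) : pTh Th (word [:: x] + H) - lin1 Th x = pTh Th H.
  by rewrite linearD [pTh Th (word _)]/(lin1 Th x) addrC addKr.
have taa t : cong (@fil F A' N) (thser Th (kfst k) N.+1 t) (thser Th (kfst k') N.+1 t).
  by apply: pTh_cong; apply: ser_cong.
suff [h1 h2] : cong (@fil F A N.+1) (NL b N.+1 k s).1 (NL b N.+1 k' s).1 /\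
    cong (@fil F A' N.+1) (NL b N.+1 k s).2 (NL b N.+1 k' s).2 by split.
split; rewrite /=.
  by rewrite !(pser _ _ _ _ (erefl _)); apply: pQ_cong; apply: star_ser_cong.
apply: (congN FS'); apply: (congB FS'); last exact: cong_refl.
apply: (congD FS'); last by rewrite !pth; apply: pTh_cong; apply: star_ser_cong.
rewrite /pathser /= -!addrA !(pser _ _ _ _ (erefl _)); apply: pQ_cong.
apply: ser2_tail_cong => t //; last by apply: cong_refl; apply: fil_submod.
by apply: tw_cong => //; apply: fil_submod.
Qed.

Lemma NL_stable b N k : kcong N (NL b N.+1 k) (NL b N k).
Proof.
move=> s; have FS := fil_submod A N; have FS' := fil_submod A' N.
suff [h1 h2] : cong (@fil F A N) (NL b N.+1 k s).1 (NL b N k s).1 /\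
    cong (@fil F A' N) (NL b N.+1 k s).2 (NL b N k s).2 by split.
split; first by apply: (congB FS); [exact/pQ_cong/ser_stable|apply: cong_refl].
apply: (congN FS'); apply: (congB FS'); last exact: cong_refl.
apply: (congD FS'); last by apply: (congB FS'); [exact: thser_stable|apply: cong_refl].
apply: (congB FS'); last exact: cong_refl.
apply: pQ_cong; apply: (cong_trans (TF_submod _ _) (ser2_stable _ _ _ _ _)).
apply: ser2_cong => t; try exact: cong_refl.
by apply: tw_cong => // u; apply: thser_stable.
Qed.

Definition sol_step w b N k s : K := w s - hf 1 (NL b N k) s.

Definition homK s (x : K) := kdeg (0 - (#|s|.-1)%:Z) x /\ (s = set0 -> x = 0).

Lemma homK_cls k : cls homK k <-> kfd 0 k.
Proof.
split=> [h|[h0 h] s]; last by split=> // ->.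
by split=> [|s]; [apply: (h set0).2|apply: (h s).1].
Qed.

Lemma homK_lim s (u : nat -> K) :
  (forall N, homK s (u N)) -> (forall N, kfil N (u N.+1 - u N)) ->
  exists2 x, homK s x & forall N, kfil N (x - u N).
Proof.
move=> hu cu; have [x hx cx] := kfil_lim (fun N => (hu N).1) cu.
exists x => //; split=> // s0; apply: kfil_sep => N.
by have := cx N; rewrite (hu N).2 // subr0.
Qed.

Lemma sol_step_deg w b N k : kfd 0 w -> fdeg (gr A') 0 b -> kfd 0 k -> kfd 0 (sol_step w b N k).
Proof.
move=> hw hb hk; apply: kfdB => //.
by rewrite -[0](subrr 1); apply: kfd_hf; apply: NL_deg.
Qed.

Lemma sol_step_contr w b N k k' : fdeg (gr A') 0 b -> cls homK k -> cls homK k' ->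
  kcong N k k' -> kcong N.+1 (sol_step w b N.+1 k) (sol_step w b N.+1 k').
Proof.
move=> hb /homK_cls hk /homK_cls hk' kk s; have KS := @kfil_submod F A A' N.+1.
apply: (congB KS); first exact: cong_refl.
have [h h'] := (NL_deg N.+1 hk hb, NL_deg N.+1 hk' hb).
by rewrite /cong hf_sub //; apply: hf_fil; [apply: kfdB|apply: NL_contr].
Qed.

Lemma sol_step_stable w b N k : fdeg (gr A') 0 b -> cls homK k ->
  kcong N (sol_step w b N.+1 k) (sol_step w b N k).
Proof.
move=> hb /homK_cls hk s; have KS := @kfil_submod F A A' N.
apply: (congB KS); first exact: cong_refl.
have [h h'] := (NL_deg N.+1 hk hb, NL_deg N hk hb).
by rewrite /cong hf_sub //; apply: hf_fil; [apply: kfdB|apply: NL_stable].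
Qed.

(* For closed w, the solutions k = (a, xi) are the pairs of a Maurer-Cartan element a and
   a path xi from its image to b whose closed part coned1 (hf 0 k) is w. *)
Definition is_sol w b k := kfd 0 k /\ forall N, kcong N k (sol_step w b N k).

Lemma sol_exists w b : kfd 0 w -> fdeg (gr A') 0 b -> exists k, is_sol w b k.
Proof.
move=> hw hb.
have Hc N k : cls homK k -> cls homK (sol_step w b N k).
  by move=> /homK_cls hk; apply/homK_cls; apply: sol_step_deg.
have H0 : cls homK (fun=> 0) by move=> s; split=> //; apply: (kdeg_submod _ _ _).1.
have [k /homK_cls hk ek] := fixed_point_exists (@kfil_submod F A A') (@kfil_bot F A A')
  homK_lim Hc (fun N k k' => @sol_step_contr w b N k k' hb)
  (fun N k => @sol_step_stable w b N k hb) H0.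
by exists k.
Qed.

Lemma sol_unique w b k k' : fdeg (gr A') 0 b -> is_sol w b k -> is_sol w b k' -> k = k'.
Proof.
move=> hb [/homK_cls hk h] [/homK_cls hk' h'].
exact: (fixed_point_unique (@kfil_submod F A A') (@kfil_bot F A A') (@kfil_sep F A A')
  (fun N k k' => @sol_step_contr w b N k k' hb) hk hk' h h').
Qed.

Lemma curvK_deg b N k : kfd 0 k -> fdeg (gr A') 0 b -> kfd 1 (curvK b N k).
Proof.
move=> hk hb; apply: kfdD; last exact: NL_deg.
by rewrite -[1](add0r 1); apply: kfdB; [apply: kfd_d|apply: kfd_bd].
Qed.

(** In the second component [path_bianchi] produces two end curvatures. That of b is negligible, as
    b is Maurer-Cartan; that of the image of a is, by [curv_thser], the linear term of Theta on the
    curvature of a, as the differential of the cone requires. *)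
Lemma curvK_bianchi b m k s : kfd 0 k -> fdeg (gr A') 0 b -> mc b ->
  (forall s, kfil m (curvK b m.+1 k s)) ->
  kfil m.+1 (cone_d Th (curvK b m.+1 k s) + bd (curvK b m.+1 k) s).
Proof.
move=> /kfd_pair[ha hx] hb mb hC.
set a := kfst k in ha *; set x := ksnd k in hx *; set al := thser Th a m.+1.
have hal : fdeg (gr A') 0 al := thser_deg Th m.+1 ha.
have hR t : fil m (curv a m.+1 t) by have := hC t; rewrite curvKE => -[].
have hS t : fil m (pathcurv al x b m.+1 t).
  by have := hC t; rewrite curvKE => -[_] /(submodN (fil_submod A' m)) /=; rewrite opprK.
have hal1 t : fil m.+1 (curv al m.+1 t - lin1 Th (curv a m.+1 t)) by apply: curv_thser.
have hal0 t : fil m (curv al m.+1 t).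
  rewrite -(subrK (lin1 Th (curv a m.+1 t)) (curv al m.+1 t)).
  by apply: submodD; [apply: fil_submod|apply: fil_decr|apply: lin1_fil].
have FS := fil_submod A' m.+1.
have -> : curvK b m.+1 k = fun t => (curv a m.+1 t, - pathcurv al x b m.+1 t).
  by apply: funext => t; apply: curvKE.
split=> /=; first by rewrite bd_kfst; apply: bianchi.
rewrite bd_ksnd /ksnd /= bdN.
have := submodB FS (submodB FS (path_bianchi hal hx hb s hal0 (fun t => fil_decr (mb m.+1 t)) hS)
  (mb m.+1 s)) (submodN FS (hal1 s)).
congr (fil m.+1 _); rewrite [dif A' (- _)]linearN.
have AC (V : zmodType) (p q u v l : V) :
  p - q + (u - v) - u - (- (v - l)) = - (- p + l) - q.
  by rewrite opprK opprD opprK [LHS](AC (2*2*1*2) ((1*7*2)*(3*5)*(4*6))) /= subrr addNr !addr0.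
exact: AC.
Qed.

Lemma coned_cong N k k' s : kcong N k k' -> cong (@kfil F A A' N) (coned k s) (coned k' s).
Proof.
move=> kk; have KS := @kfil_submod F A A' N; apply: (congB KS); last exact: bd_cong.
by rewrite /cong -linearB; apply: kfil_d; apply: kk.
Qed.

Lemma conedB k k' s : coned (fun t => k t - k' t) s = coned k s - coned k' s.
Proof. by rewrite /coned linearB bdB !opprD addrACA. Qed.

Lemma cone_dd1 k s : k set0 = 0 -> cone_d Th (coned k s) + bd (coned k) s = 0.
Proof.
by move=> k0; rewrite /coned linearB /= cone_dd bdB bd_bd // bd_lin subr0 sub0r addNr.
Qed.

Lemma sol_curvK w b k : kfd 0 w -> (forall s, coned w s = 0) -> fdeg (gr A') 0 b -> mc b ->
  is_sol w b k -> forall N s, kfil N (curvK b N k s).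
Proof.
move=> hw dw hb mb [hk ek]; elim=> [|m IH] s; first exact: kfil_bot.
have KS := @kfil_submod F A A'.
have hC t : kfil m (curvK b m.+1 k t).
  apply: (cong_mem (KS m) _ (IH t)); apply: (congD (KS m)); first exact: cong_refl.
  exact: NL_stable.
have hN := NL_deg m.+1 hk hb; have hCd := curvK_deg m.+1 hk hb.
(* The homotopy formula writes [NL] as D h NL + h D NL. As D^2 = 0, D NL is D of the curvature, and
   as w is closed, D h NL is minus D of the fixed-point map. *)
have -> : curvK b m.+1 k s = (coned k s - coned (sol_step w b m.+1 k) s)
    + hf 2 (fun t => cone_d Th (curvK b m.+1 k t) + bd (curvK b m.+1 k) t) s.
  have -> : (fun t => cone_d Th (curvK b m.+1 k t) + bd (curvK b m.+1 k) t)
      = (fun t => cone_d Th (NL b m.+1 k t) + bd (NL b m.+1 k) t).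
    apply: funext => t; rewrite {1}/curvK linearD /= (bdD (coned k)) addrACA.
    by rewrite cone_dd1 ?add0r //; apply: hk.1.
  have -> : coned (sol_step w b m.+1 k) s = - coned (hf 1 (NL b m.+1 k)) s.
    by rewrite [LHS]conedB dw sub0r.
  by rewrite opprK -addrA (hf_htpy1 _ hN).
apply: submodD; [exact: KS|exact: coned_cong|].
apply: hf_fil (curvK_bianchi _ hk hb mb hC).
by apply: kfdD; [apply: (kfd_d hCd)|apply: (kfd_bd hCd)].
Qed.

Lemma curvK_mc b k : (forall N s, kfil N (curvK b N k s)) <->
  mc (kfst k) /\ path_eq Th (kfst k) (ksnd k) b.
Proof.
split=> [h|[h1 h2] N s].
  split=> N s; have := h N s; rewrite curvKE => -[] //= _ h2.
  by rewrite -[pathcurv _ _ _ _ _]opprK; apply: submodN => //; apply: fil_submod.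
by rewrite curvKE; split=> //=; apply: submodN => //; apply: fil_submod.
Qed.

Definition coned1 k s : K := cone_d Th (k s) + bd k s.

Lemma coned1_deg k : kfd (-1) k -> kfd 0 (coned1 k).
Proof. by move=> hk; rewrite -[0](addNr 1); apply: kfdD; [apply: kfd_d|apply: kfd_bd]. Qed.

Lemma coned_coned1 k s : k set0 = 0 -> coned (coned1 k) s = 0.
Proof.
move=> k0; rewrite /coned /coned1 linearD /= cone_dd add0r bdD bd_bd // addr0.
by rewrite bd_lin subrr.
Qed.

(** By [hf_htpy0], k is its closed part plus h D k, and D k is the curvature minus [NL]; modulo F_N
    the curvature term vanishes. *)
Lemma is_sol_of_curvK b k : kfd 0 k -> fdeg (gr A') 0 b ->
  (forall N s, kfil N (curvK b N k s)) -> is_sol (coned1 (hf 0 k)) b k.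
Proof.
move=> hk hb hC; split=> // N s; have KS := @kfil_submod F A A' N.
rewrite /cong /sol_step -{1}(hf_htpy0 s hk) -/(coned1 _ _) opprB.
have -> : (fun t => cone_d Th (k t) - bd k t) = (fun t => curvK b N k t - NL b N k t).
  by apply: funext => t; rewrite /curvK addrK.
rewrite -hf_sub; [|exact: curvK_deg|exact: NL_deg].
have AC (V : zmodType) (x y z : V) : x + (y - z) + (z - x) = y.
  by rewrite [x + (y - z)]addrC -addrA [x + (z - x)]addrC !subrK.
rewrite (AC K).
by apply: hf_fil; first exact: curvK_deg.
Qed.

End ConeSolver.

(** * Compatibility with simplicial operators *)

Section RestrictionAdditive.
Context (F : fieldType) (m n : nat) (th : omap m n) (U : lmodType F).
Implicit Types (f g : {set 'I_n.+1} -> U).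

Lemma restrD f g s : restr th (fun t => f t + g t) s = restr th f s + restr th g s.
Proof. by rewrite /restr; case: ifP => _; rewrite ?addr0. Qed.

Lemma restrN f s : restr th (fun t => - f t) s = - restr th f s.
Proof. by rewrite /restr; case: ifP => _; rewrite ?oppr0. Qed.

Lemma restrB f g s : restr th (fun t => f t - g t) s = restr th f s - restr th g s.
Proof. by rewrite restrD restrN. Qed.

Lemma restr_in (P : U -> Prop) f s : P 0 -> (forall t, P (f t)) -> P (restr th f s).
Proof. by rewrite /restr; case: ifP. Qed.

Lemma restr_cong (P : U -> Prop) f g s : submod P ->
  (forall t, cong P (f t) (g t)) -> cong P (restr th f s) (restr th g s).
Proof. by move=> hP fg; rewrite /cong -restrB; apply: restr_in => //; case: hP. Qed.

End RestrictionAdditive.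

Section RestrictionSeries.
Context (F : fieldType) (m n : nat) (th : omap m n).

Lemma restr_star (A : complex F) (a : {set 'I_n.+1} -> A) G : a set0 = 0 -> G set0 = 0 ->
  restr th (star a G) = star (restr th a) (restr th G).
Proof. by move=> a0 G0; apply: funext => s; apply: restr_conv => //; apply: Tcons_bilin. Qed.

Lemma restr_ser (A : complex F) (a : {set 'I_n.+1} -> A) N : a set0 = 0 ->
  restr th (ser a N) = ser (restr th a) N.
Proof.
move=> a0; elim: N => [|N IH]; apply: funext => s; first by rewrite /restr if_same.
rewrite /= restrD restr_star ?ser_set0 // IH; congr (_ + _).
by apply: (restr_app th (L := @Tsingle F A)); apply: linear0.
Qed.

Lemma restr_ser2 (A : complex F) (a x b : {set 'I_n.+1} -> A) N :
  a set0 = 0 -> x set0 = 0 -> b set0 = 0 ->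
  restr th (ser2 a x b N) = ser2 (restr th a) (restr th x) (restr th b) N.
Proof.
move=> a0 x0 b0; elim: N => [|N IH]; apply: funext => s; first by rewrite /restr if_same.
rewrite /= !restrD !restr_star ?ser_set0 ?ser2_set0 // IH restr_ser //; congr (_ + _ + _).
by apply: (restr_app th (L := @Tsingle F A)); apply: linear0.
Qed.

Context (A A' : ainf F) (Th : amor A A').

Lemma restr_thser (a : {set 'I_n.+1} -> A) N : a set0 = 0 ->
  thser Th (restr th a) N = restr th (thser Th a N).
Proof.
move=> a0; apply: funext => s; rewrite /thser -restr_ser //.
by rewrite (restr_app th (L := pTh Th)) ?linear0.
Qed.

Lemma mc_image_restr (a : {set 'I_n.+1} -> A) al : a set0 = 0 ->
  mc_image Th a al -> mc_image Th (restr th a) (restr th al).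
Proof.
by move=> a0 h N s; rewrite restr_thser //; apply: restr_cong => //; apply: fil_submod.
Qed.

Lemma restr_pathser (al x b : {set 'I_n.+1} -> A') N :
  al set0 = 0 -> x set0 = 0 -> b set0 = 0 ->
  pathser (restr th al) (restr th x) (restr th b) N = restr th (pathser al x b N).
Proof.
move=> a0 x0 b0; rewrite /pathser restr_ser2 ?tw_set0 //; congr (ser2 _ _ _ _).
by apply: funext => s; rewrite restr_tw.
Qed.

Lemma path_eq_restr (a : {set 'I_n.+1} -> A) (x b : {set 'I_n.+1} -> A') :
  a set0 = 0 -> x set0 = 0 -> b set0 = 0 ->
  path_eq Th a x b -> path_eq Th (restr th a) (restr th x) (restr th b).
Proof.
move=> a0 x0 b0 h N s.
suff -> : pathcurv (thser Th (restr th a) N) (restr th x) (restr th b) N s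
    = restr th (pathcurv (thser Th a N) x b N) s by apply: restr_in => //; apply: fil0.
have al0 := thser_set0 Th N a0.
transitivity (restr th (fun t => pQ A' (pathser (thser Th a N) x b N t)) s + restr th (bd x) s
  - (restr th b s - restr th (thser Th a N) s)); last by rewrite -restrB -restrD -restrB.
rewrite /pathcurv restr_thser // restr_pathser //.
by rewrite (restr_bd th) // (restr_app th (L := pQ A')) ?linear0.
Qed.

Context (hc : int -> cone A A' -> cone A A').
Hypothesis hc00 : forall i, hc i 0 = 0.

Lemma kfd_restr r (k : {set 'I_n.+1} -> cone A A') : kfd r k -> kfd r (restr th k).
Proof.
move=> [k0 hk]; split=> [|s]; first exact: restr_set0.
by rewrite /restr; case: eqP => [<-|_]; [apply: hk|apply: (kdeg_submod _ _ _).1].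
Qed.

(** Where the restriction does not vanish, the dimension is unchanged, so the same component of h is
    applied; elsewhere h 0 = 0 suffices. *)
Lemma restr_hf r (k : {set 'I_n.+1} -> cone A A') :
  hf hc r (restr th k) = restr th (hf hc r k).
Proof. by apply: funext => s; rewrite /hf /restr; case: eqP => [->|_]. Qed.

Lemma restr_NL b N (k : {set 'I_n.+1} -> cone A A') : k set0 = 0 -> b set0 = 0 ->
  NL Th (restr th b) N (restr th k) = restr th (NL Th b N k).
Proof.
move=> k0 b0.
have a0 : kfst k set0 = 0 by rewrite /kfst k0.
have x0 : ksnd k set0 = 0 by rewrite /ksnd k0.
have Ea : kfst (restr th k) = restr th (kfst k).
  by apply: funext => s; rewrite /kfst /restr; case: ifP.
have Ex : ksnd (restr th k) = restr th (ksnd k).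
  by apply: funext => s; rewrite /ksnd /restr; case: ifP.
have al0 := thser_set0 Th N a0.
apply: funext => s; rewrite /NL Ea Ex restr_thser // restr_pathser // -restr_ser //.
rewrite /restr; case: ifP => _ //.
congr (_, _); first by rewrite !linear0 addr0.
by rewrite !linear0 !addr0 linear0.
Qed.

Lemma is_sol_restr w b (k : {set 'I_n.+1} -> cone A A') : b set0 = 0 ->
  is_sol Th hc w b k -> is_sol Th hc (restr th w) (restr th b) (restr th k).
Proof.
move=> b0 [hk ek]; split=> [|N s]; first exact: kfd_restr.
rewrite /sol_step restr_NL // ?restr_hf -?restrB; last by case: hk.
by apply: restr_cong => [|t]; [apply: kfil_submod|apply: ek].
Qed.

Lemma restr_coned1 (k : {set 'I_n.+1} -> cone A A') : k set0 = 0 ->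
  coned1 Th (restr th k) = restr th (coned1 Th k).
Proof.
move=> k0; apply: funext => s; rewrite /coned1 restrD (restr_bd th) //.
by rewrite (restr_app th (L := cone_d Th)) ?linear0.
Qed.

End RestrictionSeries.

(** * Truncation along Delta^1 *)

Section Homotopy.
Context (F : fieldType) (n : nat) (U : lmodType F).
Implicit Types (eta : omap n 1) (f : {set 'I_n.+1} -> U).

Definition onend eta (s : {set 'I_n.+1}) : bool := [forall v in s, eta v == ord_max].

(* Any natural truncation of f would do that is 0 over the vertex 0 of Delta^1 and f
   over the vertex 1. *)
Definition trunc eta f s : U := if onend eta s then f s else 0.

Lemma trunc0 f s : f set0 = 0 -> trunc (omap_const n (ord0 : 'I_2)) f s = 0.
Proof.
move=> f0; rewrite /trunc; case: ifP => // /forall_inP h.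
(* The empty set satisfies [onend] vacuously. *)
have [->//|/set0Pn[v vs]] := eqVneq s set0.
by have := h v vs; rewrite /omap_fun ffunE.
Qed.

Lemma trunc1 f : trunc (omap_const n (ord_max : 'I_2)) f = f.
Proof.
apply: funext => s; rewrite /trunc ifT //; apply/forall_inP => v _.
by rewrite /omap_fun ffunE.
Qed.

Lemma trunc_set0 eta f : f set0 = 0 -> trunc eta f set0 = 0.
Proof. by rewrite /trunc => ->; rewrite if_same. Qed.

Lemma trunc_in (P : U -> Prop) eta f s : P 0 -> P (f s) -> P (trunc eta f s).
Proof. by rewrite /trunc; case: ifP. Qed.

End Homotopy.

Lemma restr_trunc (F : fieldType) (U : lmodType F) m n (th : omap m n) (eta : omap n 1)
    (f : {set 'I_n.+1} -> U) :
  restr th (trunc eta f) = trunc (omap_comp eta th) (restr th f).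
Proof.
apply: funext => s; rewrite /restr /trunc.
have -> : onend (omap_comp eta th) s = onend eta (th @: s).
  apply/forall_inP/forall_inP => h v; last by move=> vs; rewrite omap_compE h // imset_f.
  by case/imsetP => u us ->; rewrite -omap_compE h.
by case: ifP; case: ifP.
Qed.

(** * Tensor products with cochains *)

(* The sign of the identification of M (x) N^*(Delta^n) with functions on simplices;
   it absorbs all Koszul signs of the tensor product. *)
Definition eps (F : fieldType) (p : nat) : F := (-1) ^+ 'C(p.+1, 2).

Lemma epsS (F : fieldType) p : eps F p.+1 = eps F p * (-1) ^+ p.+1.
Proof. by rewrite /eps binS bin1 -exprD. Qed.

(** The exponents are triangular numbers, whose cross term pq is the Koszul sign between a p-cochain
    and a coefficient of degree -q. *)
Lemma epsD (F : fieldType) p q : eps F (p + q) = eps F p * eps F q * (-1) ^+ (p * q).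
Proof.
elim: q => [|q IH]; first by rewrite addn0 muln0 /eps /= !mulr1.
by rewrite addnS !epsS IH mulnS -addnS !exprD; ring.
Qed.

Lemma eps_sq (F : fieldType) p : eps F p * eps F p = 1.
Proof. by rewrite /eps -expr2 sqrr_sign. Qed.

Section Coefficients.
Context (F : fieldType) (n : nat).
Local Notation B := (cochain_dga F n).
Local Notation T := {set 'I_n.+1}.
Implicit Types (s : T).

Definition tcoef_at (M : lmodType F) s (x : M) (b : B) : M :=
  (eps F #|s|.-1 * ceval b s) *: x.

Fact tcoef_bilin (M : lmodType F) s : bilin (@tcoef_at M s).
Proof.
split=> [b|x] c y z; rewrite /tcoef_at.
  by rewrite scalerDr !scalerA mulrC.
by rewrite cevalD cevalZ mulrDr scalerDl scalerA mulrCA.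
Qed.

Definition tcoef (M : lmodType F) s : {linear tens M B -> M} := tens_lift (tcoef_bilin M s).

Lemma tcoefE (M : lmodType F) s (x : M) (b : B) :
  tcoef M s (pure x b) = (eps F #|s|.-1 * ceval b s) *: x.
Proof. exact: tens_liftE. Qed.

Lemma tcoef0 (M : lmodType F) s : tcoef M s 0 = 0.
Proof. exact: linear0. Qed.

Lemma tcoefP (M : lmodType F) s c u v : tcoef M s (c *: u + v) = c *: tcoef M s u + tcoef M s v.
Proof. exact: linearP. Qed.

Lemma tcoefZ (M : lmodType F) s c u : tcoef M s (c *: u) = c *: tcoef M s u.
Proof. exact: linearZ. Qed.

Lemma tcoef_set0 (M : lmodType F) (u : tens M B) : tcoef M set0 u = 0.
Proof.
apply: (tens_ext (f := tcoef M set0) (g := \0 : {linear tens M B -> M})) => x b.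
by rewrite tcoefE ceval0 mulr0 scale0r.
Qed.

Lemma tcoef_tmap (M N : lmodType F) (f : {linear M -> N}) s u :
  tcoef N s (tmap f idfun u) = f (tcoef M s u).
Proof.
apply: (tens_ext (f := tcoef N s \o tmap f idfun) (g := f \o tcoef M s)) => x b /=.
by rewrite tmapE !tcoefE linearZ.
Qed.

Lemma ceval_expand (b : B) : b = \sum_sg ceval b (val sg) *: phi F sg.
Proof.
apply: cochainP => s; rewrite ceval_sum.
have [->|s0] := eqVneq s set0.
  by rewrite ceval0 big1 // => sg _; rewrite ceval0.
rewrite (bigD1 (exist _ s s0 : simplex n)) //= cevalZ ceval_phi eqxx mulr1 big1 ?addr0 //.
move=> sg ne; rewrite cevalZ ceval_phi; case: eqP => [E|_]; last by rewrite mulr0.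
by case/eqP: ne; apply: val_inj.
Qed.

(** The inverse of the coefficient map, [eps] being its own inverse. Filtration, degree and equality
    are read off coefficients through it. *)
Lemma tens_expand (M : lmodType F) (u : tens M B) :
  u = \sum_(sg : simplex n) pure (eps F #|val sg|.-1 *: tcoef M (val sg) u) (phi F sg : B).
Proof.
elim: (tens_span u) => [|c v w [x [b ->]] _ IH].
  rewrite big1 // => sg _; rewrite linear0 scaler0.
  by have := pure_linear_l (phi F sg : B) (-1) (0 : M) 0; rewrite scaler0 addr0 scaleN1r addNr.
rewrite {1}IH {1}[b]ceval_expand.
have bp := conj (@pure_linear_l F M B) (@pure_linear_r F M B) : bilin (@pure F M B).
rewrite (bilin_sumr bp) scaler_sumr -big_split; apply: eq_bigr => sg _ /=.
rewrite linearP scalerDr (bilinDl bp) tcoefE; congr (_ + _).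
rewrite (bilinZr bp) !(bilinZl bp) !scalerA; congr (_ *: _).
by rewrite -[LHS]mul1r -(eps_sq F #|val sg|.-1); ring.
Qed.

Section DegreeFiltration.
Context (A : complex F).
Implicit Types (u : tens A B).

Lemma tfilP N u : tfil N u <-> forall s, fil N (tcoef A s u).
Proof.
split=> [h s|h].
  apply: (span_min (Q := fun u => fil N (tcoef A s u))) h.
    by apply: submod_preim; apply: fil_submod.
  by move=> y [x [b [hx ->]]]; rewrite tcoefE; apply: submodZ hx; apply: fil_submod.
rewrite (tens_expand u); apply: submod_sum => [|sg _]; first exact: span_submod.
apply: span_gen; exists (eps F #|val sg|.-1 *: tcoef A (val sg) u), (phi F sg); split=> //.
by apply: submodZ; first exact: fil_submod.
Qed.

Lemma tdegP u : tdeg 0 u <-> fdeg (gr A) 0 (fun s => tcoef A s u).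
Proof.
split=> [h|[_ h]].
  split=> [|s]; first exact: tcoef_set0.
  apply: (span_min (Q := fun u => homog (gr A) (0 - (#|s|.-1)%:Z) (tcoef A s u))) h.
    by apply: submod_preim; apply: homog_submod.
  move=> y [p [q [x [b [pq hx /chomogP hb ->]]]]]; rewrite tcoefE.
  have [->|s0] := eqVneq s set0; first by rewrite ceval0 mulr0 scale0r; apply: (homog_submod _ _).1.
  have [E|/eqP nE] := eqVneq (#|s|.-1)%:Z q; last first.
    by rewrite hb // mulr0 scale0r; apply: (homog_submod _ _).1.
  by rewrite E -pq addrK; apply: submodZ hx; apply: homog_submod.
rewrite (tens_expand u); apply: submod_sum => [|sg _]; first exact: span_submod.
apply: span_gen; exists (0 - (#|val sg|.-1)%:Z), (#|val sg|.-1)%:Z.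
exists (eps F #|val sg|.-1 *: tcoef A (val sg) u), (phi F sg); split=> //.
- by rewrite subrK.
- by apply: submodZ (h _); apply: homog_submod.
- exact: phi_homog.
Qed.

Lemma tcoef_inj u v : (forall s, tcoef A s u = tcoef A s v) -> u = v.
Proof. by move=> h; rewrite (tens_expand u) (tens_expand v); apply: eq_bigr => sg _; rewrite h. Qed.

Lemma tcoef_surj (f : T -> A) : f set0 = 0 -> exists u, forall s, tcoef A s u = f s.
Proof.
move=> f0; exists (\sum_(sg : simplex n) pure (eps F #|val sg|.-1 *: f (val sg)) (phi F sg : B)).
move=> s; rewrite linear_sum [RHS](phi_expands f0 s); apply: eq_bigr => sg _ /=.
rewrite tcoefE ceval_phi; case: eqP => [->|_]; last by rewrite mulr0 !scale0r.
by rewrite mulr1 scalerA eps_sq.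
Qed.

(** A coefficient at a d-simplex has degree -d; its Koszul sign (-1)^d times the change (-1)^(d+1)
    of [eps] is -1. This is the origin of the minus sign in [curv]. *)
Lemma tcoef_delta u s : tdeg 0 u ->
  tcoef A s (tmap (ksign (gr A) 1) (ddelta B) u) = - bd (fun t => tcoef A t u) s.
Proof.
elim=> [|c v w [p [q [x [b [pq hx /chomogP hb ->]]]]] _ IH].
  rewrite !linear0 /bd big1 ?oppr0 // => v _; by rewrite linear0 scaler0.
have -> : bd (fun t => tcoef A t (c *: pure x b + w)) s
    = c *: bd (fun t => tcoef A t (pure x b)) s + bd (fun t => tcoef A t w) s.
  rewrite /bd scaler_sumr -big_split; apply: eq_bigr => v' _ /=.
  by rewrite linearP scalerDr !scalerA mulrC.
set D := tmap _ _.
have -> : tcoef A s (D (c *: pure x b + w)) = c *: tcoef A s (D (pure x b)) + tcoef A s (D w).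
  by rewrite !linearP.
rewrite IH opprD -scalerN; congr (_ *: _ + _); rewrite {}/D.
rewrite tmapE tcoefE /= cdeltaE (ksignE 1 hx) /cdelta_at mulr_sumr scaler_suml /bd -sumrN.
apply: eq_bigr => v' vs; rewrite tcoefE !scalerA -scaleNr; congr (_ *: _).
have [->|t0] := eqVneq (s :\ v') set0; first by rewrite ceval0 !mulr0 mul0r oppr0.
have [E|/eqP nE] := eqVneq (#|s :\ v'|.-1)%:Z q; last by rewrite hb // !mulr0 mul0r oppr0.
rewrite (face_dim vs t0) epsS /ksgn.
have -> : absz (1 * p) = #|s :\ v'|.-1.
  have -> : p = - (#|s :\ v'|.-1)%:Z by apply/eqP; rewrite -addr_eq0 E pq.
  by rewrite mul1r abszN.
set d := #|s :\ v'|.-1; rewrite exprS mulN1r mulrN !mulNr; congr (- _).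
have sq : (-1) ^+ d * (-1) ^+ d = 1 :> F by rewrite -expr2 sqrr_sign.
rewrite -[RHS]mulr1 -[X in _ = _ * X]sq; ring.
Qed.

End DegreeFiltration.
End Coefficients.

Lemma Tmap_ksign (F : fieldType) (V : lmodType F) (G : grading V) i p (u : Tbar V) :
  Thomog G p u -> Tmap (ksign G i) u = ksgn F i p *: u.
Proof.
have ksgnD a b : ksgn F i (a + b) = ksgn F i a * ksgn F i b.
  rewrite /ksgn -exprD mulrDr; set x := i * a; set y := i * b.
  by rewrite -signr_odd -[RHS]signr_odd; congr (_ ^+ _); lia.
have wZ c x t : word (c *: x :: t) = c *: word (x :: t) :> Tbar V.
  have w0 : word (0 :: t) = 0 :> Tbar V.
    by have := (@word_multilin F V).2 [::] t (-1) (0 : V) 0; rewrite scaler0 addr0 scaleN1r addNr.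
  by have := (@word_multilin F V).2 [::] t c x 0; rewrite addr0 w0 addr0.
elim=> [|c v w [t ht ->] _ IH]; first by rewrite linear0 scaler0.
rewrite linearP /= IH scalerDr scalerA [_ * c]mulrC -scalerA; congr (_ *: _ + _).
rewrite TmapE; elim: ht => [|a b x r hx hr IHr]; first by rewrite /= word_nil scaler0.
rewrite map_cons (ksignE i hx) wZ ksgnD -scalerA; congr (_ *: _).
case: r hr IHr => [|y r] hr IHr.
  by inversion hr; rewrite /ksgn mulr0 expr0 scale1r.
by rewrite -(TconsE x (y :: r)) -linearZ -IHr TconsE.
Qed.

Section Regroup.
Context (F : fieldType) (A : complex F) (n : nat).
Local Notation B := (cochain_dga F n).
Local Notation T := {set 'I_n.+1}.
Implicit Types (s : T) (t : tens A B) (U : tens (Tbar A) B).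

Definition tdegT U := span (fun U => exists p q u (c : B),
  [/\ p + q = 0, Thomog (gr A) p u, homog (dgr B) q c & U = pure u c]) U.

Lemma kcons_linear t : linear (@kcons F A B t).
Proof.
move=> c U V; elim: (tens_span t) => [|a v w [x [b ->]] _ IH].
  have E W : kcons (0 : tens A B) W = 0 by apply: (linear0 (tens_lift (kcons_pure_bilin W))).
  by rewrite !E scaler0 addr0.
have E W : kcons (a *: pure x b + w) W = a *: kcons (pure x b) W + kcons w W.
  exact: (linearP (tens_lift (kcons_pure_bilin W))).
have E1 : kcons (pure x b) (c *: U + V) = c *: kcons (pure x b) U + kcons (pure x b) V.
  rewrite /kcons !tens_liftE /kcons_pure /= /glift scaler_sumr -big_split.
  by apply: eq_bigr => i _; rewrite /= /kcons_at linearP.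
rewrite !E IH E1 !scalerDr !scalerA [a * c]mulrC -!addrA; congr (_ + _).
by rewrite addrCA.
Qed.

Lemma kcons_pureE p i p' (x : A) (b c : B) u : homog (gr A) p x -> homog (dgr B) i b ->
  Thomog (gr A) p' u ->
  kcons (pure x b) (pure u c) = ksgn F i p' *: pure (Tcons x u) (b * c).
Proof.
move=> hx hb hu; rewrite /kcons tens_liftE /kcons_pure (glift_homog _ hb).
rewrite /= /kcons_at kcons_compE (Tmap_ksign i hu) linearZ /=.
have bp : bilin (@pure F (Tbar A) B).
  by split; [apply: pure_linear_l|apply: pure_linear_r].
exact: (bilinZl bp).
Qed.

Lemma kcons0l U : kcons (0 : tens A B) U = 0.
Proof. exact: (linear0 (tens_lift (kcons_pure_bilin U))). Qed.

Lemma kconsPl c t t' U : kcons (c *: t + t') U = c *: kcons t U + kcons t' U.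
Proof. exact: (linearP (tens_lift (kcons_pure_bilin U))). Qed.

Lemma kcons0r t : kcons t 0 = 0.
Proof. by have := kcons_linear t (-1) 0 0; rewrite scaler0 addr0 scaleN1r addNr. Qed.

Lemma tdegT_kcons t U : tdeg 0 t -> tdegT U -> tdegT (kcons t U).
Proof.
move=> ht hU; elim: ht => [|a v w [p [i [x [b [pi hx hb ->]]]]] _ IHt].
  by rewrite kcons0l; apply: span0.
rewrite kconsPl; apply: span_linear => //.
elim: hU {IHt} => [|c V W [p' [q' [u [d [pq hu hd ->]]]]] _ IHU].
  by rewrite kcons0r; apply: span0.
rewrite kcons_linear; apply: span_linear => //; rewrite (kcons_pureE d hx hb hu).
rewrite -[_ *: _]addr0; apply: spanS; last exact: span0.
exists (p + p'), (i + q'), (Tcons x u), (b * d); split=> //.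
- by rewrite addrACA pi pq addr0.
- exact: Thomog_cons.
- exact: d_mul.
Qed.

(** Only splittings of s into faces of dimensions i and q' contribute. As p' = -q', the sign of
    moving b past u is (-1)^(i q') and cancels the cross term of [epsD]. *)
Lemma tcoef_kcons_pure s p i p' q' (x : A) (b d : B) (u : Tbar A) :
  homog (gr A) p x -> homog (dgr B) i b -> Thomog (gr A) p' u -> homog (dgr B) q' d ->
  p' + q' = 0 ->
  tcoef (Tbar A) s (kcons (pure x b) (pure u d))
  = star (fun s => tcoef A s (pure x b)) (fun s => tcoef (Tbar A) s (pure u d)) s.
Proof.
move=> hx hb hu hd pq; have bT := @Tcons_bilin F A.
have E : tcoef (Tbar A) s (kcons (pure x b) (pure u d))
    = ksgn F i p' *: ((eps F #|s|.-1 * cup_at b d s) *: Tcons x u).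
  by rewrite (kcons_pureE d hx hb hu) tcoefZ tcoefE -cupE.
apply: (etrans E); rewrite /cup_at {E}.
rewrite /star /conv mulr_sumr scaler_suml scaler_sumr; apply: eq_bigr => v0 vs.
rewrite !tcoefE (bilinZl bT) (bilinZr bT) !scalerA; congr (_ *: _).
have [l0 h0] := (low_neq0 vs, high_neq0 vs).
move/chomogP: hb => hb; move/chomogP: hd => hd.
have [El|/eqP nl] := eqVneq (#|lowf v0 s|.-1)%:Z i; last by rewrite hb // !mulr0 !mul0r !mulr0.
have [Eh|/eqP nh] := eqVneq (#|highf v0 s|.-1)%:Z q'; last by rewrite (hd (highf v0 s)) // !mulr0.
have Ed : #|s|.-1 = (#|lowf v0 s|.-1 + #|highf v0 s|.-1)%N.
  by have := card_low_high vs; rewrite -!card_gt0 in l0 h0; lia.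
have -> : ksgn F i p' = (-1) ^+ (#|lowf v0 s|.-1 * #|highf v0 s|.-1).
  have -> : p' = - (#|highf v0 s|.-1)%:Z by apply/eqP; rewrite -addr_eq0 Eh pq.
  by rewrite -El /ksgn mulrN abszN -PoszM absz_nat.
rewrite Ed epsD; set k := (_ * _)%N.
have sq : (-1) ^+ k * (-1) ^+ k = 1 :> F by rewrite -expr2 sqrr_sign.
by rewrite -[RHS]mulr1 -[X in _ = _ * X]sq; ring.
Qed.

Lemma tcoef_kcons s t U : tdeg 0 t -> tdegT U ->
  tcoef (Tbar A) s (kcons t U)
  = star (fun s => tcoef A s t) (fun s => tcoef (Tbar A) s U) s.
Proof.
move=> ht hU; have bT := @Tcons_bilin F A.
elim: ht => [|a v w [p [i [x [b [pi hx hb ->]]]]] _ IHt].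
  apply: (etrans (congr1 (tcoef (Tbar A) s) (kcons0l U))).
  by apply/(etrans (tcoef0 _ s))/esym/star0l => y; apply: tcoef0.
apply: (etrans (congr1 (tcoef (Tbar A) s) (kconsPl a (pure x b) w U))).
apply: (etrans (tcoefP s a _ _)); have -> : (fun s => tcoef A s (a *: pure x b + w))
    = (fun s => a *: tcoef A s (pure x b) + tcoef A s w) by apply: funext => y; apply: tcoefP.
apply: etrans (esym (star_linl _ _ _ _ _)); congr (_ *: _ + _); last exact: IHt.
elim: hU {IHt} => [|c V W [p' [q' [u [d [pq hu hd ->]]]]] _ IHU].
  apply: (etrans (congr1 (tcoef (Tbar A) s) (kcons0r (pure x b)))).
  by apply/(etrans (tcoef0 _ s))/esym/star0r => y; apply: tcoef0.
apply: (etrans (congr1 (tcoef (Tbar A) s) (kcons_linear (pure x b) c (pure u d) W))).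
apply: (etrans (tcoefP s c _ _)); have -> : (fun s => tcoef (Tbar A) s (c *: pure u d + W))
    = (fun s => c *: tcoef (Tbar A) s (pure u d) + tcoef (Tbar A) s W).
  by apply: funext => y; apply: tcoefP.
apply: etrans (esym (star_linr _ _ _ _ _)); congr (_ *: _ + _); last exact: IHU.
exact: tcoef_kcons_pure hx hb hu hd pq.
Qed.

Fixpoint cpow (a : T -> A) k : T -> Tbar A :=
  if k is j.+1 then star a (cpow a j) else fun s => word [:: a s].

Lemma ser_cpow (a : T -> A) N s : ser a N s = \sum_(k < N) cpow a k s.
Proof.
elim: N s => [|N IH] s; first by rewrite big_ord0.
rewrite big_ord_recl /=; congr (_ + _); rewrite /star.
have -> : ser a N = (fun s => \sum_(k < N) cpow a k s) by apply: funext => y.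
rewrite /conv exchange_big; apply: eq_bigr => v _ /=; exact: linear_sum.
Qed.

Lemma tcoef_regroup k t s : tdeg 0 t ->
  tdegT (regroup (nseq k.+1 t)) /\
  tcoef (Tbar A) s (regroup (nseq k.+1 t)) = cpow (fun s => tcoef A s t) k s.
Proof.
move=> ht; elim: k s => [|k IH] s.
  split; last exact: (tcoef_tmap (@Tsingle F A)).
  rewrite /=; elim: ht => [|a v w [p [i [x [b [pi hx hb ->]]]]] _ IH].
    by rewrite linear0; apply: span0.
  rewrite linearP; apply: span_linear => //; rewrite /= tmapE; apply: span_gen.
  by exists p, i, (word [:: x]), b; split=> //; apply: Thomog_single.
rewrite [regroup _]/(kcons t (regroup (nseq k.+1 t))).
split; first by apply: tdegT_kcons => //; apply: (IH set0).1.
rewrite tcoef_kcons //; last exact: (IH set0).1.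
by rewrite /=; apply: star_ext => // y; apply: (IH y).2.
Qed.

Lemma tcoef_sum_tsmap (A' : complex F) (f : {linear Tbar A -> Tbar A'}) t N s : tdeg 0 t ->
  tcoef A' s (\sum_(k < N) tsmap f (nseq k.+1 t)) = Tproj A' (f (ser (fun s => tcoef A s t) N s)).
Proof.
move=> ht; rewrite ser_cpow !linear_sum; apply: eq_bigr => k _.
by rewrite /tsmap (tcoef_tmap (Tproj A' \o f)) (tcoef_regroup k s ht).2.
Qed.

End Regroup.

Section NerveCoefficients.
Context (F : fieldType) (A : ainf F) (n : nat).
Local Notation B := (cochain_dga F n).
Implicit Types (t : tens A B).

Lemma tcoef_sum_tensQ t N s : tdeg 0 t ->
  tcoef A s (\sum_(k < N.+1) tensQ (nseq k.+1 t)) = curv (fun s => tcoef A s t) N.+1 s.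
Proof.
move=> ht; rewrite /tensQ big_split linearD /= tcoef_sum_tsmap //; congr (_ + _).
by rewrite big_ord_recl big1 //= addr0; apply: tcoef_delta.
Qed.

Lemma MC_tcoef t : @MC F (nerve_alg A n) t <->
  fdeg (gr A) 0 (fun s => tcoef A s t) /\ mc (fun s => tcoef A s t).
Proof.
have FS := fil_submod A.
have coefB N s : tcoef A s (0 - \sum_(k < N.+1) tensQ (nseq k.+1 t)) =
    - tcoef A s (\sum_(k < N.+1) tensQ (nseq k.+1 t)) by rewrite sub0r linearN.
split=> [[/tdegP hd hs]|[/tdegP hd hm]]; split=> //.
  move=> p s; have [N hN] := hs p.
  have hd' : tdeg 0 t by apply/tdegP.
  (* The bound N makes the partial sum small, and p makes the truncated curvature stable modulo
     F_p. *)
  have h : fil p (curv (fun s => tcoef A s t) (maxn N p).+1 s).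
    have /tfilP/(_ s) := hN (maxn N p).+1 (leqW (leq_maxl _ _)).
    by rewrite coefB (tcoef_sum_tensQ _ _ hd') => /(submodN (FS p)); rewrite opprK.
  apply: (cong_mem (FS p) _ h); apply: (cong_sym (FS p)); apply: (congB (FS p)).
    by apply: pQ_cong; apply: ser_stable_le; apply: leqW; apply: leq_maxr.
  exact: cong_refl.
(* The bound is a successor to exclude the empty sum, which does not contain the differential of the
   cochains. *)
move=> p; exists p.+1 => -[//|k]; rewrite ltnS => pk; apply/tfilP => s.
rewrite [X in fil p X]coefB tcoef_sum_tensQ //; apply: submodN => //.
by apply: (fil_le (leqW pk)); apply: hm.
Qed.

Lemma tcoef_restr m (th : omap m n) (t : nerve_alg A n) s :
  tcoef A s (nerve_restr A th t : tens A (cochain_dga F m)) = restr th (fun s => tcoef A s t) s.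
Proof.
rewrite /restr; case: eqP => E.
  apply: (tens_ext (f := tcoef A s \o tmap idfun (crestr th)) (g := tcoef A (th @: s))) => x b /=.
  by rewrite tmapE !tcoefE crestrE /crestr_at E eqxx.
apply: (tens_ext (f := tcoef A s \o tmap idfun (crestr th))
  (g := \0 : {linear tens A B -> A})) => x b /=.
by rewrite tmapE !tcoefE crestrE /crestr_at; case: eqP => // _; rewrite mulr0 scale0r.
Qed.

End NerveCoefficients.

(** * Homotopies *)

(** A relation that is functional in each dimension and stable under simplicial operators is a
    simplicial map: uniqueness makes the chosen values natural. *)
Lemma smor_of_rel (X Y : sset) (R : forall n, splx X n -> splx Y n -> Prop) :
  (forall n x, exists y, @R n x y) ->
  (forall n x y y', @R n x y -> @R n x y' -> y = y') ->
  (forall m n (th : omap m n) x y, @R n x y -> @R m (sact th x) (sact th y)) ->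
  exists f : smor X Y, forall n x, @R n x (sfun f x).
Proof.
move=> ex un nat.
have ex' n : exists g : splx X n -> splx Y n, forall x, R n x (g x).
  by have [h hh] := choice (ex n); exists h.
pose f n := projT1 (cid (ex' n)).
have hf n x : R n x (f n x) by exact: projT2 (cid (ex' n)) x.
have fn m n (th : omap m n) (x : splx X n) : f m (sact th x) = sact th (f n x).
  by apply: un (hf _ _) _; apply: nat.
by exists (SMor fn).
Qed.

Section NerveFunctions.
Context (F : fieldType) (A : ainf F).

Definition cf n (a : splx (nerve A) n) : {set 'I_n.+1} -> A := fun s => tcoef A s (sval a).

Lemma cf_deg n (a : splx (nerve A) n) : fdeg (gr A) 0 (cf a).
Proof. by have [] := (MC_tcoef (sval a)).1 (svalP a). Qed.

Lemma cf_mc n (a : splx (nerve A) n) : mc (cf a).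
Proof. by have [] := (MC_tcoef (sval a)).1 (svalP a). Qed.

Lemma cf_inj n (a b : splx (nerve A) n) : cf a = cf b -> a = b.
Proof.
by move=> E; apply: nerve_splx_eq; apply: tcoef_inj => s; have := congr1 (fun f => f s) E.
Qed.

Lemma cf_surj n (f : {set 'I_n.+1} -> A) : fdeg (gr A) 0 f -> mc f ->
  exists a : splx (nerve A) n, cf a = f.
Proof.
move=> hf mf; have [u hu] := tcoef_surj hf.1.
have E : (fun s => tcoef A s u) = f by apply: funext.
have Mu : @MC F (nerve_alg A n) u by apply/MC_tcoef; rewrite E.
by exists (exist (fun b : nerve_alg A n => MC b) u Mu).
Qed.

Lemma cf_act m n (th : omap m n) (a : splx (nerve A) n) : cf (sact th a) = restr th (cf a).
Proof. by apply: funext => s; apply: tcoef_restr. Qed.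

End NerveFunctions.

Section NerveMap.
Context (F : fieldType) (A A' : ainf F) (Th : amor A A').

Lemma path_eq_const n (a : {set 'I_n.+1} -> A) al :
  mc_image Th a al <-> path_eq Th a (fun=> 0) al.
Proof.
have E N s : pathcurv (thser Th a N) (fun=> 0) al N s = - (al s - thser Th a N s).
  by rewrite /pathcurv /pathser ser2_zero // linear0 /bd big1 ?add0r // => v _; rewrite scaler0.
have FS := fil_submod A'.
split=> h N s; first by rewrite E; apply: submodN => //; apply: h.
by have /(submodN (FS N)) := h N s; rewrite E opprK.
Qed.

Lemma nerve_map_exists : exists N : smor (nerve A) (nerve A'),
  is_nerve_map Th N /\ forall n (a : splx (nerve A) n), mc_image Th (cf a) (cf (sfun N a)).
Proof.
have [n a|n a al al' h h'|m n th a al h|N hN] :=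
    @smor_of_rel (nerve A) (nerve A') (fun n a al => mc_image Th (cf a) (cf al)).
- have [al hal him] := mc_image_exists Th (cf_deg a).
  have [y Ey] := cf_surj hal (mc_image_mc (cf_deg a) (@cf_mc _ _ _ a) him).
  by exists y; rewrite Ey.
- by apply: cf_inj; apply: mc_image_unique h h'.
- by rewrite !cf_act; apply: mc_image_restr h; case: (cf_deg a).
exists N; split=> // n a p; exists p => k pk; apply/tfilP => s.
rewrite linearB /= (tcoef_sum_tsmap _ _ _ ((tdegP (sval a)).2 (cf_deg a))).
by apply: fil_le pk _; apply: hN.
Qed.

End NerveMap.

Section HomotopyEquivalence.
Context (F : fieldType) (A A' : ainf F) (Th : amor A A').
Context (N : smor (nerve A) (nerve A')).
Hypothesis N_image : forall n (a : splx (nerve A) n), mc_image Th (cf a) (cf (sfun N a)).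
Context (hc : int -> cone A A' -> cone A A').
Hypothesis hc_linear : forall i c (x y : cone A A'),
  kdeg i x -> kdeg i y -> hc i (c *: x + y) = c *: hc i x + hc i y.
Hypothesis hc_deg : forall i (x : cone A A'), kdeg i x -> kdeg (i - 1) (hc i x).
Hypothesis hc_fil : forall i p (x : cone A A'), kdeg i x -> kfil p x -> kfil p (hc i x).
Hypothesis hc_htpy : forall i (x : cone A A'), kdeg i x ->
  cone_d Th (hc i x) + hc (i + 1) (cone_d Th x) = x.

Local Notation sol := (is_sol Th hc).

Lemma zero_kfd n r : kfd r (fun _ : {set 'I_n.+1} => 0 : cone A A').
Proof. by split=> // s; apply: (kdeg_submod _ _ _).1. Qed.

Lemma zero_coned n (s : {set 'I_n.+1}) : coned Th (fun=> 0) s = 0.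
Proof.
by rewrite /coned linear0 sub0r /bd big1 ?oppr0 // => v _; rewrite scaler0.
Qed.

Lemma restr_zero m n (th : omap m n) (U : lmodType F) : restr th (fun=> 0 : U) = fun=> 0.
Proof. by apply: funext => s; rewrite /restr if_same. Qed.

Lemma sol_mc n w (b : {set 'I_n.+1} -> A') k : kfd 0 w -> (forall s, coned Th w s = 0) ->
  fdeg (gr A') 0 b -> mc b -> sol w b k ->
  [/\ fdeg (gr A) 0 (kfst k), fdeg (gr A') (-1) (ksnd k), mc (kfst k) &
      path_eq Th (kfst k) (ksnd k) b].
Proof.
move=> hw dw hb mb hk; have [h1 h2] := (kfd_pair k).1 hk.1.
have [h3 h4] := (curvK_mc Th b k).1 (sol_curvK hc_linear hc_fil hc_htpy hw dw hb mb hk).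
by [].
Qed.

(* The homotopy inverse: the a with a path from its image to b and closed part 0. *)
Definition inv_rel n (b : splx (nerve A') n) (a : splx (nerve A) n) :=
  exists2 k, sol (fun=> 0) (cf b) k & cf a = kfst k.

Lemma inv_rel_unique n b a a' : @inv_rel n b a -> inv_rel b a' -> a = a'.
Proof.
move=> [k hk E] [k' hk' E']; apply: cf_inj; rewrite E E'.
by rewrite (sol_unique hc_linear hc_fil (cf_deg b) hk hk').
Qed.

Lemma inverse_exists : exists g : smor (nerve A') (nerve A), forall n b, @inv_rel n b (sfun g b).
Proof.
apply: smor_of_rel => [n b|n b a a'|m n th b a [k hk E]].
- have [k hk] := sol_exists Th hc_linear hc_deg hc_fil (@zero_kfd n 0) (cf_deg b).
  have [h1 _ h2 _] := sol_mc (@zero_kfd n 0) (@zero_coned n) (cf_deg b) (@cf_mc _ _ _ b) hk.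
  by have [a Ea] := cf_surj h1 h2; exists a, k.
- exact: inv_rel_unique.
exists (restr th k).
  rewrite cf_act -(restr_zero th).
  by apply: is_sol_restr hk; [apply: (hc0 hc_linear)|case: (cf_deg b)].
rewrite cf_act E; apply: funext => s; rewrite /kfst /restr; by case: ifP.
Qed.

Context (g : smor (nerve A') (nerve A)).
Hypothesis g_inv : forall n b, @inv_rel n b (sfun g b).

(** The constant path at the image of a. *)
Definition triv n (a : {set 'I_n.+1} -> A) (s : {set 'I_n.+1}) : cone A A' := (a s, 0).

Lemma triv_kfd n (a : {set 'I_n.+1} -> A) : fdeg (gr A) 0 a -> kfd 0 (triv a).
Proof.
move=> ha; apply/kfd_pair; split=> //; split=> // s; exact: (homog_submod _ _).1.
Qed.

Lemma trunc_kfd n r (eta : omap n 1) (k : {set 'I_n.+1} -> cone A A') :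
  kfd r k -> kfd r (trunc eta k).
Proof.
move=> [k0 hk]; split=> [|s]; first exact: trunc_set0.
by apply: trunc_in => //; apply: (kdeg_submod _ _ _).1.
Qed.

(* Truncating the closed part of (a, 0) along Delta^1 moves it from g (N a) to a. *)
Definition gf_datum n (eta : omap n 1) (a : {set 'I_n.+1} -> A) :=
  coned1 Th (trunc eta (hf hc 0 (triv a))).

Definition gf_rel n (p : splx (sprod (nerve A) (std_simplex 1)) n) (a' : splx (nerve A) n) :=
  exists2 k, sol (gf_datum p.2 (cf p.1)) (cf (sfun N p.1)) k & cf a' = kfst k.

Lemma trunc_hf_kfd n (eta : omap n 1) (a : {set 'I_n.+1} -> A) : fdeg (gr A) 0 a ->
  kfd (-1) (trunc eta (hf hc 0 (triv a))).
Proof.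
move=> ha; apply: trunc_kfd; rewrite -[-1](sub0r 1); apply: (kfd_hf hc_linear hc_deg).
exact: triv_kfd.
Qed.

Lemma gf_homotopic : shomotopic (smor_comp g N) (smor_id (nerve A)).
Proof.
have un n p a a' : @gf_rel n p a -> gf_rel p a' -> a = a'.
  move=> [k hk E] [k' hk' E']; apply: cf_inj; rewrite E E'.
  by rewrite (sol_unique hc_linear hc_fil (cf_deg _) hk hk').
have [n p|//|m n th p a' [k hk E]|H hH] := @smor_of_rel _ _ gf_rel.
- have hw := coned1_deg Th (trunc_hf_kfd p.2 (cf_deg p.1)).
  have dw s := coned_coned1 Th s (trunc_hf_kfd p.2 (cf_deg p.1)).1.
  have [k hk] := sol_exists Th hc_linear hc_deg hc_fil hw (cf_deg (sfun N p.1)).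
  have [h1 _ h2 _] := sol_mc hw dw (cf_deg _) (@cf_mc _ _ _ _) hk.
  by have [a Ea] := cf_surj h1 h2; exists a, k.
- exists (restr th k); last first.
    by rewrite cf_act E; apply: funext => s; rewrite /kfst /restr; case: ifP.
  have -> : gf_datum (sact th p).2 (cf (sact th p).1) = restr th (gf_datum p.2 (cf p.1)).
    rewrite /gf_datum -restr_coned1; last exact: (trunc_hf_kfd p.2 (cf_deg p.1)).1.
    rewrite restr_trunc -restr_hf; last by move=> i; apply: (hc0 hc_linear).
    congr (coned1 Th (trunc _ (hf hc 0 _))); apply: funext => s.
    by rewrite /= /triv cf_act /restr; case: ifP.
  rewrite [(sact th p).1]/(sact th p.1) sfun_nat cf_act.
  by apply: is_sol_restr hk => //; [apply: (hc0 hc_linear)|case: (cf_deg (sfun N p.1))].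
exists H => n x; split.
  (* Over the vertex 0 the datum is zero, which is the defining equation of the inverse at the image
     of x. *)
  apply: (@inv_rel_unique _ (sfun N x)) (g_inv _).
  have [k hk E] := hH n (x, omap_const n (ord0 : 'I_2)); exists k => //.
  have <- : gf_datum (omap_const n (ord0 : 'I_2)) (cf x) = fun=> 0; last by [].
  rewrite /gf_datum (_ : trunc _ _ = fun=> 0).
    by apply: funext => s; rewrite /coned1 linear0 add0r /bd big1 // => v _; rewrite scaler0.
  apply: funext => s; apply: trunc0.
  by rewrite /hf [triv _ _](triv_kfd (cf_deg x)).1 (hc0 hc_linear).
apply: (un _ (x, omap_const n (ord_max : 'I_2))) (hH n _) _.
(* Over the vertex 1 the datum is the closed part of [triv] itself, which is then the solution,
   because a constant path has no curvature. *)
exists (triv (cf x)) => //=.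
rewrite /gf_datum trunc1; have hk := triv_kfd (cf_deg x).
apply: (is_sol_of_curvK hc_linear hc_fil hc_htpy hk (cf_deg _)).
apply/curvK_mc; split; first exact: cf_mc.
exact/path_eq_const/N_image.
Qed.

(* Truncating the path from the image of g b to b moves its end from N (g b) to b. *)
Definition fg_rel n (p : splx (sprod (nerve A') (std_simplex 1)) n) (b : splx (nerve A') n) :=
  exists2 k, sol (fun=> 0) (cf p.1) k & path_eq Th (kfst k) (trunc p.2 (ksnd k)) (cf b).

Lemma trunc_fdeg n r (eta : omap n 1) (f : {set 'I_n.+1} -> A') :
  fdeg (gr A') r f -> fdeg (gr A') r (trunc eta f).
Proof.
move=> [f0 h]; split=> [|s]; first exact: trunc_set0.
by apply: trunc_in => //; apply: (homog_submod _ _).1.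
Qed.

Lemma fg_homotopic : shomotopic (smor_comp N g) (smor_id (nerve A')).
Proof.
have un n p b b' : @fg_rel n p b -> fg_rel p b' -> b = b'.
  move=> [k hk E] [k' hk' E']; apply: cf_inj.
  rewrite (sol_unique hc_linear hc_fil (cf_deg _) hk' hk) in E'.
  exact: path_endpoint_unique (cf_deg _) (cf_deg _) E E'.
have sol0 n (b : splx (nerve A') n) k (hk : sol (fun=> 0) (cf b) k) :=
  sol_mc (@zero_kfd n 0) (@zero_coned n) (cf_deg b) (@cf_mc _ _ _ b) hk.
have [n p|//|m n th p b [k hk E]|H hH] := @smor_of_rel _ _ fg_rel.
- have [k hk] := sol_exists Th hc_linear hc_deg hc_fil (@zero_kfd n 0) (cf_deg p.1).
  have [h1 h2 h3 _] := sol0 _ _ _ hk; have h2' := trunc_fdeg p.2 h2.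
  (* Only the degree of the truncated path matters here; its end is again Maurer-Cartan by
     [path_endpoint_mc]. *)
  have [b hb eb] := path_endpoint Th h1 h2'.
  have [y Ey] := cf_surj hb (path_endpoint_mc h1 h3 h2' hb eb).
  by exists y, k => //; rewrite Ey.
- have [h1 h2 _ _] := sol0 _ _ _ hk.
  exists (restr th k).
    rewrite [(sact th p).1]/(sact th p.1) cf_act -(restr_zero th).
    by apply: is_sol_restr hk; [apply: (hc0 hc_linear)|case: (cf_deg p.1)].
  have -> : kfst (restr th k) = restr th (kfst k).
    by apply: funext => s; rewrite /kfst /restr; case: ifP.
  have -> : ksnd (restr th k) = restr th (ksnd k).
    by apply: funext => s; rewrite /ksnd /restr; case: ifP.
  rewrite [(sact th p).2]/(omap_comp p.2 th) -restr_trunc cf_act.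
  by apply: path_eq_restr E; [case: h1|case: (trunc_fdeg p.2 h2)|case: (cf_deg b)].
exists H => n x; have [k hk E] := g_inv x; have [h1 h2 h3 h4] := sol0 _ _ _ hk; split.
  (* Over the vertex 0 the truncated path is zero, and a zero path ends at the image of its
     start. *)
  apply: (un _ (x, omap_const n (ord0 : 'I_2))) (hH n _) _; exists k => //=.
  have -> : trunc (omap_const n (ord0 : 'I_2)) (ksnd k) = fun=> 0.
    by apply: funext => s; apply: trunc0; case: h2.
  by rewrite -E; apply/path_eq_const; apply: N_image.
(* Over the vertex 1 the path is kept, and its end is x because k solves the equation for x. *)
apply: (un _ (x, omap_const n (ord_max : 'I_2))) (hH n _) _; exists k => //=.
by rewrite trunc1.
Qed.

End HomotopyEquivalence.

Theorem theorem1 (F : fieldType) (A A' : ainf F) (Theta : amor A A') :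
  weak_equivalence Theta ->
  exists N : smor (nerve A) (nerve A'),
    is_nerve_map Theta N /\ homotopy_equivalence N.
Proof.
move=> we; have [N [hN him]] := nerve_map_exists Theta; exists N; split=> //.
have [hc hhc] := cone_contraction we.
have hc1 i c x y : kdeg i x -> kdeg i y -> hc i (c *: x + y) = c *: hc i x + hc i y.
  by have [h _ _ _] := hhc i; apply: h.
have hc2 i x : kdeg i x -> kdeg (i - 1) (hc i x) by have [_ h _ _] := hhc i; apply: h.
have hc3 i p x : kdeg i x -> kfil p x -> kfil p (hc i x) by have [_ _ h _] := hhc i; apply: h.
have hc4 i x : kdeg i x -> cone_d Theta (hc i x) + hc (i + 1) (cone_d Theta x) = x.
  by have [_ _ _ h] := hhc i; apply: h.
have [g hg] := inverse_exists hc1 hc2 hc3 hc4.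
by exists g; split; [apply: gf_homotopic hg|apply: fg_homotopic hg].
Qed.
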